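(* Let $H$ be a real Hilbert space, $A:\mathcal D(A)\to H$ a positive self-adjoint operator with compact inverse, $V=\mathcal D(A^{1/2})$, $\tau>0$, $\mu$ an admissible memory kernel, and $b\in L^\infty_{loc}(0,+\infty)$ an on--off coefficient with switching times $(t_n)_{n\in\mathbb N}$, interval lengths $T_n=t_{n+1}-t_n$ and bounds $b_{2n+1}$. Consider $$u_{tt}(t)+Au(t)-\int_0^\infty\mu(s)Au(t-s)\,ds+b(t)u_t(t-\tau)=0,\quad t>0,\qquad u(t)=u_0(t),\quad t\le 0.\qquad (P)$$ Let $C,\alpha$ be the decay constants of the problem without delay feedback. Assume that $T_{2n}=T^*$ for all $n\in\mathbb N$, with $T^*\ge\tau$ and $T^*>\frac1\alpha\ln C$, and that $T_{2n+1}=\tilde T$ for all $n\in\mathbb N$, with $\tilde T\le\tau$. Put $c=Ce^{-\alpha T^*}\in(0,1)$ and assume $$\sup_{n\in\mathbb N}\ e^{b_{2n+1}\tilde T}\left(c+1-e^{-b_{2n+1}\tilde T}\right)=d<1.$$ Then there exist two positive constants $\gamma,\beta$ such that $$E_S(t)\le\gamma e^{-\beta t}E_S(0),\qquad t>0,$$ for every solution of (P).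
   Context: Admissible memory kernel: $\mu:[0,+\infty)\to[0,+\infty)$ with i) $\mu\in C^1(\mathbb R^+)\cap L^1(\mathbb R^+)$; ii) $\mu(0)=\mu_0>0$; iii) $\int_0^{+\infty}\mu(t)\,dt=\tilde\mu<1$; iv) $\mu'(t)\le-\delta\mu(t)$ for all $t$, for some $\delta>0$. On--off coefficient: there are times $0=t_0<t_1<t_2<\dots$ and numbers $b_{2n+1}>0$ such that, for all $n\in\mathbb N=\{0,1,2,\dots\}$, $b(t)=0$ for $t\in I_{2n}=[t_{2n},t_{2n+1})$ and $|b(t)|<b_{2n+1}$ for $t\in I_{2n+1}=[t_{2n+1},t_{2n+2})$. Write $T_n=t_{n+1}-t_n$. Phase space and solutions: with $\eta^t(s):=u(t)-u(t-s)$, $s>0$, let $\mathcal H=V\times H\times L^2_\mu((0,\infty);V)$, where $L^2_\mu((0,\infty);V)$ has squared norm $\int_0^\infty\mu(s)\|A^{1/2}w(s)\|_H^2ds$, and the squared norm of $\mathcal H$ is $(1-\tilde\mu)\|A^{1/2}u\|_H^2+\|v\|_H^2+\int_0^\infty\mu(s)\|A^{1/2}w(s)\|_H^2ds$. A solution of (P) with initial datum $U_0\in\mathcal H$ is $U=(u,u_t,\eta)\in C([0,\infty);\mathcal H)$ with $U(0)=U_0=(u_0(0),\partial_tu_0(0),\eta_0)$, $\eta_0(s)=u_0(0)-u_0(-s)$, such that for a.e. $t>0$, with $f(t)=-b(t)u_t(t-\tau)$ (which vanishes for $t<\tau$ because $b=0$ on $[0,t_1)$ and $t_1=T_0\ge\tau$),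 $$\langle u_{tt},\tilde v\rangle=-(1-\tilde\mu)\langle A^{1/2}u,A^{1/2}\tilde v\rangle_H-\int_0^\infty\mu(s)\langle A^{1/2}\eta(s),A^{1/2}\tilde v\rangle_Hds+\langle f,\tilde v\rangle_H,$$ $$\int_0^\infty\mu(s)\langle\eta_t(s)+\eta_s(s),A\tilde\eta(s)\rangle_Hds=\int_0^\infty\mu(s)\langle u_t,A\tilde\eta(s)\rangle_Hds$$ for all $\tilde v\in V$ and $\tilde\eta\in L^2_\mu(\mathbb R^+;\mathcal D(A))$. Standard energy: $E_S(t)=\frac12\|u_t(t)\|_H^2+\frac{1-\tilde\mu}2\|A^{1/2}u(t)\|_H^2+\frac12\int_0^\infty\mu(s)\|A^{1/2}\eta^t(s)\|_H^2ds$. Decay constants: it is a known result that for $b\equiv0$ the energy $E_S$ of every solution is non-increasing and there are constants $C>1$, $\alpha>0$, independent of the solution, with $E_S(t)\le Ce^{-\alpha t}E_S(0)$ for all $t\ge0$ and every solution. $C,\alpha$ denote such fixed constants. *)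

(* Defs.v *)
From HB Require Import structures.
From mathcomp Require Import all_boot all_order all_algebra.
From mathcomp Require Import sesquilinear.
From mathcomp Require Import all_classical all_reals all_analysis.

Set Implicit Arguments.
Unset Strict Implicit.
Unset Printing Implicit Defensive.

Import Order.TTheory GRing.Theory Num.Theory.
Import numFieldNormedType.Exports.

Local Open Scope classical_set_scope.
Local Open Scope ring_scope.

(* A real Hilbert space is a complete normed module [H] with a symmetric
   positive definite bilinear form [ip] inducing its norm. *)
Definition inner_product_norm (R : realType) (H : completeNormedModType R)
    (ip : {dot H for idfun}) : Prop :=
  forall x : H, ip x x = `|x| ^+ 2.

(* A partially defined operator: the values of [op] outside [dom] are
   irrelevant. *)
Record operator (R : realType) (H : completeNormedModType R) := Operator {
  dom : set H;
  op :> H -> H }.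

Section Operators.
Context {R : realType} {H : completeNormedModType R}.
Variable ip : {dot H for idfun}.
Implicit Types T A S : operator H.

Definition linear_operator T : Prop :=
  dom T 0 /\
  forall (k : R) (x y : H), dom T x -> dom T y ->
    dom T (k *: x + y) /\ T (k *: x + y) = k *: T x + T y.

(* The last clause says that the graphs of [T] and of its adjoint coincide. *)
Definition self_adjoint T : Prop :=
  [/\ linear_operator T,
      dense (dom T) &
      forall y z : H, (dom T y /\ T y = z) <->
        (forall x : H, dom T x -> ip (T x) y = ip x z)].

(* For an invertible self-adjoint operator, this is equivalent to strict
   positivity at every nonzero vector of the domain. *)
Definition positive_operator T : Prop :=
  forall x : H, dom T x -> 0 <= ip (T x) x.

Definition compact_operator (K : H -> H) : Prop :=
  forall D : set H, bounded_set D -> precompact (K @` D).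

Definition has_compact_inverse T : Prop :=
  exists K : H -> H,
    [/\ forall y, dom T (K y) /\ T (K y) = y,
        forall x, dom T x -> K (T x) = x &
        compact_operator K].

(* [S] is the (unique) positive self-adjoint square root of [A]; the equality
   of domains is part of [S^2 = A]. *)
Definition is_sqrt_operator S A : Prop :=
  [/\ self_adjoint S, positive_operator S,
      dom A = [set x | dom S x /\ dom S (S x)] &
      forall x : H, dom A x -> S (S x) = A x].

(* Bounded linear functionals on [D(S)] normed by [`|S x|]. *)
Definition in_dual S (l : H -> R) : Prop :=
  (forall (k : R) (x y : H), dom S x -> dom S y ->
     l (k *: x + y) = k * l x + l y) /\
  exists M : R, forall x : H, dom S x -> `|l x| <= M * `|S x|.

End Operators.

Section Kernel.
Context {R : realType}.
Local Notation leb := (@lebesgue_measure R).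
Implicit Types (mu : R -> R) (s : R).

Definition kernel_mass mu : R := \int[leb]_(s in `]0, +oo[) mu s.

(* Class C^1 is required on the open half-line only, with continuity up to 0
   so that [mu 0] is the limit of [mu] at 0. *)
Definition admissible_kernel mu : Prop :=
  [/\ (forall s, 0 <= s -> 0 <= mu s) /\ 0 < mu 0,
      {within `[0, +oo[, continuous mu},
      (forall s, 0 < s -> derivable mu s 1 /\ {for s, continuous (derive1 mu)}),
      leb.-integrable `]0, +oo[ (EFin \o mu) /\ kernel_mass mu < 1 &
      exists2 delta : R, 0 < delta &
        forall s, 0 < s -> derive1 mu s <= - delta * mu s].

(* The measure [mu(s)ds] on the open half-line is carried by this set. *)
Definition kernel_support mu : set R := [set s | 0 < s /\ 0 < mu s].

End Kernel.

Section MemorySpace.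
Context {R : realType} {H : completeNormedModType R}.
Local Notation leb := (@lebesgue_measure R).
Implicit Type (mu : R -> R) (T : operator H).

Definition simple_function (g : R -> H) : Prop :=
  finite_set (range g) /\ forall y : H, measurable (g @^-1` [set y]).

Definition strongly_measurable (D : set R) (f : R -> H) : Prop :=
  exists g : (R -> H)^nat, (forall n, simple_function (g n)) /\
    {ae leb, forall s, D s -> g ^~ s @ \oo --> f s}.

Definition memory_sqnorm mu T (w : R -> H) : R :=
  \int[leb]_(s in `]0, +oo[) (mu s * `|T (w s)| ^+ 2).

(* [L^2_mu((0, oo); D(T))], where [D(T)] carries the norm [`|T x|]: for an
   invertible [T], [T] is then an isometric isomorphism from [D(T)] onto [H], and
   measurability of [w] in [D(T)] is that of [T \o w] in [H]. *)
Definition memory_space mu T (w : R -> H) : Prop :=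
  [/\ {ae leb, forall s, kernel_support mu s -> dom T (w s)},
      strongly_measurable (kernel_support mu) (T \o w) &
      (\int[leb]_(s in `]0%R, +oo[) (mu s * `|T (w s)| ^+ 2)%:E < +oo)%E].

(* [S] stands for the square root of [A], so that [V = D(S)]. *)
Definition phase_space mu (S : operator H) (x : H * H * (R -> H)) : Prop :=
  dom S x.1.1 /\ memory_space mu S x.2.

Definition phase_sqnorm mu (S : operator H) (x : H * H * (R -> H)) : R :=
  (1 - kernel_mass mu) * `|S x.1.1| ^+ 2 + `|x.1.2| ^+ 2
  + memory_sqnorm mu S x.2.

End MemorySpace.

Section OnOff.
Context {R : realType}.
Local Notation leb := (@lebesgue_measure R).

Definition locally_ess_bounded (b : R -> R) : Prop :=
  measurable_fun (`]0, +oo[ : set R) b /\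
  forall K : set R, compact K -> K `<=` `]0, +oo[ ->
    exists M : R, {ae leb, forall t, K t -> `|b t| <= M}.

(* Only the odd-indexed values of [bnd] are relevant. *)
Definition on_off (b : R -> R) (ts bnd : nat -> R) : Prop :=
  [/\ ts 0%N = 0, (forall n, ts n < ts n.+1),
      (forall n, 0 < bnd n.*2.+1),
      (forall n t, ts n.*2 <= t < ts n.*2.+1 -> b t = 0) &
      (forall n t, ts n.*2.+1 <= t < ts n.*2.+2 -> `|b t| < bnd n.*2.+1)].

End OnOff.

Section Problem.
Context {R : realType} {H : completeNormedModType R}.
Variables (ip : {dot H for idfun}) (A S : operator H) (mu : R -> R).
Local Notation leb := (@lebesgue_measure R).
Implicit Types (u : R -> H) (b : R -> R) (tau t s : R).

Definition eta u t s : H := u t - u (t - s).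

Definition state u t : H * H * (R -> H) := (u t, derive1 u t, eta u t).

Definition state_diff u t t0 : H * H * (R -> H) :=
  (u t - u t0, derive1 u t - derive1 u t0, fun s => eta u t s - eta u t0 s).

(* [eta_t + eta_s] is the derivative of [(t, s) |-> eta^t(s)] in the direction
   [(1, 1)]; for data in the phase space neither partial derivative needs to
   exist on its own. *)
Definition eta_transport u t s : H :=
  'D_((1, 1) : R^o * R^o) (fun p : R^o * R^o => eta u p.1 p.2) (t, s).

(* [utt], with values in the dual of [V = D(S)], is the weak time derivative
   of [u_t] on the open half-line. *)
Definition weak_second_derivative u (utt : R -> H -> R) : Prop :=
  (forall t, 0 < t -> in_dual S (utt t)) /\
  forall v : H, dom S v ->
    locally_integrable `]0, +oo[ (utt ^~ v) /\
    forall s t, 0 < s -> s <= t ->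
      ip (derive1 u t) v - ip (derive1 u s) v
      = \int[leb]_(r in `[s, t]) utt r v.

Definition momentum_equation b tau u t (l : H -> R) : Prop :=
  forall v : H, dom S v ->
    l v = - (1 - kernel_mass mu) * ip (S (u t)) (S v)
          - \int[leb]_(s in `]0, +oo[) (mu s * ip (S (eta u t s)) (S v))
          + ip (- b t *: derive1 u (t - tau)) v.

Definition memory_equation u t : Prop :=
  forall w : R -> H, memory_space mu A w ->
    \int[leb]_(s in `]0, +oo[) (mu s * ip (eta_transport u t s) (A (w s)))
    = \int[leb]_(s in `]0, +oo[) (mu s * ip (derive1 u t) (A (w s))).

(* [u] is defined on the whole line and extends the history [u0]. Two-sided
   derivability of [u] at [t = 0] expresses that the initial velocity [u_t(0)]
   is the derivative of the history [u0] at [0]. *)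
Record is_solution b tau (u0 u : R -> H) : Prop := IsSolution {
  sol_history : forall t, t <= 0 -> u t = u0 t;
  sol_derivable : forall t, 0 <= t -> derivable (u : R^o -> H) t 1;
  sol_phase : forall t, 0 <= t -> phase_space mu S (state u t);
  sol_continuous : forall t0, 0 <= t0 ->
    phase_sqnorm mu S (state_diff u t t0)
      @[t --> within `[0, +oo[ (nbhs t0)] --> (0 : R);
  sol_equations : exists2 utt : R -> H -> R, weak_second_derivative u utt &
    {ae leb, forall t, 0 < t ->
      momentum_equation b tau u t (utt t) /\ memory_equation u t} }.

Definition energy u t : R :=
  2^-1 * `|derive1 u t| ^+ 2
  + (1 - kernel_mass mu) / 2 * `|S (u t)| ^+ 2
  + 2^-1 * \int[leb]_(s in `]0, +oo[) (mu s * `|S (eta u t s)| ^+ 2).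

(* With [b = 0] the equations do not depend on [tau]. *)
Definition decay_constants tau (C alpha : R) : Prop :=
  [/\ 1 < C, 0 < alpha &
      forall u0 u : R -> H, is_solution (fun=> 0) tau u0 u ->
        forall t, 0 <= t -> energy u t <= C * expR (- alpha * t) * energy u 0].

End Problem.

(* Main.v *)
(* Expanding in an orthonormal eigenbasis of [A^(1/2)] splits the problem into
   scalar Volterra equations [psi'' + lam (psi - mu * psi) + b psi'(. - tau) =
   0], and [E_S] is the sum of the energies of these modes. Because the kernel
   is nonincreasing, the energy [e] of one mode satisfies [e' <= |b(t)|
   |psi'(t)| |psi'(t - tau)|]. On an interval of length [Tstar] where [b]
   vanishes, [e] does not increase, and it is multiplied by at most [c = C
   exp(- alpha Tstar)]: continued past the interval without delay, the mode is
   a solution of the undelayed problem, to which the decay hypothesis applies.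
   On the next interval, of length at most [tau], the delayed velocity [psi'(t
   - tau)] belongs to the preceding undelayed interval, so that its
   contribution is bounded by the energy [e0] at the beginning of the period.
   Gronwall's inequality for [e + e0] then gives [e <= (e^(b T) (c + 1) - 1)
   e0 <= d e0] there, whence geometric decay along the periods, with the same
   constants for all the modes. *)

(* The energy estimate cannot be obtained by testing the equation of [u] with [u_t], which is only
   known to lie in [H] and not in [V]; an eigenvector does lie in [V], and the resulting mode has a
   continuous derivative. Differentiating the memory part of the energy of a mode would still bring
   in [mu'], which is bounded from above only, so that the history need not be integrable against
   it. Increments of the energy are therefore estimated directly, with errors uniform on bounded
   time intervals, and Gronwall's inequality is proved for such increments. Of the history one keeps
   measurability, square integrability against the kernel and continuity of translations
   ([memory_regular]); they are extracted from the state of the solution at time [0] and its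
   continuity there, after a correction on a null set. Since the decay hypothesis speaks of
   solutions with values in [H], a continued mode is put back on its eigenvector and checked to be a
   solution. The factor [d^-1] of the final bound pays for the incomplete period that contains
   [t]. *)
Require Import Defs.
From HB Require Import structures.
From mathcomp Require Import all_boot all_order all_algebra.
From mathcomp Require Import sesquilinear.
From mathcomp Require Import all_classical all_reals all_analysis.
From mathcomp Require Import measurable_realfun ring lra.
Import Order.TTheory GRing.Theory Num.Theory.
Import numFieldNormedType.Exports.
Local Open Scope classical_set_scope.
Local Open Scope ring_scope.

Set Implicit Arguments.
Unset Strict Implicit.
Unset Printing Implicit Defensive.

(** * Inner product spaces *)

Section InnerProduct.
Context {R : realType} {H : completeNormedModType R} (ip : {dot H for idfun}).
Hypothesis ip_norm : inner_product_norm ip.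
Implicit Types x y z : H.

Lemma ipC x y : ip x y = ip y x.
Proof. by rewrite hermC expr0 mul1r. Qed.

Lemma ipDl x y z : ip (x + y) z = ip x z + ip y z.
Proof. by rewrite linearDl. Qed.

Lemma ipDr x y z : ip z (x + y) = ip z x + ip z y.
Proof. by rewrite ipC ipDl !(ipC z). Qed.

Lemma ipZl a x z : ip (a *: x) z = a * ip x z.
Proof. by rewrite linearZl_LR. Qed.

Lemma ipZr a x z : ip z (a *: x) = a * ip z x.
Proof. by rewrite ipC ipZl ipC. Qed.

Lemma ip0l z : ip 0 z = 0.
Proof. by rewrite -(scale0r (0 : H)) ipZl mul0r. Qed.

Lemma ipNl x z : ip (- x) z = - ip x z.
Proof. by rewrite -scaleN1r ipZl mulN1r. Qed.

Lemma ipBl x y z : ip (x - y) z = ip x z - ip y z.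
Proof. by rewrite ipDl ipNl. Qed.

Lemma ipBr x y z : ip z (x - y) = ip z x - ip z y.
Proof. by rewrite ipC ipBl !(ipC z). Qed.

Lemma ip_suml n (f : 'I_n -> H) z :
  ip (\sum_(k < n) f k) z = \sum_(k < n) ip (f k) z.
Proof. by apply: (big_morph (fun x => ip x z)) => [x y|]; [exact: ipDl|exact: ip0l]. Qed.

Lemma sqnormB x y : `|x - y| ^+ 2 = `|x| ^+ 2 - 2 * ip x y + `|y| ^+ 2.
Proof. by rewrite -!ip_norm ipBl !ipBr (ipC y x); ring. Qed.

(** Stated for an arbitrary semidefinite form because it serves both [ip] and the form [ip (K x) y]
    of a compact operator, whose definiteness is itself derived from it. *)
Lemma semidefinite_cauchy_schwarz (q : H -> H -> R)
    (qDl : forall x y z, q (x + y) z = q x z + q y z)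
    (qZl : forall a x z, q (a *: x) z = a * q x z)
    (qC : forall x y, q x y = q y x) (q_ge0 : forall x, 0 <= q x x) x y :
  q x y ^+ 2 <= q x x * q y y.
Proof.
have Q t : 0 <= q x x + 2 * t * q x y + t ^+ 2 * q y y.
  have := q_ge0 (x + t *: y).
  rewrite qDl (qC x) (qC (t *: y)) !qDl !qZl (qC x (t *: y)) (qC y (t *: y)) !qZl (qC y x).
  by congr (is_true (_ <= _)); ring.
have [y0|y0] := eqVneq (q y y) 0.
  have [->|xy0] := eqVneq (q x y) 0; first by rewrite y0 mulr0 expr0n.
  (* When [q y y = 0] the quadratic polynomial is affine, and at this point it would take the value
     [-1]. *)
  have := Q (- (q x x + 1) / (2 * q x y)); rewrite y0 mulr0 addr0.
  have -> : 2 * (- (q x x + 1) / (2 * q x y)) * q x y = - (q x x + 1) by field.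
  lra.
have yp : 0 < q y y by rewrite lt_def y0 q_ge0.
have := Q (- q x y / q y y); rewrite -(pmulr_rge0 _ yp).
have -> : q y y * (q x x + 2 * (- q x y / q y y) * q x y
   + (- q x y / q y y) ^+ 2 * q y y) = q x x * q y y - q x y ^+ 2 by field.
by rewrite subr_ge0.
Qed.

Lemma cauchy_schwarz x y : `|ip x y| <= `|x| * `|y|.
Proof.
rewrite -(@ler_pXn2r _ 2) ?nnegrE ?mulr_ge0// real_normK ?num_real// exprMn.
rewrite -!ip_norm; apply: semidefinite_cauchy_schwarz => *.
- exact: ipDl.
- exact: ipZl.
- exact: ipC.
- by rewrite ip_norm sqr_ge0.
Qed.

End InnerProduct.

(** * Compact symmetric operators and the eigenbasis of the square root *)

Section CompactSymmetric.
Context {R : realType} {H : completeNormedModType R} (ip : {dot H for idfun}).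
Hypothesis ip_norm : inner_product_norm ip.
Implicit Types x y z : H.
Variable K : H -> H.
Hypothesis K_linear : forall (k : R) x y, K (k *: x + y) = k *: K x + K y.
Hypothesis K_sym : forall x y, ip (K x) y = ip x (K y).
Hypothesis K_ge0 : forall x, 0 <= ip (K x) x.
Hypothesis K_inj : forall x, K x = 0 -> x = 0.
Hypothesis K_compact : compact_operator K.
Hypothesis K_dense : forall x (e : R), 0 < e -> exists y, `|x - K y| < e.

Let K0 : K 0 = 0.
Proof. by have := K_linear (-1) 0 0; rewrite scaler0 addr0 scaleN1r addNr. Qed.

Let KZ k x : K (k *: x) = k *: K x.
Proof. by rewrite -[k *: x]addr0 K_linear K0 addr0. Qed.

Let KD x y : K (x + y) = K x + K y.
Proof. by rewrite -[x in LHS]scale1r K_linear scale1r. Qed.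

Let KB x y : K (x - y) = K x - K y.
Proof. by rewrite KD -scaleN1r KZ scaleN1r. Qed.

(** A cluster point of the image sequence replaces a convergent subsequence: the later arguments
    only need indices beyond any given [N] at which the image is close to [p]. *)
Lemma compact_operator_cluster (u : nat -> H) (M : R) :
  (forall n, `|u n| <= M) ->
  exists p, forall (e : R) N, 0 < e -> exists2 n, (N <= n)%N & `|K (u n) - p| < e.
Proof.
move=> uM; pose D := [set x : H | `|x| <= M].
have bD : bounded_set D.
  by exists M; split; [exact: num_real|move=> N MN x /= /le_trans; apply; exact: ltW].
have cl := K_compact bD; rewrite precompactE in cl.
have [|p [_ cp]] := cl ((fun n => K (u n)) @ \oo) _.
  by exists 0%N => // n _ /=; apply: subset_closure; exists (u n) => //; exact: uM.
exists p => e N e0.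
have [|z [[n Nn <-]] /= pz] := cp [set z | exists2 n, (N <= n)%N & K (u n) = z]
    (ball p e) _ (nbhsx_ballx p e e0).
  by exists N => // n /= Nn; exists n.
exists n => //; rewrite distrC; by rewrite -ball_normE in pz.
Qed.

Lemma compact_operator_bounded : exists2 B : R, 0 < B & forall x, `|K x| <= B * `|x|.
Proof.
pose D := [set x : H | `|x| <= 1].
have bD : bounded_set D.
  by exists 1; split; [exact: num_real|move=> N MN x /= /le_trans; apply; exact: ltW].
have cl := K_compact bD; rewrite precompactE in cl.
have [B [_ hB]] := compact_bounded cl.
have hB1 x : `|x| <= 1 -> `|K x| <= `|B| + 1.
  move=> x1; apply: (hB (`|B| + 1)); last by apply: subset_closure; exists x.
  by rewrite (le_lt_trans (ler_norm _))// ltrDl.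
exists (`|B| + 1); first by rewrite ltr_wpDl.
move=> x; have [->|x0] := eqVneq x 0; first by rewrite K0 !normr0 mulr0.
have nx : 0 < `|x| by rewrite normr_gt0.
have := hB1 (`|x|^-1 *: x); rewrite normrZ normfV normr_id mulVf ?gt_eqF// => /(_ (lexx _)).
by rewrite KZ normrZ normfV normr_id mulrC ler_pdivrMr.
Qed.

Let form_cauchy_schwarz x y : ip (K x) y ^+ 2 <= ip (K x) x * ip (K y) y.
Proof.
apply: (semidefinite_cauchy_schwarz (q := fun x y => ip (K x) y)) => //.
- by move=> a b c; rewrite KD ipDl.
- by move=> a b c; rewrite KZ ipZl.
- by move=> a b; rewrite K_sym ipC.
Qed.

Let K_gt0 x : x != 0 -> 0 < ip (K x) x.
Proof.
move=> x0; rewrite lt_def K_ge0 andbT; apply: contra_neq x0 => kx0.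
apply: K_inj; apply/eqP; rewrite -normr_eq0 -sqrf_eq0 -ip_norm -sqrf_eq0.
by rewrite eq_le sqr_ge0 andbT (le_trans (form_cauchy_schwarz _ _))// kx0 mul0r.
Qed.

(* The eigenvector maximises [<K x, x>] on the unit sphere of [M]; if [M] is
   trivial, [0] is returned. *)
Lemma max_eigenvector (M : set H) :
    M 0 -> (forall (k : R) x y, M x -> M y -> M (k *: x + y)) -> closed M ->
    (forall x, M x -> M (K x)) ->
  exists e, exists2 k : R, 0 < k &
    [/\ M e, K e = k *: e, forall y, M y -> `|K y| <= k * `|y| &
        `|e| = 1 \/ e = 0 /\ forall y, M y -> y = 0].
Proof.
move=> M0 Mlin Mcl MK.
have MZ k x : M x -> M (k *: x) by move=> Mx; rewrite -[_ *: _]addr0; exact: Mlin.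
have [triv|/existsNP[y0 /not_implyP[My0 /eqP y0_neq0]]] :=
    pselect (forall y, M y -> y = 0).
  exists 0, 1 => //; split=> //.
  - by rewrite K0 scaler0.
  - by move=> y /triv ->; rewrite K0 !normr0 mulr0.
  - by right.
have [B B0 KBd] := compact_operator_bounded.
pose Q := [set ip (K x) x | x in [set x | M x /\ `|x| = 1]].
have unitM x : M x -> x != 0 -> [set x | M x /\ `|x| = 1] (`|x|^-1 *: x).
  move=> Mx x0; split; first exact: MZ.
  by rewrite normrZ normfV normr_id mulVf ?normr_eq0.
have Qle x : M x -> `|x| = 1 -> ip (K x) x <= B.
  move=> Mx x1; rewrite (le_trans (ler_norm _))// (le_trans (cauchy_schwarz ip_norm _ _))//.
  by rewrite x1 mulr1 (le_trans (KBd _))// x1 mulr1.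
have supQ : has_sup Q.
  split; first by exists (ip (K (`|y0|^-1 *: y0)) (`|y0|^-1 *: y0));
    exists (`|y0|^-1 *: y0) => //; exact: unitM.
  by exists B => _ [x [Mx x1] <-]; exact: Qle.
pose m := sup Q.
have ubm y : M y -> ip (K y) y <= m * `|y| ^+ 2.
  move=> My; have [->|yn0] := eqVneq y 0; first by rewrite K0 ip0l normr0 expr0n mulr0.
  have ny : 0 < `|y| by rewrite normr_gt0.
  have : ip (K (`|y|^-1 *: y)) (`|y|^-1 *: y) <= m.
    by apply: sup_upper_bound => //; exists (`|y|^-1 *: y) => //; exact: unitM.
  rewrite KZ ipZl ipZr mulrA -expr2 exprVn mulrC ler_pdivrMr// ?exprn_gt0//.
have m0 : 0 < m.
  have := ubm _ My0; have /K_gt0 k0 := y0_neq0.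
  move=> /(lt_le_trans k0); rewrite pmulr_lgt0// exprn_gt0// normr_gt0//.
(* Cauchy-Schwarz for the form of [K], applied to [x] and [K x], together with the bound [ubm] at
   [K x], which lies in [M] again. *)
have KK x : M x -> `|K x| ^+ 2 <= m * ip (K x) x.
  move=> Mx; have [->|kx0] := eqVneq (K x) 0; first by rewrite normr0 expr0n ip0l mulr0.
  have := form_cauchy_schwarz x (K x); rewrite ip_norm => h.
  have kp : 0 < `|K x| ^+ 2 by rewrite exprn_gt0// normr_gt0.
  rewrite -(ler_pM2r kp) -expr2 (le_trans h)//.
  rewrite [leRHS](_ : _ = ip (K x) x * (m * `|K x| ^+ 2)); last by ring.
  rewrite ler_wpM2l// ?K_ge0//; exact: ubm (MK _ Mx).
have Kle y : M y -> `|K y| <= m * `|y|.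
  move=> My; rewrite -(@ler_pXn2r _ 2) ?nnegrE ?mulr_ge0 ?(ltW m0)//.
  rewrite (le_trans (KK _ My))// exprMn expr2 -mulrA ler_wpM2l ?ubm// ltW//.
have /choice[x xP] : forall n : nat, exists x, [/\ M x, `|x| = 1 & m - n.+1%:R^-1 < ip (K x) x].
  move=> n; have [|_ [x [Mx x1] <-] h] := sup_adherent (eps := n.+1%:R^-1) _ supQ.
    by rewrite invr_gt0.
  by exists x.
have [|p pP] := compact_operator_cluster (u := x) (M := 1).
  by move=> n; case: (xP n) => _ -> _.
have approx (e : R) : 0 < e -> exists n, `|K (x n) - p| < e /\ `|m *: x n - p| < 2 * e.
  move=> e0; have e20 : 0 < e ^+ 2 / m by rewrite divr_gt0// exprn_gt0.
  have [N _ hN] := near_infty_natSinv_lt (PosNum e20).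
  have [n Nn hn] := pP e N e0; exists n; split=> //.
  have [Mx x1 xm] := xP n.
  (* Expanding the square and using [KK] bounds it by [m * (m - ip (K (x n)) (x n))], which is small
     along a maximising sequence. Hence [x n] is an approximate eigenvector. *)
  have : `|K (x n) - m *: x n| ^+ 2 < e ^+ 2.
    rewrite (sqnormB ip_norm) normrZ x1 mulr1 (gtr0_norm m0) ipZr.
    apply: (@le_lt_trans _ _ (m * (m - ip (K (x n)) (x n)))).
      have := KK _ Mx; nra.
    have h : m - ip (K (x n)) (x n) < e ^+ 2 / m.
      rewrite (le_lt_trans _ (hN n Nn))//= ltW// ltrBlDr -ltrBlDl //.
    by rewrite mulrC -ltr_pdivlMr.
  rewrite ltr_pXn2r ?nnegrE ?(ltW e0)// => h.
  rewrite -(subrKA (K (x n))) (le_lt_trans (ler_normD _ _))// mulr_natl mulr2n ltrD//.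
  by rewrite distrC.
have np : `|p| = m.
  apply/eqP; rewrite -subr_eq0 -normr_le0; apply/ler_addgt0Pl => e e0; rewrite addr0.
  have [n [_ h]] := approx (e / 2) (divr_gt0 e0 (ltr0Sn _ 1)).
  have [_ x1 _] := xP n.
  rewrite -(_ : `|m *: x n| = m); last by rewrite normrZ x1 mulr1 gtr0_norm.
  rewrite (le_trans (ler_dist_dist _ _))// distrC (le_trans (ltW h))//.
  by rewrite mulrC divfK.
have Mp : M p.
  apply: Mcl => A /nbhs_ballP[e /= e0 eA].
  have [n [_ h]] := approx (e / 2) (divr_gt0 e0 (ltr0Sn _ 1)).
  exists (m *: x n); split; first by apply: MZ; case: (xP n).
  by apply: eA; rewrite -ball_normE /= distrC (lt_le_trans h)// mulrC divfK.
have Kp : K p = m *: p.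
  apply/eqP; rewrite -subr_eq0 -normr_le0; apply/ler_addgt0Pl => e e0; rewrite addr0.
  have c0 : 0 < 2 * B + m by rewrite addr_gt0// mulr_gt0.
  have [n [h1 h2]] := approx (e / (2 * B + m)) (divr_gt0 e0 c0).
  rewrite -(subrKA (K (m *: x n))) (le_trans (ler_normD _ _))//.
  rewrite -KB KZ -scalerBr normrZ (gtr0_norm m0) distrC.
  rewrite (le_trans (lerD (KBd _) (ltW _ : _ <= m * (e / (2 * B + m)))))//.
    by rewrite ltr_pM2l// distrC.
  apply: (@le_trans _ _ (B * (2 * (e / (2 * B + m))) + m * (e / (2 * B + m)))).
    by rewrite lerD2r ler_wpM2l ?(ltW B0)// distrC ltW.
  by rewrite le_eqVlt; apply/orP; left; apply/eqP; field; rewrite gt_eqF.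
have p0 : p != 0 by rewrite -normr_eq0 np gt_eqF.
exists (`|p|^-1 *: p), m => //; split => //.
- exact: MZ.
- by rewrite KZ Kp !scalerA mulrC.
- by left; have [_ ->] := unitM _ Mp p0.
Qed.


(** Each new vector maximises the quadratic form on the orthogonal complement of its predecessors.
    Once that complement is trivial the sequence goes on with zero vectors, so that it is indexed by
    [nat] in every dimension. Completeness holds because [K] becomes small on the successive
    complements and has dense range. *)
Lemma compact_symmetric_eigenbasis :
  exists (e : nat -> H) (k : nat -> R),
    [/\ forall n, 0 < k n /\ K (e n) = k n *: e n,
        forall n, `|e n| = 1 \/ e n = 0 &
        forall x, (\sum_(i < n) ip x (e i) ^+ 2) @[n --> \oo] --> `|x| ^+ 2].
Proof.
pose M (l : seq H) := [set x : H | forall z, z \in l -> ip x z = 0].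
pose good (l : seq H) (ek : H * R) := [/\ M l ek.1, 0 < ek.2, K ek.1 = ek.2 *: ek.1,
  forall y, M l y -> `|K y| <= ek.2 * `|y| &
  `|ek.1| = 1 \/ ek.1 = 0 /\ forall y, M l y -> y = 0].
(* The choice function needs a value at every list, but [good] is claimed only for lists of
   eigenvectors, whose orthogonal complement is stable under [K]. *)
have /choice[f fP] : forall l, exists ek,
    (forall z, z \in l -> exists k, K z = k *: z) -> good l ek.
  move=> l; have [lP|nlP] := pselect (forall z, z \in l -> exists k, K z = k *: z); last first.
    by exists (0, 0) => /nlP.
  have [||||e [k k0 [Me Ke Mk e1]]] := @max_eigenvector (M l).
  - by move=> z _; rewrite ip0l.
  - by move=> a x y Mx My z zl; rewrite ipDl ipZl Mx// My// mulr0 addr0.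
  - move=> x clx z zl; apply/eqP; rewrite -normr_le0; apply/ler_addgt0Pl => r r0; rewrite addr0.
    have z10 : 0 < `|z| + 1 by rewrite ltr_wpDl.
    have [y [My]] := clx (ball x (r / (`|z| + 1))) (nbhsx_ballx _ _ (divr_gt0 r0 z10)).
    rewrite -ball_normE /= => xy.
    rewrite -[x](subrK y) ipDl (My _ zl) addr0 (le_trans (cauchy_schwarz ip_norm _ _))//.
    rewrite (le_trans (ler_wpM2r _ (ltW xy)))// mulrAC ler_pdivrMr// ler_pM2l// lerDl//.
  - by move=> x Mx z zl; rewrite K_sym; have [k ->] := lP _ zl; rewrite ipZr Mx// mulr0.
  - by exists (e, k).
pose L := fix L n := if n is m.+1 then (f (L m)).1 :: L m else [::].
have LP n : forall z, z \in L n -> exists k, K z = k *: z.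
  elim: n => [//|n IH] z /=; rewrite inE => /orP[/eqP ->|/IH//].
  by exists (f (L n)).2; case: (fP _ IH).
pose e n := (f (L n)).1; pose k n := (f (L n)).2.
have gP n : good (L n) (e n, k n) by rewrite /e /k -surjective_pairing; exact: fP (LP n).
have memL n i : (i < n)%N -> e i \in L n.
  elim: n => [//|n IH]; rewrite ltnS leq_eqVlt => /orP[/eqP ->|/IH h] /=.
    by rewrite mem_head.
  by rewrite inE h orbT.
have Lmem n z : z \in L n -> exists2 i, (i < n)%N & z = e i.
  elim: n => [//|n IH] /=; rewrite inE => /orP[/eqP ->|/IH[i ni ->]]; first by exists n.
  by exists i => //; rewrite ltnS ltnW.
have eigen n : K (e n) = k n *: e n by case: (gP n).
have k0 n : 0 < k n by case: (gP n).
have orth i j : (i < j)%N -> ip (e j) (e i) = 0.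
  by move=> ij; case: (gP j) => /= h _ _ _ _; apply: h; exact: memL.
have unit n : `|e n| = 1 \/ e n = 0.
  by case: (gP n) => _ _ _ _ [|[]]; [left|right].
have eD n y : ip (ip y (e n) *: e n) (e n) = ip y (e n).
  by rewrite ipZl ip_norm; case: (unit n) => ->;
    rewrite ?normr1 ?expr1n ?mulr1// -(scale0r (0:H)) ipZr !mul0r.
pose r n x := x - \sum_(i < n) ip x (e i) *: e i.
have rS n x : r n.+1 x = r n x - ip x (e n) *: e n by rewrite /r big_ord_recr /= opprD addrA.
have rM n x i : (i < n)%N -> ip (r n x) (e i) = 0.
  elim: n => [//|n IH]; rewrite ltnS leq_eqVlt rS ipBl => /orP[/eqP ->|ni].
    rewrite eD /r ipBl ip_suml big1 ?subr0 ?subrr// => j _.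
    by rewrite ipZl (ipC _ (e j)) orth ?mulr0.
  by rewrite IH// ipZl (orth _ _ ni) mulr0 subr0.
have rML n x : M (L n) (r n x) by move=> z /Lmem[i ni ->]; exact: rM.
have rip n x : ip (r n x) (e n) = ip x (e n).
  rewrite /r ipBl ip_suml big1 ?subr0// => j _.
  by rewrite ipZl (ipC _ (e j)) orth ?mulr0.
have rnorm n x : `|r n x| ^+ 2 = `|x| ^+ 2 - \sum_(i < n) ip x (e i) ^+ 2.
  elim: n => [|n IH]; first by rewrite /r !big_ord0 !subr0.
  rewrite rS (sqnormB ip_norm) IH big_ord_recr /= ipZr rip -(ip_norm (_ *: _)) ipZr eD.
  by ring.
have rdec n m x : (n <= m)%N -> `|r m x| <= `|r n x|.
  move=> nm; rewrite -(@ler_pXn2r _ 2) ?nnegrE// !rnorm lerD2l lerN2.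
  rewrite -(subnKC nm) big_split_ord /= lerDl sumr_ge0// => i _; exact: sqr_ge0.
have rle n x : `|r n x| <= `|x| by have := rdec 0%N n x (leq0n n); rewrite {2}/r big_ord0 subr0.
have rB n x y : r n (x - y) = r n x - r n y.
  rewrite /r; under eq_bigr do rewrite ipBl scalerBl.
  by rewrite sumrB !opprD !opprK addrACA.
have rK n y : r n (K y) = K (r n y).
  rewrite /r KB; congr (_ - _); elim: n => [|n IH]; first by rewrite !big_ord0 K0.
  by rewrite !big_ord_recr /= KD -IH KZ eigen K_sym eigen ipZr scalerA mulrC.
(* Otherwise all the vectors are of norm one with eigenvalues above [d]. Their images are then
   orthogonal of norm above [d], hence at mutual distance above [d], against the existence of a
   cluster point. *)
have small (d : R) : 0 < d -> exists n, forall y, M (L n) y -> `|K y| <= d * `|y|.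
  move=> d0; have [[n [en|kn]]|nex] := pselect (exists n, e n = 0 \/ k n <= d).
  - exists n => y My; case: (gP n) => _ _ _ _ [|[_ /(_ _ My) ->]].
      by rewrite /= en normr0 => /eqP; rewrite eq_sym oner_eq0.
    by rewrite K0 !normr0 mulr0.
  - exists n => y My; case: (gP n) => _ _ _ /(_ _ My) h _.
    by rewrite (le_trans h)// ler_wpM2r.
  have e1 n : `|e n| = 1 by case: (unit n) => // en; case: nex; exists n; left.
  have kd n : d < k n by rewrite ltNge; apply/negP => h; apply: nex; exists n; right.
  have [n|p pP] := compact_operator_cluster (u := e) (M := 1); first by rewrite e1.
  have [n _ h1] := pP (d / 2) 0%N (divr_gt0 d0 (ltr0Sn _ 1)).
  have [m nm h2] := pP (d / 2) n.+1 (divr_gt0 d0 (ltr0Sn _ 1)).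
  have : `|K (e m) - K (e n)| < d.
    rewrite -(subrKA p) (le_lt_trans (ler_normD _ _))// [ltRHS](splitr d) ltrD//.
    by rewrite distrC.
  rewrite -(@ltr_pXn2r _ 2) ?nnegrE ?(ltW d0)// (sqnormB ip_norm) !eigen ipZl ipZr (orth _ _
    nm).
  rewrite !mulr0 subr0 !normrZ !e1 !mulr1 !gtr0_norm ?k0// => h.
  have := kd m; have := kd n; nra.
exists e, k; split => // x.
apply/cvgrPdist_le => /= eps eps0.
have [x0|x0] := eqVneq x 0.
  near=> n; rewrite x0 normr0 expr0n big1 ?subrr ?normr0 ?ltW// => i _.
  by rewrite ip0l expr0n.
have r0 : 0 < `|x| by rewrite normr_gt0.
(* The squared remainder is at most the norm of [r N x] times that of [x]. In [r N x] the part
   coming from [x - K y] is small by density, and [r N (K y) = K (r N y)] is small by the choice of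
   [N]. *)
have [y xy] := K_dense x (divr_gt0 (divr_gt0 eps0 r0) (ltr0Sn _ 1)).
have y0 : 0 < `|y| + 1 by rewrite ltr_wpDl.
have [N hN] := small _ (divr_gt0 (divr_gt0 (divr_gt0 eps0 r0) (ltr0Sn _ 1)) y0).
near=> n; have Nn : (N <= n)%N by near: n; exists N.
rewrite -rnorm ger0_norm ?sqr_ge0// (le_trans (_ : _ <= `|r N x| * `|x|))//.
  rewrite expr2 ler_pM// ?rle// rdec//.
rewrite -ler_pdivlMr//.
rewrite (_ : r N x = r N (x - K y) + r N (K y)); last by rewrite rB subrK.
rewrite (le_trans (ler_normD _ _))// [leRHS](splitr) lerD//.
  by rewrite (le_trans (rle _ _))// ltW.
rewrite rK (le_trans (hN _ (rML _ _)))// mulrAC ler_pdivrMr// ler_pM2l ?divr_gt0//.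
by rewrite (le_trans (rle _ _))// lerDl.
Unshelve. all: by end_near. Qed.

End CompactSymmetric.

Section SquareRootEigenbasis.
Context {R : realType} {H : completeNormedModType R} (ip : {dot H for idfun}).
Hypothesis ip_norm : inner_product_norm ip.
Implicit Types (T A S : operator H) (x y z : H).

Lemma linear_operator0 T : linear_operator T -> T 0 = 0.
Proof.
move=> [T0 Tl]; have [_] := Tl 1 0 0 T0 T0.
by rewrite !scale1r addr0 => /eqP; rewrite eq_sym -subr_eq0 addrK => /eqP.
Qed.

Lemma linear_operatorZ T k x : linear_operator T -> dom T x ->
  dom T (k *: x) /\ T (k *: x) = k *: T x.
Proof.
move=> Tlin Tx; have [T0 Tl] := Tlin; have := Tl k x 0 Tx T0.
by rewrite !addr0 (linear_operator0 Tlin) addr0.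
Qed.

Lemma linear_operatorB T x y : linear_operator T -> dom T x -> dom T y ->
  dom T (x - y) /\ T (x - y) = T x - T y.
Proof.
move=> Tlin Tx Ty; have [_ Tl] := Tlin; have := Tl (-1) y x Ty Tx.
by rewrite !scaleN1r ![- _ + _]addrC.
Qed.

Lemma self_adjoint_linear T : self_adjoint ip T -> linear_operator T.
Proof. by case. Qed.

Lemma self_adjoint_sym T x y : self_adjoint ip T -> dom T x -> dom T y ->
  ip (T x) y = ip x (T y).
Proof. by move=> [_ _ Tadj] Tx Ty; have [+ _] := Tadj y (T y); apply. Qed.

(** The eigenvectors of the compact inverse of [A] are also eigenvectors of [S]: if [A e = r^2 e],
    then [w = S e - r e] satisfies [S w = - r w], and positivity of [S] forces [w = 0]. *)
Lemma sqrt_operator_eigenbasis A S :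
    self_adjoint ip A -> positive_operator ip A -> has_compact_inverse A ->
    is_sqrt_operator ip S A ->
  exists (e : nat -> H) (r : nat -> R),
    [/\ forall n, [/\ 0 < r n, dom S (e n) & S (e n) = r n *: e n],
        forall n, `|e n| = 1 \/ e n = 0 &
        forall x, (\sum_(i < n) ip x (e i) ^+ 2) @[n --> \oo] --> `|x| ^+ 2].
Proof.
move=> Asa Apos [K [AK KA Kc]] [Ssa Spos domA SSA].
have Alin := self_adjoint_linear Asa; have Slin := self_adjoint_linear Ssa.
have A0 := linear_operator0 Alin.
have [||||x d d0|e [k [ek e1 pars]]] := compact_symmetric_eigenbasis ip_norm (K := K) _ _ _ _
  Kc _.
- move=> k x y; have [[dx Ax] [dy Ay]] := (AK x, AK y).
  have [_ Al] := Alin; have [dz Az] := Al k _ _ dx dy.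
  by rewrite -(KA _ dz) Az Ax Ay.
- move=> x y; have [[dx Ax] [dy Ay]] := (AK x, AK y).
  by rewrite -[in LHS]Ay -(self_adjoint_sym Asa)// Ax.
- by move=> x; have [dx Ax] := AK x; rewrite -[x in ip _ x]Ax ipC Apos.
- by move=> x Kx; have [_] := AK x; rewrite Kx A0.
- have [_ dA _] := Asa.
  have [||y [xy dy]] := dA (ball x d); first by exists x; exact: ballxx.
    exact: ball_open.
  by exists (A y); rewrite KA//; rewrite -ball_normE in xy.
exists e, (fun n => Num.sqrt (k n)^-1); split => // n.
have [kn Ke] := ek n; set r := Num.sqrt _.
have r0 : 0 < r by rewrite sqrtr_gt0 invr_gt0.
have [dKe AKe] := AK (e n); have [de Ae] := linear_operatorZ (k n)^-1 Alin dKe.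
rewrite AKe Ke scalerA mulVf ?gt_eqF// scale1r in de Ae.
have [dSe dSSe] : dom S (e n) /\ dom S (S (e n)) by move: de; rewrite domA.
have [dre Sre] := linear_operatorZ r Slin dSe.
have [dw Sw] := linear_operatorB Slin dSSe dre.
split=> //; apply/eqP; rewrite -subr_eq0 -normr_eq0 -sqrf_eq0 -ip_norm.
set w := _ - _ in dw Sw *.
have Sw' : S w = - r *: w.
  rewrite Sw SSA// Ae Sre /w scalerBr scalerA scaleNr mulNr -expr2 sqr_sqrtr ?invr_ge0 ?(ltW
    kn)//.
  by rewrite scaleNr opprK addrC.
have := Spos _ dw; rewrite Sw' ipZl ip_norm; have := sqr_ge0 `|w| => h1 h2.
by rewrite eq_le h1 andbT -(pmulr_rle0 _ r0); lra.
Qed.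

End SquareRootEigenbasis.

(** * Integrals and the memory kernel *)

Section AlmostEverywhere.
Local Open Scope ereal_scope.
Context d (T : measurableType d) (R : realType) (mu : {measure set T -> \bar R}).
Implicit Types (D : set T) (f g : T -> \bar R).

Import HBNNSimple.

(* No measurability is assumed of [f] and [g]: the integral of a nonnegative
   function is the supremum of those of the simple functions below it. *)
Lemma ge0_integral_ae_le D f g :
  (forall x, D x -> 0 <= f x) -> (forall x, D x -> 0 <= g x) ->
  {ae mu, forall x, D x -> f x <= g x} ->
  \int[mu]_(x in D) f x <= \int[mu]_(x in D) g x.
Proof.
move=> f0 g0 [N [mN N0 fgN]]; rewrite !ge0_integralE//.
apply: ge_ereal_sup => _ [h /= hf <-].
have mNC : measurable (~` N) by exact: measurableC.
(* Cutting a simple function below [f] to [0] on the null set [N] keeps its integral and puts it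
   below [g] everywhere. *)
pose k := proj_nnsfun h mNC.
rewrite -integralT_nnsfun (_ : \int[mu]_x (h x)%:E = \int[mu]_x (k x)%:E); last first.
  apply: ge0_ae_eq_integral => //; [exact/measurable_EFinP|exact/measurable_EFinP| | |].
  - by move=> x _; rewrite lee_fin.
  - by move=> x _; rewrite lee_fin.
  - exists N; split => // x /= /not_implyP[_]; apply: contra_notP => nNx.
    by rewrite /k /= mindicE mem_set// mulr1.
rewrite integralT_nnsfun; apply: ereal_sup_ubound; exists k => //= x.
rewrite /k /= mindicE; have [Nx|nNx] := pselect (N x).
  rewrite memNset ?mulr0 /=; last by apply.
  by rewrite patchE; case: ifPn => // /set_mem/g0.
rewrite mem_set// mulr1 (le_trans (hf x))// !patchE; case: ifPn => // /set_mem Dx.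
by apply: contrapT => nfg; apply: nNx; apply: fgN => /(_ Dx).
Qed.

Lemma ge0_integral_ae_eq D f g :
  (forall x, D x -> 0 <= f x) -> (forall x, D x -> 0 <= g x) ->
  {ae mu, forall x, D x -> f x = g x} ->
  \int[mu]_(x in D) f x = \int[mu]_(x in D) g x.
Proof.
move=> f0 g0 fg; apply/eqP; rewrite eq_le !ge0_integral_ae_le//.
  by apply: filterS fg => x h Dx; rewrite h.
by apply: filterS fg => x h Dx; rewrite h.
Qed.

(** Stated without measurability because integrands containing [S (eta u t s)] are only known to
    agree almost everywhere with measurable ones. *)
Lemma Rintegral_ae_eq D (f g : T -> R) :
  {ae mu, forall x, D x -> f x = g x} ->
  (\int[mu]_(x in D) f x = \int[mu]_(x in D) g x)%R.
Proof.
move=> fg; rewrite /Rintegral integralE [in RHS]integralE; congr fine; congr (_ - _).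
  by apply: ge0_integral_ae_eq => //; apply: filterS fg => x h Dx; rewrite !funeposE h.
by apply: ge0_integral_ae_eq => //; apply: filterS fg => x h Dx; rewrite !funenegE h.
Qed.

End AlmostEverywhere.

Section Reflection.
Context {R : realType}.
Local Notation leb := (@lebesgue_measure R).

Definition reflect_at (t r : R) : measurableTypeR R := t - r.

Lemma measurable_reflect_at t : measurable_fun [set: measurableTypeR R] (reflect_at t).
Proof. by apply: measurable_funB => //; exact: measurable_cst. Qed.

(** By uniqueness of Lebesgue measure it suffices to compare the values on the intervals []a, b]],
    whose preimages are the intervals [[t - b, t - a[]. Translations are later treated as two
    successive reflections. *)
Lemma lebesgue_measure_reflect t (A : set R) : measurable A ->
  pushforward leb (reflect_at t) A = leb A.
Proof.
move=> mA.
pose f : {mfun measurableTypeR R >-> measurableTypeR R} :=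
  HB.pack (reflect_at t) (isMeasurableFun.Build _ _ _ _ _ (measurable_reflect_at t)).
apply/esym/(lebesgue_measure_unique (mu := pushforward leb f)) => //= _ [[a b]] _ <-.
rewrite /pushforward (_ : reflect_at t @^-1` _ = `[t - b, t - a[%classic).
  rewrite !lebesgue_measure_itv/= !lte_fin ltrD2l ltrN2; case: ifP => //.
  by rewrite opprB addrC => _; congr EFin; ring.
by apply/seteqP; split => x; rewrite /reflect_at /= !in_itv /= => /andP[]; lra.
Qed.

Lemma ge0_integral_reflect t (f : R -> \bar R) : measurable_fun setT f ->
  (forall r, 0 <= f r)%E ->
  (\int[leb]_r f (t - r)%R = \int[leb]_r f r)%E.
Proof.
move=> mf f0.
transitivity (\int[pushforward leb (reflect_at t)]_r f r)%E.
  by rewrite ge0_integral_pushforward//=; exact: measurable_reflect_at.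
apply: eq_measure_integral => [|mt A mA _]; first exact: measurable_reflect_at.
exact: lebesgue_measure_reflect.
Qed.

Lemma integral_reflect t (f : R -> R) : measurable_fun setT f ->
  \int[leb]_r f (t - r) = \int[leb]_r f r.
Proof.
move=> mf; rewrite /Rintegral integralE [in RHS]integralE; congr fine; congr (_ - _)%E.
  rewrite -[RHS](ge0_integral_reflect t)//; last by apply: measurable_funepos;
    exact/measurable_EFinP.
  by apply: eq_integral => x _; rewrite !funeposE.
rewrite -[RHS](ge0_integral_reflect t)//; last by apply: measurable_funeneg;
  exact/measurable_EFinP.
by apply: eq_integral => x _; rewrite !funenegE.
Qed.

Lemma negligible_reflect t (N : set R) : leb.-negligible N ->
  leb.-negligible [set r | N (t - r)].
Proof.
move=> [A [mA A0 NA]]; exists (reflect_at t @^-1` A); split.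
- by rewrite -[X in measurable X]setTI; exact: measurable_reflect_at.
- by rewrite -A0 -(lebesgue_measure_reflect t mA).
- by move=> r /NA.
Qed.

End Reflection.

Section MemoryIntegral.
Context {R : realType} (mu : R -> R).
Hypothesis mu_adm : admissible_kernel mu.
Local Notation leb := (@lebesgue_measure R).
Implicit Types (g f : R -> R) (s t r h : R).

(* Extending the kernel by [0] lets all memory integrals range over the whole
   line in the variable [r = t - s], where only the kernel depends on [t]. *)
Definition kern s : R := if 0 < s then mu s else 0.

Definition memint t g : R := \int[leb]_r (kern (t - r) * g r).

Definition memL1 t g : Prop :=
  measurable_fun setT g /\ leb.-integrable setT (EFin \o (fun r => kern (t - r) * g r)).

Lemma kern_le0 s : s <= 0 -> kern s = 0.
Proof. by rewrite /kern ltNge => ->. Qed.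

Lemma kern_gt0 s : 0 < s -> kern s = mu s.
Proof. by rewrite /kern => ->. Qed.

Lemma kern_ge0 s : 0 <= kern s.
Proof.
rewrite /kern; case: ltP => // s0; have [[mu0 _] _ _ _ _] := mu_adm.
exact/mu0/ltW.
Qed.

Lemma admissible_kernel_nincr s t : 0 <= s -> s <= t -> mu t <= mu s.
Proof.
have [[mu0 _] muc mud _ [delta d0 md]] := mu_adm.
apply: ler0_derive1_nincry => // x; rewrite in_itv /= andbT => x0.
  by have [] := mud x x0.
by rewrite (le_trans (md _ x0))// mulNr oppr_le0 mulr_ge0 ?mu0 ?ltW.
Qed.

(** The restriction to [0 < s] matters: [kern] jumps from [0] up to [mu 0] at the origin. *)
Lemma kern_nincr s t : 0 < s -> s <= t -> kern t <= kern s.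
Proof.
move=> s0 st; rewrite !kern_gt0 ?(lt_le_trans s0)//.
by rewrite admissible_kernel_nincr// ltW.
Qed.

Lemma kern_le s : kern s <= mu 0.
Proof.
have [[mu0 _] _ _ _ _] := mu_adm; rewrite /kern; case: ltP => s0; last exact: mu0.
by rewrite admissible_kernel_nincr// ltW.
Qed.

Let kernE : kern = mu \_ `]0, +oo[.
Proof.
apply/funext => s; rewrite /kern patchE; congr (if _ then _ else _).
by apply/idP/idP => [s0|/set_mem/=]; rewrite ?in_itv/= ?andbT//; apply/mem_set;
  rewrite /= in_itv/= s0.
Qed.

Let kern_integrable : leb.-integrable setT (EFin \o kern).
Proof.
have [_ _ _ [int_mu _] _] := mu_adm.
by rewrite kernE -restrict_EFin; apply/integrable_restrict => //=; rewrite setTI.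
Qed.

Lemma measurable_kern : measurable_fun setT kern.
Proof. by have /integrableP[/measurable_EFinP] := kern_integrable. Qed.

Lemma measurable_kern_reflect t : measurable_fun setT (fun r => kern (t - r)).
Proof.
apply: (measurableT_comp measurable_kern); apply: measurable_funB => //.
Qed.

Lemma kernel_massE : kernel_mass mu = \int[leb]_s kern s.
Proof. by rewrite /kernel_mass Rintegral_mkcond kernE. Qed.

Lemma kernel_mass_ge0 : 0 <= kernel_mass mu.
Proof. by rewrite kernel_massE; apply: Rintegral_ge0 => s _; exact: kern_ge0. Qed.

Lemma kernel_mass_lt1 : kernel_mass mu < 1.
Proof. by have [_ _ _ [_]] := mu_adm. Qed.

Lemma half_line_memint t g : measurable_fun setT g ->
  \int[leb]_(s in `]0, +oo[) (mu s * g (t - s)) = memint t g.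
Proof.
move=> mg; rewrite Rintegral_mkcond -(integral_reflect t); last first.
  rewrite (_ : _ \_ _ = fun s => kern s * g (t - s)); last first.
    by apply/funext => s; rewrite kernE !patchE; case: ifPn => //; rewrite mul0r.
  apply: measurable_funM; first exact: measurable_kern.
  by apply: (measurableT_comp mg); apply: measurable_funB.
apply: eq_Rintegral => r _; rewrite kernE !patchE subKr.
by case: ifPn => //; rewrite mul0r.
Qed.

Let memL1_measurable t g : measurable_fun setT g ->
  measurable_fun setT (fun r => kern (t - r) * g r).
Proof. by move=> mg; apply: measurable_funM => //; exact: measurable_kern_reflect. Qed.

Lemma memL1_cst t (c : R) : memL1 t (cst c).
Proof.
split; first exact: measurable_cst.
have mk : measurable_fun setT (fun r => `|kern r|).
  by apply: measurableT_comp => //; exact: measurable_kern.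
have : leb.-integrable setT (EFin \o (fun r => kern (t - r))).
  apply/integrableP; split; first by apply/measurable_EFinP; exact: measurable_kern_reflect.
  rewrite (ge0_integral_reflect t (f := fun r => `|kern r|%:E))//; last exact/measurable_EFinP.
  by have /integrableP[] := kern_integrable.
move=> /(integrableZl measurableT c); apply: eq_integrable => // r _ /=.
by rewrite -EFinM mulrC.
Qed.

Lemma memint_cst t (c : R) : memint t (cst c) = c * kernel_mass mu.
Proof.
have [_] := memL1_cst t 1.
rewrite (_ : EFin \o _ = EFin \o (fun r => kern (t - r))); last by apply/funext => r /=;
  rewrite mulr1.
move=> i1; rewrite /memint kernel_massE -(integral_reflect t (f := kern));
  last exact: measurable_kern.
by rewrite -RintegralZl//; apply: eq_Rintegral => r _; rewrite mulrC.
Qed.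

Lemma memL1_le t g f : measurable_fun setT g -> memL1 t f ->
  (forall r, r < t -> `|g r| <= f r) -> memL1 t g.
Proof.
move=> mg [mf fi] gf; split => //; apply: le_integrable fi => //.
  by apply/measurable_EFinP; exact: memL1_measurable.
move=> r _ /=; rewrite lee_fin !normrM; have [rt|tr] := ltP r t.
  by rewrite ler_wpM2l// (le_trans (gf _ rt)) ?ler_norm.
by rewrite kern_le0 ?normr0 ?mul0r// subr_le0.
Qed.

Lemma memL1D t g f : memL1 t g -> memL1 t f -> memL1 t (fun r => g r + f r).
Proof.
move=> [mg gi] [mf fi]; split; first exact: measurable_funD.
by apply: eq_integrable (integrableD measurableT gi fi) => // r _ /=; rewrite mulrDr.
Qed.

Lemma memL1Z t (c : R) g : memL1 t g -> memL1 t (fun r => c * g r).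
Proof.
move=> [mg gi]; split; first by apply: measurable_funM => //; exact: measurable_cst.
by apply: eq_integrable (integrableZl measurableT c gi) => // r _ /=; rewrite -EFinM mulrCA.
Qed.

Lemma memL1B t g f : memL1 t g -> memL1 t f -> memL1 t (fun r => g r - f r).
Proof.
move=> gi fi; have := memL1D gi (memL1Z (-1) fi).
by under eq_fun do rewrite mulN1r.
Qed.

Lemma memintD t g f : memL1 t g -> memL1 t f ->
  memint t (fun r => g r + f r) = memint t g + memint t f.
Proof.
by move=> [_ gi] [_ fi]; rewrite /memint -RintegralD//; apply: eq_Rintegral => r _;
  rewrite mulrDr.
Qed.

Lemma memintZ t (c : R) g : memL1 t g -> memint t (fun r => c * g r) = c * memint t g.
Proof.
by move=> [_ gi]; rewrite /memint -RintegralZl//; apply: eq_Rintegral => r _; rewrite mulrCA.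
Qed.

Lemma memintB t g f : memL1 t g -> memL1 t f ->
  memint t (fun r => g r - f r) = memint t g - memint t f.
Proof.
move=> gi fi; rewrite -mulN1r -memintZ// -memintD//; last exact: memL1Z.
by apply: eq_Rintegral => r _; rewrite mulN1r.
Qed.

Lemma memint_le t g f : memL1 t g -> memL1 t f -> (forall r, r < t -> g r <= f r) ->
  memint t g <= memint t f.
Proof.
move=> [_ gi] [_ fi] gf; apply: le_Rintegral => // r _; have [rt|tr] := ltP r t.
  by rewrite ler_wpM2l ?kern_ge0 ?gf.
by rewrite kern_le0 ?mul0r// subr_le0.
Qed.

Lemma memint_ge0 t g : (forall r, r < t -> 0 <= g r) -> 0 <= memint t g.
Proof.
move=> g0; apply: Rintegral_ge0 => r _; have [rt|tr] := ltP r t.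
  by rewrite mulr_ge0 ?kern_ge0 ?g0.
by rewrite kern_le0 ?mul0r// subr_le0.
Qed.

Lemma eq_memint t g f : (forall r, r < t -> g r = f r) -> memint t g = memint t f.
Proof.
move=> gf; apply: eq_Rintegral => r _; have [rt|tr] := ltP r t; first by rewrite gf.
by rewrite kern_le0 ?mul0r// subr_le0.
Qed.

(** The kernel has finite mass and the absolute value of [g] is at most [1 + g ^+ 2]. *)
Lemma memL1_sqr t g : measurable_fun setT g -> memL1 t (fun r => g r ^+ 2) -> memL1 t g.
Proof.
move=> mg g2; apply: (memL1_le mg (memL1D (memL1_cst t 1) g2)) => r _ /=.
by rewrite -(real_normK (num_real (g r))); have := sqr_ge0 (`|g r| - 1); nra.
Qed.

Lemma memint_abs_le t g f : memL1 t g -> memL1 t f ->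
  (forall r, r < t -> `|g r| <= f r) -> `|memint t g| <= memint t f.
Proof.
move=> gi fi gf; rewrite ler_norml; apply/andP; split; last first.
  by apply: memint_le => // r /gf; rewrite ler_norml => /andP[].
rewrite -mulN1r -memintZ//; apply: memint_le => //; first exact: memL1Z.
by move=> r /gf; rewrite ler_norml mulN1r => /andP[].
Qed.

Lemma memL1_sqrB t f g : measurable_fun setT f -> measurable_fun setT g ->
  memL1 t (fun r => f r ^+ 2) -> memL1 t (fun r => g r ^+ 2) ->
  memL1 t (fun r => (f r - g r) ^+ 2).
Proof.
move=> mf mg f2 g2; apply: (memL1_le _ (memL1Z 2 (memL1D f2 g2))).
  by apply: measurable_funX; exact: measurable_funB.
move=> r _; rewrite ger0_norm ?sqr_ge0//.
by have := sqr_ge0 (f r + g r); nra.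
Qed.

Lemma integral_translate h f : measurable_fun setT f ->
  \int[leb]_r f (r + h) = \int[leb]_r f r.
Proof.
move=> mf; rewrite -[RHS](integral_reflect h)// -[RHS](integral_reflect 0); last first.
  by apply: (measurableT_comp mf); apply: measurable_funB.
by apply: eq_Rintegral => r _; rewrite sub0r opprK addrC.
Qed.

Lemma memint_shift t h g : measurable_fun setT g ->
  memint t (fun r => g (r + h)) = memint (t + h) g.
Proof.
move=> mg; rewrite /memint -[RHS](integral_translate h); last exact: memL1_measurable.
by apply: eq_Rintegral => r _; congr (kern _ * _); ring.
Qed.

Lemma memL1_shift t h g : memL1 (t + h) g -> memL1 t (fun r => g (r + h)).
Proof.
move=> [mg gi].
have mgh : measurable_fun setT (fun r => g (r + h)).
  by apply: (measurableT_comp mg); apply: measurable_funD.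
split => //; apply/integrableP; split; first by apply/measurable_EFinP; exact: memL1_measurable.
have /integrableP[_] := gi; apply: le_lt_trans.
pose F (r : R) : R := `|kern (t + h - r) * g r|.
have mF : measurable_fun setT F.
  by apply: measurableT_comp => //; exact: memL1_measurable.
have F0 r : (0 <= (F r)%:E)%E by rewrite lee_fin /F.
have E : (\int[leb]_r (F (r + h))%:E = \int[leb]_r (F r)%:E)%E.
  rewrite -[RHS](ge0_integral_reflect h (f := fun r => (F r)%:E))//;
    last exact/measurable_EFinP.
  rewrite -[RHS](ge0_integral_reflect 0 (f := fun r => (F (h - r))%:E))//; last first.
    by apply/measurable_EFinP; apply: (measurableT_comp mF); apply: measurable_funB.
  by apply: eq_integral => r _; rewrite sub0r opprK addrC.
rewrite [leRHS](_ : _ = \int[leb]_r (F r)%:E)%E// -E le_eqVlt; apply/orP; left; apply/eqP.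
by apply: eq_integral => r _; rewrite /= /F; congr (`|kern _ * _|%:E); ring.
Qed.

End MemoryIntegral.

(** * A local Gronwall inequality *)

Section UniformContinuity.
Context {R : realType}.
Implicit Types (f G : R -> R) (a c s t T e : R).

(** Heine's theorem. Compactness is used in its near-covering form, along the filter of moduli [d]
    tending to [0] from the right. *)
Lemma heine_segment f a c e : {within `[a, c], continuous f} -> 0 < e ->
  exists2 d : R, 0 < d & forall s t, a <= s <= c -> a <= t <= c -> `|t - s| < d ->
    `|f t - f s| < e.
Proof.
move=> fc e0; pose A := [set` `[a, c]].
have /compact_near_coveringP cov : compact A by exact: segment_compact.
have [|d /= d0 dP] := cov _ (0^'+)
    (fun d s => a <= s <= c -> forall t, a <= t <= c -> `|t - s| < d -> `|f t - f s| < e) _.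
  move=> x Ax; have := (subspace_continuousP _ f).1 fc x Ax.
  move=> /cvgrPdist_lt /(_ _ (divr_gt0 e0 (ltr0Sn _ 1))) [r /= r0 rP].
  have r20 : 0 < r / 2 by rewrite divr_gt0.
  exists (ball x (r / 2), [set d | d < r / 2]); first split => /=.
  - exact: nbhsx_ballx.
  - exact: nbhs_right_lt.
  move=> [s d] /= [xs dr] sac t tac ts.
  have h y : a <= y <= c -> `|x - y| < r -> `|f x - f y| < e / 2.
    by move=> yac xy; apply: rP => //; rewrite /A /= in_itv.
  rewrite -ball_normE /= in xs.
  rewrite -(subrKA (f x)) (splitr e) (le_lt_trans (ler_normD _ _))// ltrD//.
    rewrite distrC h// -(subrKA s) (splitr r) (le_lt_trans (ler_normD _ _))// ltrD//.
    by rewrite distrC (lt_trans ts).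
  by rewrite h// (lt_le_trans xs)// ler_pdivrMr// mulr2n mulrDr mulr1 lerDl ltW.
exists (d / 2); first by rewrite divr_gt0.
move=> s t sac tac ts; apply: (dP (d / 2)) ts => //=.
- by rewrite sub0r normrN gtr0_norm ?divr_gt0// ltr_pdivrMr// mulr2n mulrDr mulr1 ltrDl.
- by rewrite divr_gt0.
Qed.

Lemma within_segment_bounded f a c : {within `[a, c], continuous f} ->
  exists2 M : R, 0 <= M & forall t, a <= t <= c -> `|f t| <= M.
Proof.
move=> fc; have [ac|ca] := leP a c; last first.
  by exists 0 => // t /andP[at_ tc]; have := le_trans at_ tc; rewrite leNgt ca.
have [|x _ xM] := @EVT_max R (fun t => `|f t|) a c ac.
  by move=> t; apply: continuous_comp; [exact: fc|exact: norm_continuous].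
by exists `|f x| => // t tac; apply: xM; rewrite in_itv.
Qed.

(** Only nonnegative times are constrained, since a history is merely measurable. One modulus serves
    all pairs in [[0, T]], as required when increments are added over partitions. *)
Definition loc_unif_cont f := forall T e, 0 < e ->
  exists2 d : R, 0 < d & forall s t, 0 <= s <= T -> 0 <= t <= T -> `|t - s| < d ->
    `|f t - f s| < e.

Lemma within_loc_unif_cont f : {within `[0, +oo[, continuous f} -> loc_unif_cont f.
Proof.
move=> fc T e e0; apply: heine_segment => //.
by apply: continuous_subspaceW fc; apply: subset_itvl.
Qed.

(** Extending by the value at [0] gives a function continuous on the whole line, to which the
    results on measurability, integrability and primitives apply. *)
Lemma loc_unif_cont_max f : loc_unif_cont f -> continuous (fun t => f (Num.max t 0)).
Proof.
move=> fc t; apply/cvgrPdist_lt => e e0.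
have [d d0 dP] := fc (`|t| + 1) e e0.
near=> s.
have st : `|t - s| < Num.min d 1.
  by near: s; apply: cvgr_dist_lt => //; rewrite lt_min d0 ltr01.
rewrite lt_min in st; case/andP: st => std st1.
have h1 : s <= `|t| + 1.
  by rewrite -[s](subKr t) (le_trans (ler_norm _))// (le_trans (ler_normB _ _))// lerD2l ltW.
have h2 : t <= `|t| + 1 by rewrite (le_trans (ler_norm _))// lerDl.
have h3 : 0 <= `|t| + 1 by rewrite addr_ge0.
apply: dP; rewrite ?le_max ?ge_max ?lexx ?orbT ?h1 ?h2 ?h3//.
apply: le_lt_trans std; rewrite /Num.max; case: ltP => ht; case: ltP => hs.
- by rewrite subrr normr0.
- by rewrite sub0r normrN distrC !ger0_norm; lra.
- by rewrite subr0 !ger0_norm; lra.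
- by [].
Unshelve. all: by end_near. Qed.

Lemma loc_unif_cont_within f : loc_unif_cont f -> {within `[0, +oo[, continuous f}.
Proof.
move=> /loc_unif_cont_max fc.
apply: (@subspace_eq_continuous _ _ _ (fun t => f (Num.max t 0))) => [t|].
  by rewrite inE /= in_itv /= andbT => t0; rewrite /from_subspace /= max_l.
exact: continuous_subspaceT.
Qed.

Lemma loc_unif_cont_bounded f T : loc_unif_cont f ->
  exists2 M : R, 0 <= M & forall t, 0 <= t <= T -> `|f t| <= M.
Proof.
move=> /loc_unif_cont_within fc; apply: within_segment_bounded.
by apply: continuous_subspaceW fc; apply: subset_itvl.
Qed.

(* Adding the increments over a partition into [N] equal pieces costs at most
   [e * (c - a)]. *)
Lemma local_upper_slope_le G a c : a <= c ->
  (forall e, 0 < e -> exists2 d : R, 0 < d & forall s t, a <= s -> s < t -> t <= c ->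
    t - s < d -> G t - G s <= e * (t - s)) ->
  G c <= G a.
Proof.
rewrite le_eqVlt => /orP[/eqP -> //|ac] Gs.
have ca : 0 < c - a by rewrite subr_gt0.
rewrite -subr_le0; apply/ler_addgt0Pl => e e0; rewrite addr0.
have [d d0 dP] := Gs (e / (c - a)) (divr_gt0 e0 ca).
have [N hN] : exists N : nat, (c - a) / N.+1%:R < d.
  have q0 : 0 < d / (c - a) by rewrite divr_gt0.
  have [N _ /(_ N (leqnn N)) hN] := near_infty_natSinv_lt (PosNum q0).
  by exists N; rewrite mulrC -ltr_pdivlMr.
pose h := (c - a) / N.+1%:R.
have h0 : 0 < h by rewrite divr_gt0.
have hc : h * N.+1%:R = c - a by rewrite /h divfK// pnatr_eq0.
have step (i : nat) : (i <= N.+1)%N -> G (a + h * i%:R) - G a <= e / (c - a) * (h * i%:R).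
  elim: i => [|i IH] iN; first by rewrite mulr0 addr0 subrr mulr0.
  have E : h * i.+1%:R = h * i%:R + h by rewrite -natr1; ring.
  have hi : 0 <= h * i%:R by rewrite mulr_ge0 ?ler0n// ltW.
  have hi1 : h * i.+1%:R <= c - a by rewrite -hc ler_pM2l// ler_nat.
  have := dP (a + h * i%:R) (a + h * i.+1%:R).
  have -> : a + h * i.+1%:R - (a + h * i%:R) = h by rewrite E; ring.
  move=> /(_ _ _ _ hN) S.
  have {}S : G (a + h * i.+1%:R) - G (a + h * i%:R) <= e / (c - a) * h by apply: S; lra.
  have := IH (ltnW iN).
  have -> : e / (c - a) * (h * i.+1%:R) = e / (c - a) * (h * i%:R) + e / (c - a) * h by
    rewrite E mulrDr.
  lra.
have := step _ (leqnn _); rewrite hc divfK ?gt_eqF//.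
by rewrite (addrC a) subrK.
Qed.

(* Gronwall's inequality in the form that needs neither continuity nor
   differentiability of [Y]. *)
Lemma local_gronwall Y a c (B K : R) : a <= c -> 0 <= B ->
  (forall t, a <= t <= c -> 0 <= Y t <= K) ->
  (forall e, 0 < e -> exists2 d : R, 0 < d & forall s t, a <= s -> s < t -> t <= c ->
    t - s < d -> Y t - Y s <= (t - s) * (B * Y t + e)) ->
  Y c <= expR (B * (c - a)) * Y a.
Proof.
move=> ac B0 YK Yd.
have K0 : 0 <= K by have /YK/andP[] : a <= a <= c; [rewrite lexx|exact: le_trans].
(* The integrating factor turns the growth bound into an upper slope at most [0]. *)
suff : expR (- (B * (c - a))) * Y c <= expR (- (B * (a - a))) * Y a.
  rewrite subrr mulr0 oppr0 expR0 mul1r -(ler_pM2l (expR_gt0 (B * (c - a)))).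
  by rewrite mulrA -expRD subrr expR0 mul1r.
apply: (local_upper_slope_le (G := fun t => expR (- (B * (t - a))) * Y t)) => // e e0.
have e20 : 0 < e / 2 by rewrite divr_gt0.
have [d d0 dP] := Yd (e / 2) e20.
(* The hypothesis involves the value [Y t] at the right end, whereas comparison with
   [expR (B * h) * Y s] needs [Y s]. The exchange costs [B * h * (Y t - Y s)], which is of second
   order in the step [h] and bounded by [D * h ^+ 2]. *)
pose D := B * (B * K + e) + 1.
have D0 : 0 < D by rewrite ltr_wpDl// mulr_ge0// addr_ge0 ?mulr_ge0// ltW.
exists (Num.min d (e / 2 / D)); first by rewrite lt_min d0 divr_gt0.
move=> s t as_ st tc; rewrite lt_min => /andP[tsd tse].
have {}tse : D * (t - s) < e / 2 by rewrite mulrC -ltr_pdivlMr.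
have := dP s t as_ st tc tsd => Yts.
have /andP[Ys0 YsK] : 0 <= Y s <= K by apply: YK; rewrite as_ (le_trans (ltW st)).
have /andP[Yt0 YtK] : 0 <= Y t <= K by apply: YK; rewrite tc (le_trans as_)// ltW.
set h := t - s in tse Yts *.
have h0 : 0 < h by rewrite subr_gt0.
have -> : expR (- (B * (s - a))) = expR (- (B * (t - a))) * expR (B * h).
  by rewrite -expRD; congr expR; rewrite /h; ring.
rewrite -mulrA -mulrBr.
have ex1 : expR (- (B * (t - a))) <= 1.
  rewrite -[leRHS]expR0 ler_expR oppr_le0 mulr_ge0// subr_ge0 (le_trans as_)// ltW//.
have ex2 : 1 + B * h <= expR (B * h) by exact: expR_ge1Dx.
have bnd : Y t - expR (B * h) * Y s <= e * h.
  have : (1 + B * h) * Y s <= expR (B * h) * Y s by rewrite ler_wpM2r.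
  have P1 : B * h * (Y t - Y s) <= B * h * (h * (B * K + e)).
    rewrite ler_wpM2l ?mulr_ge0 ?(ltW h0)// (le_trans Yts)// ler_wpM2l ?(ltW h0)//.
    by rewrite lerD ?ler_wpM2l//; lra.
  have P2 : h * (B * (B * K + e)) * h <= e / 2 * h.
    rewrite ler_wpM2r ?(ltW h0)//; move: tse; rewrite /D mulrDl mul1r mulrC; lra.
  move: P1 P2 Yts; set BK := B * K; nra.
have [neg|pos] := leP (Y t - expR (B * h) * Y s) 0.
  apply: (@le_trans _ _ 0); first by rewrite mulr_ge0_le0 ?expR_ge0.
  by rewrite mulr_ge0 ?ltW.
by apply: le_trans bnd; rewrite ler_piMl ?(ltW pos).
Qed.

End UniformContinuity.

(** * Regular scalar modes and their energy *)

Section ModeRegularity.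
Context {R : realType} (mu : R -> R).
Hypothesis mu_adm : admissible_kernel mu.
Local Notation leb := (@lebesgue_measure R).
Implicit Types (f g phi p : R -> R) (s t r h T e : R).

(* The last two fields say that the history [phi (- s)] is in [L^2_mu] and that
   translations act continuously on it. *)
Record memory_regular phi : Prop := MemoryRegular {
  mr_measurable : measurable_fun setT phi;
  mr_loc_unif_cont : loc_unif_cont phi;
  mr_hist : memL1 mu 0 (fun r => phi r ^+ 2);
  mr_hist_cont : forall e, 0 < e -> exists2 d : R, 0 < d & forall h, 0 < h -> h < d ->
    memint mu 0 (fun r => (phi (r + h) - phi r) ^+ 2) <= e }.

Record mode_regular phi p : Prop := ModeRegular {
  mr_memory :> memory_regular phi;
  mr_derive : forall t, 0 <= t -> is_derive t (1 : R) phi (p t);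
  mr_cont : loc_unif_cont p }.

(** Before [s] the kernel seen from [t] is below the one seen from [s], by monotonicity; between [s]
    and [t] the function is bounded and the kernel has finite mass. Integrability of the history at
    time [0] thus propagates to all later times. *)
Lemma memL1_split s t g f (c : R) : s <= t -> 0 <= c -> measurable_fun setT g -> memL1 mu s f ->
  (forall r, r < s -> `|g r| <= f r) -> (forall r, s <= r -> r < t -> `|g r| <= c) ->
  memL1 mu t g /\ memint mu t (fun r => `|g r|) <= memint mu s f + c * kernel_mass mu.
Proof.
move=> st c0 mg [mf fi] gf gc.
have [_ ci] := memL1_cst mu_adm t c.
have si := integrableD measurableT fi ci.
have mng : measurable_fun setT (fun r => `|g r|) by exact: measurableT_comp.
have mk g' : measurable_fun setT g' ->
  measurable_fun setT (EFin \o (fun r => kern mu (t - r) * g' r)).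
  move=> mg'; apply/measurable_EFinP; apply: measurable_funM => //.
  exact: measurable_kern_reflect.
have ptw r : kern mu (t - r) * `|g r| <= kern mu (s - r) * f r + kern mu (t - r) * c.
  have k0 := kern_ge0 mu_adm; have [rs|sr] := ltP r s.
    apply: (@le_trans _ _ (kern mu (s - r) * f r)).
      rewrite ler_pM// ?gf// kern_nincr// ?subr_gt0//; lra.
    by rewrite lerDl mulr_ge0.
  rewrite [kern mu (s - r)]kern_le0 ?mul0r ?add0r ?subr_le0//.
  have [rt|tr] := ltP r t; first by rewrite ler_wpM2l// gc.
  by rewrite kern_le0 ?mul0r// subr_le0.
have gi : memL1 mu t (fun r => `|g r|).
  split => //; apply: le_integrable si => //; first exact: mk.
  move=> r _ /=; rewrite !lee_fin ger0_norm ?mulr_ge0 ?kern_ge0//.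
  by rewrite (le_trans (ptw r))// ler_norm.
split; first exact: (memL1_le mu_adm mg gi).
rewrite -(memint_cst mu_adm t c) /memint -RintegralD//.
by apply: le_Rintegral => //; case: gi.
Qed.

Lemma derive_lipschitz phi p T : (forall t, 0 <= t -> is_derive t (1 : R) phi (p t)) ->
  loc_unif_cont p -> exists2 L : R, 0 <= L &
  (forall t, 0 <= t <= T -> `|p t| <= L) /\
  (forall s t, 0 <= s <= T -> 0 <= t <= T -> `|phi t - phi s| <= L * `|t - s|).
Proof.
move=> phip pc; have [L L0 pL] := loc_unif_cont_bounded T pc.
exists L => //; split => //.
suff H s t : 0 <= s <= T -> 0 <= t <= T -> s <= t -> `|phi t - phi s| <= L * `|t - s|.
  move=> s t sT tT; have [st|/ltW ts] := leP s t; first exact: H.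
  by rewrite distrC (distrC t) H.
move=> /andP[s0 sT] /andP[t0 tT] st.
have [|||x /andP[/= sx xt] ->] := @MVT_segment R phi p s t.
- by [].
- move=> x; rewrite in_itv /= => /andP[sx _]; apply: phip.
  by rewrite (le_trans s0)// ltW.
- apply: derivable_within_continuous => x; rewrite in_itv /= => /andP[sx _].
  by have := phip _ (le_trans s0 sx); case.
rewrite normrM ler_wpM2r// pL//; rewrite !bnd_simp in sx xt.
by rewrite (le_trans s0)//= (le_trans xt).
Qed.

Lemma derive_loc_unif_cont phi p : (forall t, 0 <= t -> is_derive t (1 : R) phi (p t)) ->
  loc_unif_cont p -> loc_unif_cont phi.
Proof.
move=> phip pc T e e0; have [L L0 [_ lip]] := derive_lipschitz T phip pc.
have L1 : 0 < L + 1 by rewrite ltr_wpDl.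
exists (e / (L + 1)); first by rewrite divr_gt0.
move=> s t sT tT; rewrite ltr_pdivlMr// => st.
apply: le_lt_trans (lip _ _ sT tT) _; apply: le_lt_trans st.
by rewrite mulrC ler_wpM2l// lerDl.
Qed.

Section Regular.
Variable phi : R -> R.
Hypothesis reg : memory_regular phi.

Lemma mr_sqr_split T : exists2 M : R, 0 <= M &
  (forall t, 0 <= t <= T -> `|phi t| <= M) /\
  forall t, 0 <= t <= T -> memL1 mu t (fun r => phi r ^+ 2) /\
    memint mu t (fun r => phi r ^+ 2) <= memint mu 0 (fun r => phi r ^+ 2) + M ^+ 2.
Proof.
have [M M0 pM] := loc_unif_cont_bounded T (mr_loc_unif_cont reg).
exists M => //; split => // t /andP[t0 tT].
have [||||i1 i2] := @memL1_split 0 t (fun r => phi r ^+ 2) (fun r => phi r ^+ 2) (M ^+ 2) t0 _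
  _ (mr_hist reg).
- exact: sqr_ge0.
- by apply: measurable_funX; exact: mr_measurable reg.
- by move=> r _; rewrite ger0_norm ?sqr_ge0.
- move=> r r0 rt; rewrite normrX ler_pXn2r ?nnegrE ?pM//.
  by rewrite r0 (le_trans (ltW rt)).
split => //; under eq_memint do rewrite -[phi _ ^+ 2]ger0_norm ?sqr_ge0//.
rewrite (le_trans i2)// lerD2l ler_piMr ?sqr_ge0// ltW// kernel_mass_lt1//.
Qed.

Lemma mr_sqr t : 0 <= t -> memL1 mu t (fun r => phi r ^+ 2).
Proof.
by move=> t0; have [M _ [_ /(_ t)[]]] := mr_sqr_split t; rewrite ?t0 ?lexx.
Qed.

Lemma mr_memL1 t : 0 <= t -> memL1 mu t phi.
Proof. by move=> t0; apply: memL1_sqr => //; [exact: mr_measurable reg|exact: mr_sqr]. Qed.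

Lemma measurable_mr_shift h : measurable_fun setT (fun r => phi (r + h)).
Proof. by apply: (measurableT_comp (mr_measurable reg)); apply: measurable_funD. Qed.

Lemma mr_shift_sqr s h : 0 <= s -> 0 <= s + h ->
  memL1 mu s (fun r => (phi (r + h) - phi r) ^+ 2).
Proof.
move=> s0 sh0; apply: memL1_sqrB => //.
- exact: measurable_mr_shift.
- exact: mr_measurable reg.
- exact: (memL1_shift mu_adm (mr_sqr sh0)).
- exact: mr_sqr.
Qed.

(** Splitting at time [0] makes the estimate uniform in [s]: the earlier part is the continuity of
    translations of the history, the later part the uniform continuity of [phi]. *)
Lemma mr_shift_cont T e : 0 < e -> exists2 d : R, 0 < d & forall s h, 0 <= s -> 0 < h ->
  s + h <= T -> h < d -> memint mu s (fun r => (phi (r + h) - phi r) ^+ 2) <= e.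
Proof.
move=> e0; have e20 : 0 < e / 2 by rewrite divr_gt0.
have [d1 d10 H1] := mr_hist_cont reg e20.
(* The minimum with [1] ensures that [e1 ^+ 2 <= e1 <= e / 2]. *)
pose e1 := Num.min 1 (e / 2).
have e10 : 0 < e1 by rewrite lt_min ltr01.
have [d2 d20 H2] := mr_loc_unif_cont reg T e10.
exists (Num.min d1 d2); first by rewrite lt_min d10.
move=> s h s0 h0 sT; rewrite lt_min => /andP[hd1 hd2].
have [|||||i1 i2] := @memL1_split 0 s (fun r => (phi (r + h) - phi r) ^+ 2)
    (fun r => (phi (r + h) - phi r) ^+ 2) (e1 ^+ 2) s0 _ _ (mr_shift_sqr (lexx 0) _).
- exact: sqr_ge0.
- apply: measurable_funX; apply: measurable_funB; first exact: measurable_mr_shift.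
  exact: mr_measurable reg.
- by rewrite add0r ltW.
- by move=> r _; rewrite ger0_norm ?sqr_ge0.
- move=> r r0 rs; rewrite normrX ler_pXn2r ?nnegrE ?(ltW e10)// ltW// H2//; try lra.
  by rewrite addrAC subrr add0r gtr0_norm.
rewrite (_ : memint _ _ _ = memint mu s (fun r => `|(phi (r + h) - phi r) ^+ 2|)); last first.
  by apply: eq_memint => r _; rewrite ger0_norm ?sqr_ge0.
apply: le_trans i2 _; rewrite [leRHS](splitr e) lerD ?H1//.
apply: (@le_trans _ _ (e1 ^+ 2)).
  by rewrite ler_piMr ?sqr_ge0// ltW// kernel_mass_lt1.
rewrite expr2 (@le_trans _ _ e1)//; last by rewrite ge_min lexx orbT.
by rewrite ler_piMr ?(ltW e10)// ge_min lexx.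
Qed.

(** After a translation the two means are taken with the same kernel, so that their difference is
    the mean of an increment of [phi], which is small in mean square. *)
Lemma mr_mean_cont : loc_unif_cont (fun t => memint mu t phi).
Proof.
move=> T e e0; have e20 : 0 < e / 2 by rewrite divr_gt0.
have [d d0 H] := mr_shift_cont T (exprn_gt0 2 e20).
suff K s t : 0 <= s <= T -> 0 <= t <= T -> s < t -> t - s < d ->
    `|memint mu t phi - memint mu s phi| < e.
  exists d => // s t sT tT; have [st|ts|->] := ltgtP s t.
  - by rewrite gtr0_norm ?subr_gt0//; exact: K.
  - by rewrite distrC (distrC (memint _ _ _)) gtr0_norm ?subr_gt0//; exact: K.
  - by rewrite !subrr normr0.
move=> /andP[s0 sT] /andP[t0 tT] st tsd.
pose h := t - s; have th : t = s + h by rewrite /h addrC subrK.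
have h0 : 0 < h by rewrite subr_gt0.
have sh0 : 0 <= s + h by rewrite -th.
have q := H s h s0 h0 _ tsd; rewrite -th in q; have {q} := q tT => q.
have iq := mr_shift_sqr s0 sh0.
have isub : memL1 mu s (fun r => phi (r + h) - phi r).
  apply: memL1_sqr => //; apply: measurable_funB; first exact: measurable_mr_shift.
  exact: mr_measurable reg.
have -> : memint mu t phi - memint mu s phi = memint mu s (fun r => phi (r + h) - phi r).
  rewrite memintB ?memint_shift// -?th//.
  - exact: mr_measurable reg.
  - by apply: (memL1_shift mu_adm); exact: mr_memL1.
  - exact: mr_memL1.
have ic := memL1_cst mu_adm s (e / 4).
(* Young's inequality passes from the mean square to the mean; each of the two terms then
   contributes at most [e / 4]. *)
apply: (@le_lt_trans _ _ (memint mu s (fun r => e / 4 + e^-1 * (phi (r + h) - phi r) ^+ 2))).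
  apply: memint_abs_le => //; first by apply: memL1D => //; exact: memL1Z.
  move=> r _; set x := phi _ - phi _; rewrite -(real_normK (num_real x)).
  rewrite -(ler_pM2l e0) mulrDr mulVKf ?gt_eqF//.
  by have := sqr_ge0 (`|x| - e / 2); nra.
rewrite memintD//; last exact: memL1Z.
rewrite memint_cst// memintZ//.
have h1 : e^-1 * memint mu s (fun r => (phi (r + h) - phi r) ^+ 2) <= e / 4.
  by rewrite ler_pdivrMl//; apply: le_trans q _; lra.
have h2 : e / 4 * kernel_mass mu <= e / 4.
  by rewrite ler_piMr ?divr_ge0 ?(ltW e0)// ltW// kernel_mass_lt1.
lra.
Qed.

Lemma mr_deviation_cont : loc_unif_cont (fun t => phi t - memint mu t phi).
Proof.
move=> T e ep; have e20 : 0 < e / 2 by rewrite divr_gt0.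
have [d1 d10 H1] := mr_loc_unif_cont reg T e20.
have [d2 d20 H2] := mr_mean_cont T e20.
exists (Num.min d1 d2); first by rewrite lt_min d10.
move=> s t sT tT; rewrite lt_min => /andP[h1 h2].
have -> : phi t - memint mu t phi - (phi s - memint mu s phi) =
  phi t - phi s - (memint mu t phi - memint mu s phi) by ring.
by rewrite (le_lt_trans (ler_normB _ _))// (splitr e) ltrD ?H1 ?H2.
Qed.

End Regular.
End ModeRegularity.

Section IntegralBound.
Context {R : realType}.
Local Notation leb := (@lebesgue_measure R).

Lemma lebesgue_aeS (P Q : R -> Prop) : (forall r, P r -> Q r) ->
  {ae leb, forall r, P r} -> {ae leb, forall r, Q r}.
Proof. by move=> PQ; apply: filterS => //; exact: (ae_filter_ringOfSetsType leb). Qed.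

Lemma lebesgue_aeI (P Q : R -> Prop) :
  {ae leb, forall r, P r} -> {ae leb, forall r, Q r} -> {ae leb, forall r, P r /\ Q r}.
Proof. by move=> hP hQ; apply: filterI => //; exact: (ae_filter_ringOfSetsType leb). Qed.

Lemma lebesgue_aeW (P : R -> Prop) : (forall r, P r) -> {ae leb, forall r, P r}.
Proof. by move=> hP; exists set0; split => // r /= nP; apply: nP. Qed.

Lemma lebesgue_ae_neq (x : R) : {ae leb, forall r : R, r <> x}.
Proof.
exists [set x]; split; [exact: measurable_set1|exact: lebesgue_measure_set1|].
by move=> r /contrapT.
Qed.

Lemma Rintegral_ae_le_cst (s t k : R) (F : R -> R) : s <= t ->
  leb.-integrable `[s, t] (EFin \o F) -> {ae leb, forall r, s < r < t -> F r <= k} ->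
  \int[leb]_(r in `[s, t]) F r <= k * (t - s).
Proof.
move=> st iF Fk.
have ik : leb.-integrable `[s, t] (EFin \o cst k).
  by apply: continuous_compact_integrable;
    [exact: segment_compact|exact: continuous_subspaceT (@cst_continuous _ _ _)].
have Fk' : {ae leb, forall r, `[s, t]%classic r -> F r <= k}.
  have := lebesgue_aeI (lebesgue_aeI (lebesgue_ae_neq s) (lebesgue_ae_neq t)) Fk.
  apply: lebesgue_aeS => r [[/eqP rs /eqP rt] h]; rewrite /= in_itv /= => /andP[sr tr].
  by apply: h; rewrite !lt_neqAle sr tr rt eq_sym rs.
have -> : k * (t - s) = \int[leb]_(r in `[s, t]) k.
  rewrite Rintegral_cst//= lebesgue_measure_itv/= lte_fin.
  by move: st; rewrite le_eqVlt => /orP[/eqP ->|->//]; rewrite ltxx subrr.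
have -> : \int[leb]_(r in `[s, t]) F r = \int[leb]_(r in `[s, t]) Num.min (F r) k.
  apply: Rintegral_ae_eq.
  by apply: lebesgue_aeS Fk' => r h rs; rewrite min_l// h.
apply: le_Rintegral => //; last by move=> r _; rewrite ge_min lexx orbT.
have /integrableP[/measurable_EFinP mF _] := iF.
have iFk : leb.-integrable `[s, t] ((EFin \o (Num.norm \o F)) \+ (EFin \o (Num.norm \o cst
  k)))%E.
  by apply: integrableD => //; exact: integrable_norm.
apply: le_integrable iFk => //.
  by apply/measurable_EFinP; apply: measurable_minr => //; exact: measurable_cst.
move=> r _ /=; rewrite lee_fin [leRHS]ger0_norm ?addr_ge0//.
by rewrite /Num.min; case: ifP => _; rewrite ?lerDl ?lerDr.
Qed.

End IntegralBound.

Section ModeEnergy.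
Context {R : realType} (mu : R -> R).
Hypothesis mu_adm : admissible_kernel mu.
Local Notation leb := (@lebesgue_measure R).
Local Notation m := (kernel_mass mu).
Implicit Types (phi p b : R -> R) (s t r h T e lam tau B : R).

Definition mode_memory phi t : R := memint mu t (fun r => (phi t - phi r) ^+ 2).

(** This is [energy] along [phi t *: e], with [p] the derivative of [phi] and [e] a unit eigenvector
    of [S] whose eigenvalue has square [lam]. *)
Definition mode_energy lam phi p t : R :=
  2^-1 * p t ^+ 2 + (1 - m) / 2 * (lam * phi t ^+ 2) + 2^-1 * (lam * mode_memory phi t).

(** [F] stands for the weak second derivative tested against an eigenvector; being known almost
    everywhere only, it enters in integrated form. The elastic and memory terms are combined: with
    [m] the kernel mass, [(1 - m) phi(r)] plus the mean of [phi(r) - phi(r - s)] equals [phi(r)]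
    minus the mean of the past. *)
Definition mode_equation lam b tau phi p : Prop :=
  exists2 F : R -> R,
    forall s t, 0 < s -> s <= t -> leb.-integrable `[s, t] (EFin \o F) /\
      p t - p s = \int[leb]_(r in `[s, t]) F r &
    {ae leb, forall r, 0 < r ->
      F r = - lam * (phi r - memint mu r phi) - b r * p (r - tau)}.

Section Regular.
Variables (phi p : R -> R) (lam : R).
Hypothesis reg : mode_regular mu phi p.
Hypothesis lam0 : 0 <= lam.

Let mphi : measurable_fun setT phi := mr_measurable reg.

Lemma mode_memory_memL1 t : 0 <= t -> memL1 mu t (fun r => (phi t - phi r) ^+ 2).
Proof.
move=> t0; apply: memL1_sqrB => //; last exact: mr_sqr reg _ t0.
exact: memL1_cst.
Qed.

Lemma mode_memory_ge0 t : 0 <= mode_memory phi t.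
Proof. by apply: memint_ge0 => // r _; exact: sqr_ge0. Qed.

Lemma mode_energy_ge_velocity t : 2^-1 * p t ^+ 2 <= mode_energy lam phi p t.
Proof.
have m1 := kernel_mass_lt1 mu_adm.
have h1 : 0 <= (1 - m) / 2 * (lam * phi t ^+ 2).
  by rewrite mulr_ge0 ?divr_ge0 ?subr_ge0 ?(ltW m1)// mulr_ge0 ?sqr_ge0.
have h2 : 0 <= 2^-1 * (lam * mode_memory phi t) by rewrite mulr_ge0// mulr_ge0//
  mode_memory_ge0.
by rewrite /mode_energy; lra.
Qed.

Lemma mode_energy_ge0 t : 0 <= mode_energy lam phi p t.
Proof. by apply: le_trans (mode_energy_ge_velocity t); rewrite mulr_ge0 ?sqr_ge0. Qed.

(** The finite-increment form of the derivative of the memory energy, in which the dissipation due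
    to [mu'] is discarded by monotonicity of the kernel. For [M] proportional to [t - s] the last
    term is of third order in the step. *)
Lemma mode_memory_increment s t (M : R) : 0 <= s -> s < t -> 0 <= M ->
  (forall r, s <= r <= t -> `|phi r - phi s| <= M) ->
  mode_memory phi t <= mode_memory phi s
    + 2 * (phi t - phi s) * (m * phi t - memint mu t phi) + mu 0 * M ^+ 2 * (t - s).
Proof.
move=> s0 st M0 pM; have t0 : 0 <= t by rewrite (le_trans s0)// ltW.
pose D := phi t - phi s; pose c := mu 0 * M ^+ 2.
have mu00 : 0 <= mu 0 by rewrite (le_trans (kern_ge0 mu_adm 0))// kern_le.
have c0 : 0 <= c by rewrite mulr_ge0 ?sqr_ge0.
have lin : memL1 mu t (fun r => 2 * D * (phi t - phi r)).
  apply: memL1Z; apply: memL1B; first exact: memL1_cst.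
  exact: (mr_memL1 mu_adm reg).
have [[_ it] [_ is_]] := (mode_memory_memL1 t0, mode_memory_memL1 s0).
have [_ il] := lin.
have ic : leb.-integrable setT (EFin \o (cst c \_ `[s, t])).
  rewrite -restrict_EFin; apply/integrable_restrict => //=; rewrite setTI.
  by apply: continuous_compact_integrable;
    [exact: segment_compact|exact: continuous_subspaceT (@cst_continuous _ _ _)].
have iD := integrableD measurableT is_ il.
rewrite (_ : 2 * (phi t - phi s) * (m * phi t - memint mu t phi) =
  memint mu t (fun r => 2 * D * (phi t - phi r))); last first.
  rewrite memintZ; last by apply: memL1B; [exact: memL1_cst|exact: (mr_memL1 mu_adm reg)].
  rewrite memintB; [|exact: memL1_cst|exact: (mr_memL1 mu_adm reg)].
  by rewrite (memint_cst mu_adm t (phi t)) /D (mulrC m).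
rewrite (_ : mu 0 * M ^+ 2 * (t - s) = \int[leb]_r (cst c \_ `[s, t]) r); last first.
  rewrite -Rintegral_mkcond Rintegral_cst//= lebesgue_measure_itv/= lte_fin st//.
rewrite /mode_memory {1 2 3}/memint -RintegralD// -RintegralD//.
apply: le_Rintegral => //; first by apply: eq_integrable (integrableD measurableT iD ic).
move=> r _ /=; have k0 := kern_ge0 mu_adm; rewrite patchE.
(* With [x = phi t - phi r] and [D = phi t - phi s], the past satisfies [(phi s - phi r) ^+ 2 = (x -
   D) ^+ 2 >= x ^+ 2 - 2 * D * x]. Between [s] and [t] the same expression [x ^+ 2 - 2 * D * x] is
   at most [(phi r - phi s) ^+ 2]. *)
have [rs|sr] := ltP r s.
  have kk : kern mu (t - r) <= kern mu (s - r) by rewrite kern_nincr// ?subr_gt0//; lra.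
  rewrite memNset /=; last by rewrite in_itv /= => /andP[sr _]; move: rs; rewrite ltNge sr.
  have := k0 (t - r); have : phi s - phi r = (phi t - phi r) - D by rewrite /D; ring.
  have := ler_wpM2r (sqr_ge0 (phi s - phi r)) kk.
  set x := phi t - phi r; move=> h1 h2; rewrite h2 in h1 *; rewrite addr0 => h3.
  have := mulr_ge0 h3 (sqr_ge0 D); lra.
rewrite [kern mu (s - r)]kern_le0 ?mul0r ?add0r ?subr_le0//.
have [rt|tr] := leP r t; last first.
  rewrite kern_le0 ?mul0r ?add0r; last by rewrite subr_le0 ltW.
  by case: ifP.
rewrite mem_set /=; last by rewrite in_itv /= sr rt.
have := pM r; rewrite sr rt => /(_ isT) prs.
have : (phi r - phi s) ^+ 2 <= M ^+ 2.
  by rewrite -(real_normK (num_real (phi r - phi s))) ler_pXn2r ?nnegrE.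
have -> : phi r - phi s = D - (phi t - phi r) by rewrite /D; ring.
set x := phi t - phi r => h1.
have h2 : kern mu (t - r) * (x ^+ 2 - 2 * D * x) <= mu 0 * M ^+ 2.
  apply: (@le_trans _ _ (kern mu (t - r) * M ^+ 2)).
    by rewrite ler_wpM2l//; have := sqr_ge0 D; lra.
  by rewrite ler_wpM2r ?sqr_ge0// kern_le.
rewrite /c; lra.
Qed.

Lemma mode_energy_bounded T : exists K : R, forall t, 0 <= t <= T ->
  mode_energy lam phi p t <= K.
Proof.
have [M M0 [pM sqM]] := mr_sqr_split mu_adm reg T.
have [P P0 pP] := loc_unif_cont_bounded T (mr_cont reg).
pose S := memint mu 0 (fun r => phi r ^+ 2) + M ^+ 2.
exists (2^-1 * P ^+ 2 + (1 - m) / 2 * (lam * M ^+ 2) + 2^-1 * (lam * (2 * (M ^+ 2 + S)))).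
move=> t tT; have [it St] := sqM t tT; have /andP[t0 _] := tT.
have m1 := kernel_mass_lt1 mu_adm.
have sq x (Y : R) : `|x| <= Y -> x ^+ 2 <= Y ^+ 2.
  by move=> xY; rewrite -(real_normK (num_real x)) ler_pXn2r ?nnegrE// (le_trans _ xY).
rewrite /mode_energy lerD// ?lerD//.
- by rewrite ler_wpM2l ?sq// pP.
- by rewrite ler_wpM2l ?divr_ge0 ?subr_ge0 ?(ltW m1)// ler_wpM2l// sq// pM.
- rewrite ler_wpM2l// ler_wpM2l//.
  have ic := memL1_cst mu_adm t (phi t ^+ 2).
  apply: (@le_trans _ _ (memint mu t (fun r => 2 * (phi t ^+ 2 + phi r ^+ 2)))).
    apply: memint_le => //; first exact: mode_memory_memL1.
      by apply: memL1Z; exact: memL1D.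
    by move=> r _; have := sqr_ge0 (phi t + phi r); nra.
  rewrite memintZ; last exact: memL1D.
  rewrite ler_wpM2l// memintD// lerD// memint_cst//.
  rewrite (@le_trans _ _ (phi t ^+ 2))//; last by rewrite sq// pM.
  by rewrite ler_piMr ?sqr_ge0// ltW.
Qed.

Section Equation.
Variables (b : R -> R) (tau a c B e0 : R).
Hypothesis eqn : mode_equation lam b tau phi p.
Hypotheses (a0 : 0 <= a) (ac : a <= c) (B0 : 0 <= B) (e00 : 0 <= e0).
(** Covers both kinds of interval: on an undelayed one the first alternative holds and [B], [e0] are
    taken to be [0]; on a delayed one [e0] is the energy at the beginning of the period. *)
Hypothesis delay : forall r, a < r < c ->
  b r = 0 \/ `|b r| <= B /\ 2^-1 * p (r - tau) ^+ 2 <= e0.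

Let mean t := phi t - memint mu t phi.

Let mean_cont : loc_unif_cont mean := mr_deviation_cont mu_adm reg.

(** The equation is integrated against the fixed factor [p t]. Young's inequality bounds the product
    of the present and delayed velocities by the sum of their kinetic energies, hence by the energy
    at [t] plus [e0]. *)
Let velocity_increment (e K : R) s t : 0 <= e -> a <= s -> s < t -> t <= c ->
  (forall r, s < r < t -> `|p t| * (lam * `|mean r - mean t|) <= e) ->
  K = B * (mode_energy lam phi p t + e0) ->
  p t * (p t - p s) <= (- lam * mean t * p t + K + e) * (t - s).
Proof.
move=> e_ge0 as_ st tc me ->.
have [F Fint Feq] := eqn.
pose k := - lam * mean t * p t + B * (mode_energy lam phi p t + e0) + e.
have pos s' : 0 < s' -> s <= s' -> s' < t -> p t * (p t - p s') <= k * (t - s').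
  move=> s'0 ss' s't; have [iF ->] := Fint s' t s'0 (ltW s't).
  rewrite -RintegralZl//.
  have ipF : leb.-integrable `[s', t] (EFin \o (fun r => p t * F r)).
    by apply: eq_integrable (integrableZl _ (p t) iF) => // r _ /=; rewrite EFinM.
  apply: Rintegral_ae_le_cst => //; first exact: ltW.
  apply: lebesgue_aeS Feq => r FE /andP[s'r rt].
  have r0 : 0 < r by rewrite (lt_trans s'0).
  have srt : s < r < t by rewrite (le_lt_trans ss').
    rewrite (FE r0).
    have h1 : p t * (- lam * (mean r - mean t)) <= e.
      rewrite (le_trans (ler_norm _))// normrM normrM normrN (ger0_norm lam0) me//.
    have h2 : p t * (- (b r * p (r - tau))) <= B * (mode_energy lam phi p t + e0).
      have arc : a < r < c by case/andP: srt => ? ?;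
        rewrite (le_lt_trans as_)//= (lt_le_trans _ tc).
      have E0 := mode_energy_ge_velocity t; have E1 := mode_energy_ge0 t.
      have [->|[bB pe]] := delay arc; first by rewrite mul0r oppr0 mulr0 mulr_ge0// addr_ge0.
      rewrite (le_trans (ler_norm _))// normrM normrN normrM mulrCA.
      apply: (@le_trans _ _ (B * (`|p t| * `|p (r - tau)|)));
        first by rewrite ler_wpM2r ?mulr_ge0.
      rewrite ler_wpM2l//; move: E0 pe.
      rewrite -(real_normK (num_real (p t))) -(real_normK (num_real (p (r - tau)))).
      by have := sqr_ge0 (`|p t| - `|p (r - tau)|); lra.
    rewrite /k; move: h1 h2; rewrite /mean; lra.
have [s0|] := ltP 0 s; first exact: pos.
have s_ge0 := le_trans a0 as_; move=> s_le0.
have s0 : s = 0 by apply/eqP; rewrite eq_le s_le0.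
rewrite -/k s0 subr0; rewrite s0 in st.
apply/ler_addgt0Pl => x x0.
have x1 : 0 < x / (`|p t| + `|k| + 1) by rewrite divr_gt0// ltr_wpDl// addr_ge0.
set y := x / _ in x1.
have [d d0 dP] := mr_cont reg t x1.
(* [mode_equation] concerns positive times only. At [s = 0] the estimate is taken from a nearby
   [s'], with both [s'] and the change of [p] bounded by [y], which costs at most [x] in all. *)
pose s' := Num.min (Num.min d y) t / 2.
have s'0 : 0 < s' by rewrite divr_gt0// !lt_min d0 x1 st.
have [s'd s'y s't] : [/\ s' < d, s' <= y & s' < t].
  have : s' < Num.min (Num.min d y) t.
    by rewrite /s' ltr_pdivrMr// mulr2n mulrDr mulr1 ltrDl !lt_min d0 x1 st.
  by rewrite !lt_min => /andP[/andP[-> /ltW ->] ->].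
have h1 := pos s' s'0; rewrite s0 in h1; have {}h1 := h1 (ltW s'0) s't.
have h2 : `|p s' - p 0| < y.
  by apply: dP; rewrite ?lexx ?(ltW st)// ?(ltW s'0) ?(ltW s't)// subr0 gtr0_norm.
have h3 : p t * (p s' - p 0) <= `|p t| * y.
  by rewrite (le_trans (ler_norm _))// normrM ler_wpM2l// ltW.
have h4 : - k * s' <= `|k| * y.
  by rewrite (le_trans (ler_norm _))// normrM normrN (gtr0_norm s'0) ler_wpM2l.
have h5 : y * (`|p t| + `|k| + 1) = x.
  by rewrite /y divfK// gt_eqF// ltr_wpDl// addr_ge0.
by move: h1 h3 h4 h5 x1; rewrite mulrBr; lra.
Qed.

(** To first order the three parts of the energy contribute [- lam * mean * p],
    [(1 - m) * lam * phi * p] and [lam * p * (m * phi - memint)], which cancel because [mean] is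
    [phi - memint]; only the delayed term survives. The thirds of [e] absorb the oscillation of
    [mean], that of [p] between the mean value point and [t], and the remainder of
    [mode_memory_increment]. *)
Lemma mode_energy_step (e : R) : 0 < e -> exists2 d : R, 0 < d &
  forall s t, a <= s -> s < t -> t <= c -> t - s < d ->
    mode_energy lam phi p t - mode_energy lam phi p s
    <= (t - s) * (B * (mode_energy lam phi p t + e0) + e).
Proof.
move=> ep.
have [L L0 [pL pLip]] := derive_lipschitz c (mr_derive reg) (mr_cont reg).
have [G G0 mG] := loc_unif_cont_bounded c mean_cont.
pose mu0 := mu 0; have mu00 : 0 <= mu0 by rewrite (le_trans (kern_ge0 mu_adm 0))// kern_le.
have k1 : 0 < L * lam + 1 by rewrite ltr_wpDl// mulr_ge0.
have k2 : 0 < lam * G + 1 by rewrite ltr_wpDl// mulr_ge0.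
have k3 : 0 < lam * (mu0 * L ^+ 2) + 1 by rewrite ltr_wpDl// mulr_ge0// mulr_ge0// sqr_ge0.
have e1 : 0 < e / 3 / (L * lam + 1) by rewrite divr_gt0// divr_gt0.
have e2 : 0 < e / 3 / (lam * G + 1) by rewrite divr_gt0// divr_gt0.
have e3 : 0 < e / 3 / (lam * (mu0 * L ^+ 2) + 1) by rewrite divr_gt0// divr_gt0.
have [d1 d10 H1] := mean_cont c e1.
have [d2 d20 H2] := mr_cont reg c e2.
exists (Num.min (Num.min d1 d2) (Num.min 1 (e / 3 / (lam * (mu0 * L ^+ 2) + 1)))).
  by rewrite !lt_min d10 d20 ltr01.
move=> s t as_ st tc; rewrite !lt_min => /andP[/andP[hd1 hd2] /andP[hd3 hd4]].
have s0 := le_trans a0 as_; have t0 : 0 < t by rewrite (le_lt_trans s0).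
have tc' : 0 <= t <= c by rewrite (ltW t0).
have sc : 0 <= s <= c by rewrite s0 (le_trans (ltW st)).
pose h := t - s; have h0 : 0 < h by rewrite subr_gt0.
have V := velocity_increment (e := e / 3) (ltW (divr_gt0 ep (ltr0Sn _ 2))) as_ st tc _ erefl.
have {}V : p t * (p t - p s) <= (- lam * mean t * p t + B * (mode_energy lam phi p t + e0) + e
  / 3) * h.
  apply: V => r /andP[sr rt].
  have rc : 0 <= r <= c by rewrite (le_trans s0 (ltW sr)) (le_trans (ltW rt)).
  have : `|mean r - mean t| < e / 3 / (L * lam + 1).
    by apply: H1 => //; rewrite distrC gtr0_norm ?subr_gt0//; lra.
  rewrite ltr_pdivlMr// => /ltW; apply: le_trans.
  rewrite mulrA mulrC ler_wpM2l//.
  by rewrite (le_trans (ler_wpM2r lam0 (pL _ tc')))// lerDl.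
have Q := mode_memory_increment s0 st (M := L * h) _ _.
have {}Q : mode_memory phi t <= mode_memory phi s
    + 2 * (phi t - phi s) * (m * phi t - memint mu t phi) + mu 0 * (L * h) ^+ 2 * h.
  apply: Q; first by rewrite mulr_ge0// ltW.
  move=> r /andP[sr rt]; apply: le_trans (pLip _ _ sc _) _.
    by rewrite (le_trans s0 sr) (le_trans rt).
  by rewrite ler_wpM2l// ger0_norm ?subr_ge0// lerD2r.
have [x /andP[/= sx xt] D] : exists2 x, x \in `]s, t[%R & phi t - phi s = p x * h.
  apply: (MVT st) => [x|].
    by rewrite in_itv /= => /andP[sx _]; apply: mr_derive reg _ _; lra.
  apply: derivable_within_continuous => x; rewrite in_itv /= => /andP[sx _].
  by have := mr_derive reg (le_trans s0 sx); case.
rewrite !bnd_simp in sx xt.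
have xc : 0 <= x <= c by rewrite (le_trans s0 (ltW sx)) (le_trans (ltW xt)).
have px : `|p x - p t| < e / 3 / (lam * G + 1).
  by apply: H2 => //; rewrite distrC gtr0_norm ?subr_gt0//; lra.
have P : lam * ((p x - p t) * mean t) <= e / 3.
  rewrite (le_trans (ler_norm _))// normrM (ger0_norm lam0) normrM mulrCA.
  move: px; rewrite ltr_pdivlMr// => /ltW; apply: le_trans.
  rewrite ler_wpM2l// (le_trans (ler_wpM2l lam0 (mG _ tc')))// lerDl//.
have X : lam * (mu 0 * (L * h) ^+ 2) <= e / 3.
  move: hd4; rewrite ltr_pdivlMr// -/h => /ltW; apply: le_trans.
  have l0 : 0 <= lam * (mu0 * L ^+ 2) by rewrite mulr_ge0// mulr_ge0// sqr_ge0.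
  rewrite exprMn -/mu0 (_ : _ * (_ * _) = h * (h * (lam * (mu0 * L ^+ 2)))); last by ring.
  rewrite ler_wpM2l ?(ltW h0)// (@le_trans _ _ (lam * (mu0 * L ^+ 2)))//; last by rewrite lerDl.
  by rewrite ler_piMl// ltW.
have m1 := kernel_mass_lt1 mu_adm.
set E := mode_energy lam phi p t in V *.
(* Convexity of the square bounds an increment by the slope at the right end; [A2] uses the same for
   [phi]. *)
have A1 : 2^-1 * p t ^+ 2 - 2^-1 * p s ^+ 2 <= p t * (p t - p s).
  by have := sqr_ge0 (p t - p s); lra.
have A2 : (1 - m) / 2 * (lam * phi t ^+ 2) - (1 - m) / 2 * (lam * phi s ^+ 2)
    <= (1 - m) * (lam * (phi t * (p x * h))).
  rewrite -D -mulrBr -mulrBr -mulrA ler_wpM2l ?subr_ge0 ?(ltW m1)// mulrCA ler_wpM2l//.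
  by have := sqr_ge0 (phi t - phi s); lra.
have A3 : 2^-1 * (lam * mode_memory phi t) - 2^-1 * (lam * mode_memory phi s)
    <= lam * (p x * h * (m * phi t - memint mu t phi)) + 2^-1 * (lam * (mu 0 * (L * h) ^+ 2 *
      h)).
  move: (ler_wpM2l lam0 Q); rewrite D; lra.
have P' := ler_wpM2r (ltW h0) P; have X' := ler_wpM2r (ltW h0) X.
rewrite /E {1 2}/mode_energy -/E.
have := mulr_ge0 (mulr_ge0 lam0 (mulr_ge0 mu00 (sqr_ge0 (L * h)))) (ltW h0).
move: V A1 A2 A3 P' X'; rewrite /mean -/mu0 -/h; lra.
Qed.

Lemma mode_energy_gronwall :
  mode_energy lam phi p c + e0 <= expR (B * (c - a)) * (mode_energy lam phi p a + e0).
Proof.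
have [K EK] := mode_energy_bounded c.
apply: (local_gronwall (Y := fun t => mode_energy lam phi p t + e0) (K := K + e0)) => //.
  move=> t /andP[at_ tc]; rewrite addr_ge0 ?mode_energy_ge0//= lerD2r EK//.
  by rewrite (le_trans a0 at_).
move=> e ep; have [d d0 H] := mode_energy_step ep; exists d => // s t as_ st tc tsd.
by rewrite (_ : _ + e0 - _ = mode_energy lam phi p t - mode_energy lam phi p s) ?H//; ring.
Qed.

End Equation.
End Regular.
End ModeEnergy.

(** * Continuing a mode without delay *)

Section Primitive.
Context {R : realType}.
Local Notation leb := (@lebesgue_measure R).
Implicit Types (f g F G : R -> R) (a c s t T e : R).

(* The lower bound [-1] makes [0] an interior point, so that the primitive is
   derivable at [0] from both sides. *)
Definition primitive c f t : R :=
  \int[leb]_(r in `[-1, t]) f (Num.max r 0) - \int[leb]_(r in `[-1, c]) f (Num.max r 0).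

Lemma primitive_derive c f t : loc_unif_cont f -> 0 <= t ->
  is_derive t (1 : R) (primitive c f) (f t).
Proof.
move=> fc t0; have cont := loc_unif_cont_max fc.
have [|||dF dE] := @continuous_FTC1_closed R (fun r => f (Num.max r 0)) (-1) t (t + 1) _ _ _
  (cont t).
- by rewrite ltrDl.
- apply: continuous_compact_integrable; first exact: segment_compact.
  exact: continuous_subspaceT.
- by rewrite (lt_le_trans _ t0)// oppr_lt0.
rewrite -[f t]subr0; apply: is_deriveB.
by apply: DeriveDef => //; rewrite -derive1E dE max_l.
Qed.

Lemma primitive_eq0 c f t : 0 <= c -> (forall r, r <= c -> 0 <= r -> f r = 0) -> t <= c ->
  primitive c f t = 0.
Proof.
move=> c0 f0 tc; have z s : s <= c -> \int[leb]_(r in `[-1, s]) f (Num.max r 0) = 0.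
  move=> sc; rewrite -[RHS](mul0r (fine (leb `[-1, s]))) -(Rintegral_cst leb (measurable_itv
    _)).
  apply: eq_Rintegral => r; rewrite inE /= in_itv /= => /andP[_ rs].
  by rewrite f0// ?ge_max ?c0 ?andbT ?le_max ?lexx ?orbT// (le_trans rs).
by rewrite /primitive !z ?subrr.
Qed.

(** The mean value theorem is applied to [G - k * F] with [k = 1] and [k = -1]. *)
Lemma derive_increment_le a c F G (f g : R -> R) : 0 <= a -> a <= c ->
  (forall t, 0 <= t -> is_derive t (1 : R) F (f t)) ->
  (forall t, 0 <= t -> is_derive t (1 : R) G (g t)) ->
  (forall t, a <= t <= c -> `|f t| <= g t) -> `|F c - F a| <= G c - G a.
Proof.
move=> a0 ac dF dG fg.
have K (k : R) : `|k| = 1 -> k * (F c - F a) <= G c - G a.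
  move=> k1.
  have dGF t : 0 <= t -> is_derive t (1 : R) (fun t => G t - k * F t) (g t - k * f t).
    by move=> t0; have := dF t t0; have := dG t t0 => ? ?; apply: is_deriveB.
  have [||x] := @MVT_segment R (fun t => G t - k * F t) (fun t => g t - k * f t) a c ac.
  - by move=> x; rewrite in_itv /= => /andP[ax _]; apply: dGF; rewrite (le_trans a0)// ltW.
  - apply: derivable_within_continuous => x; rewrite in_itv /= => /andP[ax _].
    by have := dGF _ (le_trans a0 ax); case.
  rewrite in_itv /= => xac E; rewrite -subr_ge0.
  have -> : G c - G a - k * (F c - F a) = (g x - k * f x) * (c - a) by rewrite -E; ring.
  rewrite mulr_ge0 ?subr_ge0// (le_trans _ (fg _ xac))//.
  by rewrite (le_trans (ler_norm _))// normrM k1 mul1r.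
rewrite ler_norml lerNl; apply/andP; split.
  by rewrite -mulN1r; apply: K; rewrite normrN normr1.
by rewrite -[_ - _]mul1r; apply: K; rewrite normr1.
Qed.

Lemma primitive_base c f : primitive c f c = 0.
Proof. exact: subrr. Qed.

Lemma derive_integral F f s t : loc_unif_cont f ->
  (forall t, 0 <= t -> is_derive t (1 : R) F (f t)) -> 0 < s -> s <= t ->
  F t - F s = \int[leb]_(r in `[s, t]) f r.
Proof.
move=> fc dF s0; rewrite le_eqVlt => /orP[/eqP ->|st].
  by rewrite subrr set_itv1 Rintegral_set1.
have Fc x : 0 <= x -> {for x, continuous F}.
  by move=> x0; apply/differentiable_continuous; rewrite -derivable1_diffP; have := dF x x0;
    case.
rewrite /Rintegral (@continuous_FTC2 R f F s t st)//.
- apply: continuous_subspaceW (loc_unif_cont_within fc) => x /=.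
  by rewrite !in_itv /= andbT => /andP[sx _]; rewrite (le_trans (ltW s0)).
- split.
  + move=> x; rewrite in_itv /= => /andP[sx _].
    by have := dF x (ltW (lt_trans s0 sx)); case.
  + by apply: cvg_at_right_filter; exact: Fc (ltW s0).
  + by apply: cvg_at_left_filter; exact: Fc (ltW (lt_trans s0 st)).
- move=> x; rewrite in_itv /= => /andP[sx _]; rewrite derive1E.
  by have := dF x (ltW (lt_trans s0 sx)) => dx; rewrite derive_val.
Qed.

Lemma loc_unif_cont_comp_max c f : 0 <= c -> loc_unif_cont f ->
  loc_unif_cont (fun t => f (Num.max t c)).
Proof.
move=> c0 fc T e e0; have [d d0 dP] := fc (Num.max T c) e e0; exists d => // s t sT tT st.
have h x : 0 <= x <= T -> 0 <= Num.max x c <= Num.max T c.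
  by move=> /andP[x0 xT]; rewrite le_max x0 /= ge_max le_max xT /= le_max lexx orbT.
apply: dP; rewrite ?h//; apply: le_lt_trans st; rewrite /Num.max.
case: ltP => h1; case: ltP => h2.
- by rewrite subrr normr0.
- by rewrite distrC (distrC t) !ger0_norm; lra.
- by rewrite !ger0_norm; lra.
- by [].
Qed.

Lemma loc_unif_contB f g : loc_unif_cont f -> loc_unif_cont g ->
  loc_unif_cont (fun t => f t - g t).
Proof.
move=> fc gc T e ep; have e20 : 0 < e / 2 by rewrite divr_gt0.
have [d1 d10 H1] := fc T _ e20; have [d2 d20 H2] := gc T _ e20.
exists (Num.min d1 d2); first by rewrite lt_min d10.
move=> s t sT tT; rewrite lt_min => /andP[h1 h2].
have -> : f t - g t - (f s - g s) = f t - f s - (g t - g s) by ring.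
by rewrite (le_lt_trans (ler_normB _ _))// (splitr e) ltrD ?H1 ?H2.
Qed.

Lemma loc_unif_contZ (k : R) f : loc_unif_cont f -> loc_unif_cont (fun t => k * f t).
Proof.
move=> fc T e ep; have k1 : 0 < `|k| + 1 by rewrite ltr_wpDl.
have [d d0 H] := fc T _ (divr_gt0 ep k1); exists d => // s t sT tT st.
rewrite -mulrBr normrM; have := H s t sT tT st; rewrite ltr_pdivlMr//.
by apply: le_lt_trans; rewrite mulrC ler_wpM2l// lerDl.
Qed.

Lemma loc_unif_cont_cst (k : R) : loc_unif_cont (fun=> k).
Proof. by move=> T e e0; exists 1 => // s t _ _ _; rewrite subrr normr0. Qed.

Lemma geometric_cauchy_limit (u : nat -> R) (M : R) :
  (forall n, `|u n.+1 - u n| <= M * 2^-1 ^+ n) ->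
  forall n, `|lim (u n @[n --> \oo]) - u n| <= 2 * M * 2^-1 ^+ n.
Proof.
move=> uM.
have q0 : 0 < 2^-1 :> R by [].
have M0 : 0 <= M by have := uM 0%N; rewrite expr0 mulr1; exact: le_trans.
(* The subtracted term is what lets the induction on [k] close. *)
have tail n k : `|u (n + k)%N - u n| <= 2 * M * 2^-1 ^+ n - 2 * M * 2^-1 ^+ (n + k).
  elim: k => [|k IH]; first by rewrite addn0 !subrr normr0.
  rewrite addnS -(subrKA (u (n + k)%N)) (le_trans (ler_normD _ _))//.
  by have := uM (n + k)%N; have := IH; rewrite exprS; lra.
have tail' n k : `|u (n + k)%N - u n| <= 2 * M * 2^-1 ^+ n.
  by rewrite (le_trans (tail n k))// gerBl mulr_ge0 ?exprn_ge0 ?(ltW q0)// mulr_ge0.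
have cu : cvgn u.
  apply/cauchy_cvgP; apply: cauchy_exP => e e0.
  have M1 : 0 < 2 * M + 1 by rewrite ltr_wpDl// mulr_ge0.
  have [n _ /(_ n (leqnn n)) /= hn] := near_infty_natSinv_expn_lt (PosNum (divr_gt0 e0 M1)).
  exists (u n); near=> m.
  have nm : (n <= m)%N by near: m; exists n.
  rewrite /= -ball_normE /= distrC -(subnKC nm) (le_lt_trans (tail' _ _))//.
  move: hn; rewrite /= ltr_pdivlMr// => hn; apply: le_lt_trans hn.
  by rewrite [leRHS]mulrC div1r -exprVn ler_wpM2r ?exprn_ge0 ?(ltW q0)// lerDl.
move=> n; have cn : (u (n + k)%N - u n) @[k --> \oo] --> lim (u n @[n --> \oo]) - u n.
  apply: cvgB; last exact: cvg_cst.
  have := cu; rewrite -(cvg_shiftn n) => h.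
  by under eq_fun do rewrite addnC.
have : (`|u (n + k)%N - u n|) @[k --> \oo] --> `|lim (u n @[n --> \oo]) - u n|.
  exact: cvg_norm cn.
move=> /cvg_lim <- //; apply: limr_le; last by apply: nearW => k; exact: tail'.
by apply/cvg_ex; eexists; exact: cvg_norm cn.
Unshelve. all: by end_near. Qed.

End Primitive.

Section Volterra.
Context {R : realType} (mu : R -> R).
Hypothesis mu_adm : admissible_kernel mu.
Local Notation leb := (@lebesgue_measure R).
Implicit Types (f g y z : R -> R) (s t r h T e : R).

Lemma measurable_eq_before f g c : 0 <= c -> measurable_fun setT f ->
  loc_unif_cont f -> loc_unif_cont g -> (forall t, t <= c -> g t = f t) ->
  measurable_fun setT g.
Proof.
move=> c0 mf fc gc fg.
rewrite (_ : g = fun t => f t + (g (Num.max t 0) - f (Num.max t 0))).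
  apply: measurable_funD => //; apply: continuous_measurable_fun.
  exact: loc_unif_cont_max (loc_unif_contB gc fc).
apply/funext => t; have [t0|t0] := leP 0 t; first by rewrite addrC subrK.
by rewrite (fg 0)// subrr addr0 fg// (le_trans (ltW t0)).
Qed.

(** Square integrability and continuity of translations are conditions at time [0], so they survive
    any continuous change after [c]. Strict positivity of [c] leaves room for small translations,
    which look at arguments slightly above [0]. *)
Lemma memory_regular_eq_before f g c : 0 < c -> memory_regular mu f ->
  loc_unif_cont g -> (forall t, t <= c -> g t = f t) -> memory_regular mu g.
Proof.
move=> c0 reg gc fg.
have mg : measurable_fun setT g.
  exact: measurable_eq_before (ltW c0) (mr_measurable reg) (mr_loc_unif_cont reg) gc fg.
split => //.
  apply: (memL1_le mu_adm _ (mr_hist reg)); first exact: measurable_funX.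
  by move=> r r0; rewrite fg ?ger0_norm ?sqr_ge0// ltW// (lt_trans r0).
move=> e e0; have [d d0 H] := mr_hist_cont reg e0.
exists (Num.min d c) => [|h h0]; first by rewrite lt_min d0.
rewrite lt_min => /andP[hd hc]; rewrite (le_trans _ (H h h0 hd))//.
rewrite le_eqVlt; apply/orP; left; apply/eqP; apply: eq_memint => r r0.
by rewrite !fg//; lra.
Qed.

Section Extension.
Variables (phi p : R -> R) (lam c kappa : R).
Hypothesis reg : mode_regular mu phi p.
(** The force is Lipschitz with constant [2 * lam], because the kernel mass is below [1], and each
    of two integrations of the weight gains a factor [1 / kappa]. The condition makes the resulting
    factor at most [1 / 2]. *)
Hypotheses (lam0 : 0 <= lam) (c0 : 0 < c) (kappa0 : 0 < kappa) (kappa_large : 4 * lam <= kappa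
  ^+ 2).

Let force y t := - lam * (y t - memint mu t y).

Let force_cont y : memory_regular mu y -> loc_unif_cont (force y).
Proof. by move=> yr; apply: loc_unif_contZ; exact: mr_deviation_cont. Qed.

(** The force does not vanish before [c]. Truncating time there makes the velocity, and with it the
    displacement, vanish up to [c], so that the given past is kept. *)
Let velocity y t := primitive c (force y) (Num.max t c).

Let velocity_cont y : memory_regular mu y -> loc_unif_cont (velocity y).
Proof.
move=> yr; apply: loc_unif_cont_comp_max (ltW c0) _.
apply: (derive_loc_unif_cont (p := force y)); last exact: force_cont.
by move=> t; apply: primitive_derive; exact: force_cont.
Qed.

Let velocity_before y t : t <= c -> velocity y t = 0.
Proof. by move=> tc; rewrite /velocity max_r// primitive_base. Qed.

Let displacement y := primitive c (velocity y).

Let displacement_derive y t : memory_regular mu y -> 0 <= t ->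
  is_derive t (1 : R) (displacement y) (velocity y t).
Proof. by move=> yr; apply: primitive_derive; exact: velocity_cont. Qed.

Let displacement_before y t : t <= c -> displacement y t = 0.
Proof. by apply: primitive_eq0 => [|r rc _]; [exact: ltW|exact: velocity_before]. Qed.

Let expkappa_derive (K : R) t :
  is_derive t (1 : R) (fun t => K / kappa * expR (kappa * t)) (K * expR (kappa * t)).
Proof.
apply: is_derive_eq.
by rewrite /GRing.scale /= mulr1; field; exact: lt0r_neq0.
Qed.

(* The weight [e^(kappa t)] makes the Volterra operator a contraction. *)
Let contraction y z (Y : R) t : memory_regular mu y -> memory_regular mu z -> c <= t ->
  0 <= Y -> (forall r, r <= c -> y r = z r) ->
  (forall r, c <= r <= t -> `|y r - z r| <= Y * expR (kappa * r)) ->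
  `|displacement y t - displacement z t| <= 2^-1 * Y * expR (kappa * t).
Proof.
move=> yr zr ct Y0 yz yzY.
have m1 := kernel_mass_lt1 mu_adm.
have Yge r s : r <= s -> Y * expR (kappa * r) <= Y * expR (kappa * s).
  by move=> rs; rewrite ler_wpM2l// ler_expR ler_pM2l.
have Ye0 r : 0 <= Y * expR (kappa * r) by rewrite mulr_ge0 ?expR_ge0.
have fF r : c <= r <= t -> `|force y r - force z r| <= 2 * lam * Y * expR (kappa * r).
  move=> /andP[cr rt]; have r0 : 0 <= r by rewrite (le_trans (ltW c0)).
  have iy := mr_memL1 mu_adm yr r0; have iz := mr_memL1 mu_adm zr r0.
  have -> : force y r - force z r = - lam * (y r - z r - memint mu r (fun s => y s - z s)).
    by rewrite memintB// /force; ring.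
  rewrite normrM normrN (ger0_norm lam0) mulrC -mulrA mulrAC ler_wpM2r//.
  rewrite mulr_natl mulr2n (le_trans (ler_normB _ _))// lerD//; first by rewrite yzY// cr.
  apply: (@le_trans _ _ (memint mu r (cst (Y * expR (kappa * r))))).
    apply: memint_abs_le => //; [exact: memL1B|exact: memL1_cst|].
    move=> s sr; have [cs|sc] := leP c s; last by rewrite (yz _ (ltW sc)) subrr normr0 Ye0.
    by rewrite (le_trans (yzY _ _)) ?Yge ?(ltW sr)// cs (le_trans (ltW sr)).
  by rewrite memint_cst// ler_piMr// ltW.
have fV r : c <= r <= t ->
  `|velocity y r - velocity z r| <= 2 * lam * Y / kappa * expR (kappa * r).
  move=> /andP[cr rt]; rewrite /velocity max_l//.
  have := @derive_increment_le R c r (fun t => primitive c (force y) t - primitive c (force z)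
    t)
    (fun t => 2 * lam * Y / kappa * expR (kappa * t))
    (fun t => force y t - force z t) (fun t => 2 * lam * Y * expR (kappa * t)) (ltW c0) cr.
  rewrite !primitive_base subr0 subr0 => H; apply: le_trans (H _ _ _) _.
  - by move=> s s0; apply: is_deriveB; apply: primitive_derive => //; exact: force_cont.
  - by move=> s _; exact: expkappa_derive.
  - by move=> s /andP[cs sr]; rewrite fF// cs (le_trans sr).
  - by rewrite gerBl mulr_ge0 ?expR_ge0// divr_ge0 ?(ltW kappa0)// !mulr_ge0.
have := @derive_increment_le R c t (fun t => displacement y t - displacement z t)
    (fun t => 2 * lam * Y / kappa / kappa * expR (kappa * t))
    (fun t => velocity y t - velocity z t) (fun t => 2 * lam * Y / kappa * expR (kappa * t))
      (ltW c0) ct.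
rewrite !(displacement_before _ (lexx c)) subr0 subr0 => H; apply: le_trans (H _ _ _) _.
- by move=> s s0; apply: is_deriveB; exact: displacement_derive.
- by move=> s _; exact: expkappa_derive.
- by move=> s sct; exact: fV.
apply: (@le_trans _ _ (2 * lam * Y / kappa / kappa * expR (kappa * t))).
  by rewrite gerBl mulr_ge0 ?expR_ge0// !divr_ge0 ?(ltW kappa0)// !mulr_ge0.
rewrite ler_wpM2r ?expR_ge0// ler_pdivrMr// ler_pdivrMr//.
by have := ler_wpM2l Y0 kappa_large; lra.
Qed.

(* Continues [phi] beyond time [c] with the constant velocity [p c]. *)
Let start t := phi t - primitive c (fun s => p (Num.max s c) - p c) t.

Let defect_cont : loc_unif_cont (fun s => p (Num.max s c) - p c).
Proof.
apply: loc_unif_contB; last exact: loc_unif_cont_cst.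
by apply: loc_unif_cont_comp_max (ltW c0) _; exact: mr_cont reg.
Qed.

Let start_before t : t <= c -> start t = phi t.
Proof.
move=> tc; rewrite /start primitive_eq0 ?subr0// ?(ltW c0)// => r rc _.
by rewrite max_r// subrr.
Qed.

Let start_derive t : 0 <= t -> is_derive t (1 : R) start (p t - (p (Num.max t c) - p c)).
Proof.
move=> t0; apply: is_deriveB; first exact: mr_derive reg _ t0.
exact: (primitive_derive c defect_cont t0).
Qed.

Let start_cont : loc_unif_cont start.
Proof.
apply: derive_loc_unif_cont start_derive _.
by apply: loc_unif_contB; [exact: mr_cont reg|exact: defect_cont].
Qed.

(** Picard iteration for the fixed point [start + displacement]. The sum is written as a double
    subtraction so that [loc_unif_contB] and [is_deriveB] apply. *)
Let iterate := fix iterate n := if n is k.+1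
  then fun t => start t - (0 - displacement (iterate k) t) else start.

Let iterateS n t : iterate n.+1 t = start t - (0 - displacement (iterate n) t).
Proof. by []. Qed.

Let iterate_before n t : t <= c -> iterate n t = phi t.
Proof.
by case: n => [|n] tc /=; rewrite ?displacement_before ?subr0 ?start_before.
Qed.

Let displacement_cont y : memory_regular mu y -> loc_unif_cont (displacement y).
Proof.
move=> yr; apply: (derive_loc_unif_cont (p := velocity y)); last exact: velocity_cont.
by move=> t; exact: displacement_derive.
Qed.

Let iterate_regular n : memory_regular mu (iterate n).
Proof.
apply: (memory_regular_eq_before c0 reg); last exact: iterate_before.
elim: n => [|n IH]; first exact: start_cont.
apply: loc_unif_contB; first exact: start_cont.
apply: loc_unif_contB; first exact: loc_unif_cont_cst.
apply: displacement_cont.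
by apply: (memory_regular_eq_before c0 reg) => //; exact: iterate_before.
Qed.

(** Only [Y] depends on the time horizon [T]; the weight and the ratio [1 / 2] do not. *)
Let iterate_increment T : exists2 Y : R, 0 <= Y & forall n t, c <= t <= T ->
  `|iterate n.+1 t - iterate n t| <= Y * expR (kappa * t) * 2^-1 ^+ n.
Proof.
have [Y Y0 HY] := loc_unif_cont_bounded T (displacement_cont (iterate_regular 0)).
exists Y => //; elim => [|n IH] t /andP[ct tT].
  rewrite expr0 mulr1 /= sub0r opprK addrAC subrr add0r.
  rewrite (le_trans (HY t _))//; first by rewrite (le_trans (ltW c0) ct).
  by rewrite ler_peMr// -expR0 ler_expR mulr_ge0// ltW// (lt_le_trans c0).
rewrite [X in `|X|](_ : _ = displacement (iterate n.+1) t - displacement (iterate n) t);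
  last first.
  rewrite (iterateS n.+1) (iterateS n);
    move: (displacement (iterate n.+1) t) (displacement (iterate n) t).
  by move: (start t) => x y z; ring.
have := @contraction (iterate n.+1) (iterate n) (Y * 2^-1 ^+ n) t (iterate_regular _)
  (iterate_regular _) ct.
move=> /(_ _ _ _) H; apply: le_trans (H _ _ _) _.
- by rewrite mulr_ge0 ?exprn_ge0.
- by move=> r rc; rewrite !iterate_before.
- move=> r /andP[cr rt]; rewrite mulrAC IH// cr (le_trans rt)//.
by rewrite le_eqVlt; apply/orP; left; apply/eqP; rewrite exprS; ring.
Qed.

Let limit t := lim (iterate n t @[n --> \oo]).

Let limit_before t : t <= c -> limit t = phi t.
Proof.
move=> tc; rewrite /limit; under eq_fun do rewrite iterate_before//.
by apply: cvg_lim => //; exact: cvg_cst.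
Qed.

Let limit_approx T : exists2 Y : R, 0 <= Y & forall n t, t <= T ->
  `|limit t - iterate n t| <= Y * expR (kappa * t) * 2^-1 ^+ n.
Proof.
have [Y Y0 HY] := iterate_increment T.
exists (2 * Y); first by rewrite mulr_ge0.
move=> n t tT; have [tc|ct] := leP t c.
  by rewrite limit_before// iterate_before// subrr normr0 !mulr_ge0 ?expR_ge0 ?exprn_ge0.
rewrite -[2 * Y * _]mulrA; apply: (@geometric_cauchy_limit R (iterate^~ t)) => k.
by apply: HY; rewrite (ltW ct).
Qed.

Let limit_cont : loc_unif_cont limit.
Proof.
move=> T e e0; have [Y Y0 HY] := limit_approx T.
have M1 : 0 < Y * expR (kappa * T) + 1 by rewrite ltr_wpDl// mulr_ge0 ?expR_ge0.
have e30 : 0 < e / 3 by rewrite divr_gt0.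
have [n _ /(_ n (leqnn n)) /= hn] := near_infty_natSinv_expn_lt (PosNum (divr_gt0 e30 M1)).
have {}hn t : 0 <= t <= T -> `|limit t - iterate n t| < e / 3.
  move=> /andP[t0 tT]; apply: le_lt_trans (HY n t tT) _.
  move: hn; rewrite /= ltr_pdivlMr// div1r -exprVn mulrC; apply: le_lt_trans.
  rewrite ler_wpM2r ?exprn_ge0//; apply: (@le_trans _ _ (Y * expR (kappa * T)));
    last by rewrite lerDl.
  by rewrite ler_wpM2l// ler_expR ler_pM2l.
have [d d0 H] := mr_loc_unif_cont (iterate_regular n) T e30.
exists d => // s t sT tT st; have := H s t sT tT st; have := hn s sT; have := hn t tT.
have -> : limit t - limit s = (limit t - iterate n t) + (iterate n t - iterate n s) - (limit s
  - iterate n s) by ring.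
move=> h1 h2 h3; rewrite (le_lt_trans (ler_normB _ _))//.
by have := ler_normD (limit t - iterate n t) (iterate n t - iterate n s); lra.
Qed.

Let limit_regular : memory_regular mu limit.
Proof. exact: memory_regular_eq_before c0 reg limit_cont limit_before. Qed.

Let limit_fixpoint t : limit t = start t + displacement limit t.
Proof.
have [tc|ct] := leP t c.
  by rewrite limit_before// start_before// displacement_before// addr0.
have [Y Y0 HY] := limit_approx t.
apply/eqP; rewrite -subr_eq0 -normr_le0; apply/ler_addgt0Pl => e e0; rewrite addr0.
have M1 : 0 < Y * expR (kappa * t) + 1 by rewrite ltr_wpDl// mulr_ge0 ?expR_ge0.
have [n _ /(_ n (leqnn n)) /= hn] := near_infty_natSinv_expn_lt (PosNum (divr_gt0 e0 M1)).
have h1 := HY n.+1 t (lexx t).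
have := @contraction limit (iterate n) (Y * 2^-1 ^+ n) t limit_regular (iterate_regular _)
  (ltW ct).
move=> /(_ _ _ _) H.
have {}H : `|displacement limit t - displacement (iterate n) t| <= 2^-1 * (Y * 2^-1 ^+ n) *
  expR (kappa * t).
  apply: H; first by rewrite mulr_ge0 ?exprn_ge0.
  - by move=> r rc; rewrite limit_before// iterate_before.
  - by move=> r /andP[cr rt]; rewrite mulrAC HY.
have -> : limit t - (start t + displacement limit t) =
    (limit t - iterate n.+1 t) - (displacement limit t - displacement (iterate n) t).
  rewrite iterateS; move: (displacement limit t) (displacement (iterate n) t) (limit t).
  by move: (start t) => x y z w; ring.
rewrite (le_trans (ler_normB _ _))// (le_trans (lerD h1 H))//.
have {}hn : 2^-1 ^+ n * (Y * expR (kappa * t) + 1) < e.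
  by move: hn; rewrite /= ltr_pdivlMr// div1r -exprVn.
have q0 : 0 <= 2^-1 ^+ n :> R by rewrite exprn_ge0.
move: hn q0; rewrite exprS; move: (expR _) (2^-1 ^+ n) => X q h2 h3.
have h4 : Y * X * q <= e by lra.
by apply: le_trans h4; lra.
Qed.

Lemma volterra_extension_weighted : exists psi q,
  [/\ mode_regular mu psi q, forall t, t <= c -> psi t = phi t,
      forall t, t <= c -> q t = p t &
      forall s t, c <= s -> s <= t ->
        q t - q s = \int[leb]_(r in `[s, t]) (- lam * (psi r - memint mu r psi))].
Proof.
exists limit, (fun t => p t - (p (Num.max t c) - p c) - (0 - velocity limit t)); split.
- split => //.
  + move=> t t0.
    have E : limit = fun s => start s - (0 - displacement limit s).
      by apply/funext => s; rewrite sub0r opprK; exact: limit_fixpoint.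
    have D : is_derive t 1 (fun s => start s - (0 - displacement limit s))
        (p t - (p (Num.max t c) - p c) - (0 - velocity limit t)).
      apply: is_deriveB; first exact: start_derive.
      by apply: is_deriveB; apply: displacement_derive.
    by rewrite -E in D.
  + apply: loc_unif_contB.
      by apply: loc_unif_contB; [exact: mr_cont reg|exact: defect_cont].
    by apply: loc_unif_contB; [exact: loc_unif_cont_cst|exact: velocity_cont].
- exact: limit_before.
- by move=> t tc; rewrite velocity_before// max_r// !subrr !subr0.
- move=> s t cs st.
  have dF r : 0 <= r -> is_derive r 1 (primitive c (force limit)) (force limit r).
    by move=> r0; apply: primitive_derive => //; exact: force_cont.
  have := derive_integral (force_cont limit_regular) dF (lt_le_trans c0 cs) st.
  rewrite /force => <-; rewrite /velocity !max_l ?(le_trans cs)// /force.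
  by move: (primitive _ _ t) (primitive _ _ s) => x y; ring.
Qed.

End Extension.

Lemma volterra_extension phi p lam c : mode_regular mu phi p -> 0 <= lam -> 0 < c ->
  exists psi q,
  [/\ mode_regular mu psi q, forall t, t <= c -> psi t = phi t,
      forall t, t <= c -> q t = p t &
      forall s t, c <= s -> s <= t ->
        q t - q s = \int[leb]_(r in `[s, t]) (- lam * (psi r - memint mu r psi))].
Proof.
(* This weight is positive even for [lam = 0], and its square is at least [4 * lam]. *)
move=> reg lam0 c0; apply: (volterra_extension_weighted reg lam0 c0 (kappa := 2 * (lam + 1))).
  by rewrite mulr_gt0// ltr_wpDl.
by have := sqr_ge0 lam; lra.
Qed.

End Volterra.

(** * Half-line memory integrals and time translations *)

Section HalfLine.
Context {R : realType} (mu : R -> R).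
Hypothesis mu_adm : admissible_kernel mu.
Local Notation leb := (@lebesgue_measure R).
Implicit Types (f g phi : R -> R) (s t r h T e a : R).

Lemma half_line_kern f s : ((fun s => mu s * f s) \_ `]0, +oo[) s = kern mu s * f s.
Proof.
rewrite patchE /kern; have [s0|s0] := ltP 0 s.
  by rewrite mem_set//= in_itv /= s0.
rewrite memNset ?mul0r//= in_itv /= andbT => h.
by move: s0; rewrite leNgt h.
Qed.

Lemma ge0_half_line_integral t g : measurable_fun setT g -> (forall r, 0 <= g r) ->
  (\int[leb]_(s in `]0%R, +oo[) (mu s * g (t - s)%R)%:E = \int[leb]_r (kern mu (t - r) * g
    r)%:E)%E.
Proof.
move=> mg g0; rewrite integral_mkcond.
have mF : measurable_fun setT (fun r => kern mu (t - r) * g r).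
  by apply: measurable_funM => //; exact: measurable_kern_reflect.
rewrite -[RHS](ge0_integral_reflect t (f := fun r => (kern mu (t - r) * g r)%:E)).
- apply: eq_integral => s _; rewrite subKr -(half_line_kern (fun s => g (t - s))) /=.
  by rewrite !patchE; case: ifP.
- exact/measurable_EFinP.
- by move=> r; rewrite lee_fin mulr_ge0// kern_ge0.
Qed.

Lemma memL1_half_line t g : measurable_fun setT g -> (forall r, 0 <= g r) ->
  memL1 mu t g <-> (\int[leb]_(s in `]0%R, +oo[) (mu s * g (t - s)%R)%:E < +oo)%E.
Proof.
move=> mg g0; rewrite ge0_half_line_integral//.
have mF : measurable_fun setT (fun r => kern mu (t - r) * g r).
  by apply: measurable_funM => //; exact: measurable_kern_reflect.
have E : (\int[leb]_r (kern mu (t - r) * g r)%:E = \int[leb]_r `|(kern mu (t - r) * g r)%:E|)%E.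
  by apply: eq_integral => r _; rewrite gee0_abs// lee_fin mulr_ge0// kern_ge0.
split; first by move=> [_ /integrableP[_]]; rewrite E.
move=> fin; split => //; apply/integrableP; split; first exact/measurable_EFinP.
by rewrite -E.
Qed.

Lemma mr_shift_cont_sym phi T e : memory_regular mu phi -> 0 < e ->
  exists2 d : R, 0 < d & forall s t, 0 <= s <= T -> 0 <= t <= T -> `|t - s| < d ->
    memint mu s (fun r => (phi (r + (t - s)) - phi r) ^+ 2) <= e.
Proof.
move=> reg e0; have [d d0 H] := mr_shift_cont mu_adm reg T e0.
have mphi := mr_measurable reg.
exists d => // s t /andP[s0 sT] /andP[t0 tT]; have [st|ts|->] := ltgtP s t.
- by rewrite gtr0_norm ?subr_gt0// => tsd; apply: H => //; rewrite ?subr_gt0//; lra.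
- rewrite distrC gtr0_norm ?subr_gt0// => tsd.
  rewrite (_ : memint mu s _ = memint mu (s + (t - s)) (fun r => (phi r - phi (r + (s - t)))
    ^+ 2)).
    rewrite (_ : s + (t - s) = t); last by ring.
    under eq_memint do rewrite -sqrrN opprB.
    by apply: H => //; rewrite ?subr_gt0//; lra.
  rewrite -(memint_shift mu_adm)//; last first.
    by apply: measurable_funX; apply: measurable_funB => //; exact: (measurable_mr_shift reg).
  by apply: eq_memint => r _; congr ((_ - phi _) ^+ 2); ring.
- move=> _; rewrite (_ : memint _ _ _ = memint mu t (cst 0)).
    by rewrite memint_cst// mul0r ltW.
  by apply: eq_memint => r _; rewrite !subrr addr0 subrr expr0n.
Qed.

Lemma loc_unif_cont_shift a f : 0 <= a -> loc_unif_cont f -> loc_unif_cont (fun t => f (a + t)).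
Proof.
move=> a0 fc T e e0; have [d d0 H] := fc (a + T) e e0; exists d => // s t sT tT st.
have E : a + t - (a + s) = t - s by ring.
by apply: H; rewrite ?E//; lra.
Qed.

Let continuous_max_eq f (D : set R) : loc_unif_cont f -> D `<=` `[0, +oo[ ->
  continuous (fun t => f (Num.max t 0)) /\ {in D, f =1 (fun t => f (Num.max t 0))}.
Proof.
move=> fc D0; split; first exact: loc_unif_cont_max.
by move=> t /set_mem /D0; rewrite /= in_itv /= andbT => t0; rewrite max_l.
Qed.

Lemma loc_unif_cont_compact_integrable f (D : set R) : loc_unif_cont f -> compact D ->
  D `<=` `[0, +oo[ -> leb.-integrable D (EFin \o f).
Proof.
move=> fc cD D0; have [gc E] := continuous_max_eq fc D0.
have mD : measurable D by exact: compact_measurable.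
apply: eq_integrable (continuous_compact_integrable cD (continuous_subspaceT gc)) => // t Dt.
by rewrite /= (E t Dt).
Qed.

Lemma loc_unif_cont_locally_integrable f : loc_unif_cont f -> locally_integrable `]0, +oo[ f.
Proof.
move=> fc; have sub : (`]0, +oo[ : set R) `<=` `[0, +oo[.
  by move=> t /=; rewrite !in_itv /= !andbT; exact: ltW.
split.
- have [gc E] := continuous_max_eq fc sub.
  apply: (eq_measurable_fun (fun t => f (Num.max t 0))); first by move=> t Dt; rewrite -E.
  by apply: measurable_funTS; exact: continuous_measurable_fun.
- exact: interval_open.
- move=> K KD cK; have := loc_unif_cont_compact_integrable fc cK (subset_trans KD sub).
  by move=> /integrableP[_].
Qed.

Lemma Rintegral_itv_translate a s t f : loc_unif_cont f -> 0 <= a + s ->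
  \int[leb]_(r in `[a + s, a + t]) f r = \int[leb]_(r in `[s, t]) f (a + r).
Proof.
move=> fc as0.
have E : f \_ `[a + s, a + t] = (fun r => f (Num.max r 0)) \_ `[a + s, a + t].
  apply/funext => r; rewrite !patchE; case: ifP => // /set_mem /=;
    rewrite in_itv /= => /andP[h _].
  by rewrite max_l// (le_trans as0).
rewrite Rintegral_mkcond [RHS]Rintegral_mkcond -(integral_translate a); last first.
  rewrite E; apply: (measurable_restrictT _ _).1 => //; apply: measurable_funTS.
  exact: continuous_measurable_fun (loc_unif_cont_max fc).
apply: eq_Rintegral => r _; rewrite !patchE (addrC r a).
rewrite (_ : (a + r \in `[a + s, a + t]%classic) = (r \in `[s, t]%classic))//.
by apply/idP/idP => /set_mem /=; rewrite in_itv /= => h; apply/mem_set; rewrite /= in_itv /=;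
  lra.
Qed.

End HalfLine.

Section EtaTransport.
Context {R : realType} {H : completeNormedModType R}.

(** In the direction [(1, 1)] the difference [t - s] is constant, so only the present value varies.
    For a mode this yields the memory equation. *)
Lemma eta_transportE (w : R -> H) (t s : R) : eta_transport w t s = derive1 w t.
Proof.
rewrite /eta_transport derive1E /derive.
apply: (f_equal (fun f => lim (f @ 0^'))); apply/funext => h; congr (_ *: _).
rewrite /Defs.eta /=.
have -> : h *: (1 : R^o) + t - (h *: (1 : R^o) + s) = t - s by rewrite opprD addrACA subrr
  add0r.
by rewrite opprB addrA subrK.
Qed.

End EtaTransport.

(** * A scalar mode as a solution of the undelayed problem *)

Section ModeSolution.
Import HBSimple.
Context {R : realType} {H : completeNormedModType R} (ip : {dot H for idfun}).
Hypothesis ip_norm : inner_product_norm ip.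
Local Notation leb := (@lebesgue_measure R).
Variables (A S : operator H) (mu : R -> R) (e : H) (rt lam a tau : R) (psi q : R -> R).
Hypothesis mu_adm : admissible_kernel mu.
Hypotheses (S_sa : self_adjoint ip S) (Se_dom : dom S e) (Se : S e = rt *: e).
Hypotheses (e1 : `|e| = 1) (rt0 : 0 < rt) (lamE : lam = rt ^+ 2) (a0 : 0 <= a).
Hypothesis reg : mode_regular mu psi q.
Hypothesis eqn : forall s t, a < s -> s <= t ->
  q t - q s = \int[leb]_(r in `[s, t]) (- lam * (psi r - memint mu r psi)).
Implicit Types (s t r h c : R).

(** The origin of time is moved to [a], because the decay hypothesis compares the energy with its
    value at time [0]. *)
Let w t : H := psi (a + t) *: e.
Let Slin := self_adjoint_linear S_sa.
Let force t := - lam * (psi t - memint mu t psi).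

Let force_cont : loc_unif_cont force.
Proof. by apply: loc_unif_contZ; exact: (mr_deviation_cont mu_adm (mr_memory reg)). Qed.

Let lam0 : 0 < lam.
Proof. by rewrite lamE exprn_gt0. Qed.

Let SZ c : S (c *: e) = (rt * c) *: e.
Proof. by have [_ ->] := linear_operatorZ c Slin Se_dom; rewrite Se scalerA mulrC. Qed.

Let normSZ c : `|S (c *: e)| ^+ 2 = lam * c ^+ 2.
Proof. by rewrite SZ normrZ e1 mulr1 real_normK ?num_real// exprMn lamE. Qed.

Let ipSS c v : dom S v -> ip (S (c *: e)) (S v) = lam * c * ip e v.
Proof.
move=> dv; rewrite SZ ipZl -(self_adjoint_sym S_sa Se_dom dv) Se ipZl lamE expr2.
by ring.
Qed.

Let mode_derive t : 0 <= t -> is_derive t (1 : R) (w : R^o -> H) (q (a + t) *: e).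
Proof.
move=> t0; have [dpsi psi_q] := mr_derive reg (addr_ge0 a0 t0).
suff cw : (fun h => h^-1 *: ((w \o shift t) (h *: (1 : R)) - w t)) @ 0^' --> q (a + t) *: e.
  by apply: DeriveDef; [apply/cvg_ex; exists (q (a + t) *: e)|exact: cvg_lim cw].
have cpsi : (fun h => h^-1 *: ((psi \o shift (a + t)) (h *: (1 : R)) - psi (a + t))) @ 0^' -->
  q (a + t).
  by rewrite -psi_q; exact: dpsi.
rewrite (_ : (fun h => _) = (fun h => (h^-1 *: ((psi \o shift (a + t)) (h *: (1 : R)) - psi (a
  + t))) *: e)).
  by apply: cvgZr_tmp.
by apply/funext => h; rewrite /w /= addrCA -scalerBl scalerA.
Qed.

Let etaE t s : Defs.eta w t s = (psi (a + t) - psi (a + t - s)) *: e.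
Proof. by rewrite /Defs.eta /w scalerBl addrA. Qed.

Let derive1w t : 0 <= t -> derive1 w t = q (a + t) *: e.
Proof. by move=> t0; rewrite derive1E; have := mode_derive t0; case. Qed.

Let memory_sqr t : 0 <= t ->
  \int[leb]_(s in `]0, +oo[) (mu s * `|S (Defs.eta w t s)| ^+ 2) = lam * mode_memory mu psi (a
    + t).
Proof.
move=> t0; have at0 : 0 <= a + t by rewrite addr_ge0.
have i2 := mode_memory_memL1 mu_adm reg at0.
rewrite -(memintZ lam i2) -half_line_memint//; last by have [] := memL1Z lam i2.
by apply: eq_Rintegral => s _; rewrite etaE normSZ.
Qed.

Lemma mode_solution_energy t : 0 <= t -> energy S mu w t = mode_energy mu lam psi q (a + t).
Proof.
move=> t0; rewrite /energy memory_sqr// derive1w// normSZ normrZ e1 mulr1.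
by rewrite real_normK ?num_real.
Qed.

Lemma strongly_measurable_scale (D : set R) (k : R -> R) : measurable_fun setT k ->
  strongly_measurable D (fun s => k s *: e).
Proof.
move=> mk; have mk' : measurable_fun setT (EFin \o k) by exact/measurable_EFinP.
have [g gk] := approximation_sfun measurableT mk'.
exists (fun n s => g n s *: e); split; last first.
  apply: lebesgue_aeW => s _.
  by apply: cvgZr_tmp; have /fine_cvgP[] := gk s I.
move=> n; split.
  apply: (@sub_finite_set _ _ ((fun c => c *: e) @` range (g n))).
    by move=> _ [s _ <-]; exists (g n s) => //; exists s.
  by apply: finite_image; exact: fimfunP.
move=> y; have [[c <-]|nc] := pselect (exists c, c *: e = y).
  rewrite (_ : _ @^-1` _ = g n @^-1` [set c]).
    by rewrite -[X in measurable X]setTI; exact: measurable_funP.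
  apply/seteqP; split => s /=; last by move->.
  move=> /(congr1 (fun x => ip x e)); rewrite !ipZl ip_norm e1 expr1n !mulr1//.
by rewrite (_ : _ @^-1` _ = set0)//; apply/seteqP; split => s //= h; apply: nc; exists (g n s).
Qed.

Lemma mode_is_solution : is_solution ip A S mu (fun=> 0) tau w w.
Proof.
have mpsi : measurable_fun setT psi := mr_measurable reg.
have mpsi_r t : measurable_fun setT (fun s => psi (t - s)).
  by apply: (measurableT_comp mpsi); apply: measurable_funB.
split => //.
- by move=> t t0; have := mode_derive t0; case.
- move=> t t0; have at0 : 0 <= a + t by rewrite addr_ge0.
  rewrite /state; split => /=; first by have [] := linear_operatorZ (psi (a + t)) Slin Se_dom.
  split => /=.
  + apply: lebesgue_aeW => s _.
    by rewrite etaE; have [] := linear_operatorZ (psi (a + t) - psi (a + t - s)) Slin Se_dom.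
  + rewrite (_ : S \o _ = fun s => (rt * (psi (a + t) - psi (a + t - s))) *: e).
      apply: strongly_measurable_scale; apply: measurable_funM => //.
      by apply: measurable_funB => //; exact: mpsi_r.
    by apply/funext => s; rewrite /= etaE SZ.
  + have i2 := memL1Z lam (mode_memory_memL1 mu_adm reg at0).
    have := (memL1_half_line mu_adm (a + t) i2.1 _).1 _.
    move=> /(_ _ i2) fin; have {}fin := fin (fun r => mulr_ge0 (ltW lam0) (sqr_ge0 _)).
    apply: le_lt_trans fin; rewrite le_eqVlt; apply/orP; left; apply/eqP.
    by apply: eq_integral => s _; rewrite etaE normSZ.
- move=> t0 t00; apply/cvgrPdist_le => /= eps eps0.
  (* The position contributes at most [lam * d1] to the squared norm, the velocity [d1] and the
     memory [4 * lam * d1]. *)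
  have k0 : 0 < 5 * lam + 1 by rewrite ltr_wpDl// mulr_ge0 ?(ltW lam0).
  pose d1 := Num.min 1 (eps / (5 * lam + 1)).
  have d10 : 0 < d1 by rewrite lt_min ltr01 divr_gt0.
  pose T := a + t0 + 1.
  have [x1 x10 H1] := mr_loc_unif_cont reg T d10.
  have [x2 x20 H2] := mr_cont reg T d10.
  have [x3 x30 H3] := mr_shift_cont_sym mu_adm T reg d10.
  have x0 : 0 < Num.min (Num.min x1 x2) (Num.min x3 1) by rewrite !lt_min x10 x20 x30 ltr01.
  near=> t.
  have t_ge0 : 0 <= t.
    by near: t; rewrite near_withinE; apply: nearW => x /=; rewrite in_itv /= andbT.
  have : `|t - t0| < Num.min (Num.min x1 x2) (Num.min x3 1).
    near: t; rewrite near_withinE; apply: filterS (nbhsx_ballx t0 _ x0) => x.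
    by rewrite -ball_normE /= distrC.
  rewrite !lt_min => /andP[/andP[y1 y2] /andP[y3 y4]].
  have at00 : 0 <= a + t0 by rewrite addr_ge0.
  have T0 : 0 <= a + t0 <= T by rewrite at00 /T lerDl ler01.
  have Tt : 0 <= a + t <= T.
    rewrite addr_ge0//= /T -addrA lerD2l -lerBlDl (le_trans (ler_norm _))// ltW//.
  have dE : a + t - (a + t0) = t - t0 by ring.
  have := H3 _ _ T0 Tt; have := H2 _ _ T0 Tt; have := H1 _ _ T0 Tt.
  rewrite dE => /(_ y1) h1 /(_ y2) h2 /(_ y3) h3.
  set c := psi (a + t) - psi (a + t0) in h1; set h := t - t0 in h3 *.
  pose Q := fun r => (psi (r + h) - psi r) ^+ 2.
  have iQ : memL1 mu (a + t0) Q.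
    apply: (mr_shift_sqr mu_adm reg at00).
    by rewrite (_ : a + t0 + h = a + t) ?addr_ge0// /h; ring.
  have mpsih : measurable_fun setT (fun r => psi (r + h) - psi r).
    by apply: measurable_funB => //; exact: (measurable_mr_shift reg).
  (* In the variable [r = a + t0 - s] the difference of the memory variables at [t] and [t0] is [c]
     minus the increment of [psi] over [h]. *)
  pose G := fun r => (c - (psi (r + h) - psi r)) ^+ 2.
  have iG : memL1 mu (a + t0) G.
    by apply: memL1_sqrB => //; exact: memL1_cst.
  have mem : memory_sqnorm mu S (fun s => Defs.eta w t s - Defs.eta w t0 s) = lam * memint mu
    (a + t0) G.
    rewrite -memintZ// -half_line_memint//; last by have [] := memL1Z lam iG.
    apply: eq_Rintegral => s _; rewrite !etaE -scalerBl normSZ /G /c.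
    congr (_ * (_ * _ ^+ 2)); rewrite (_ : a + t0 - s + h = a + t - s); last by rewrite /h;
      ring.
    by ring.
  rewrite /phase_sqnorm /= !derive1w// -!scalerBl mem normSZ normrZ e1 mulr1 real_normK
    ?num_real// -/c.
  set dq := q (a + t) - q (a + t0) in h2 *.
  have sq x : `|x| < d1 -> x ^+ 2 <= d1.
    move=> xd; rewrite -(real_normK (num_real x)) expr2.
    have d1_1 : d1 <= 1 by rewrite ge_min lexx.
    by have := normr_ge0 x; nra.
  have m1 := kernel_mass_lt1 mu_adm; have m0 := kernel_mass_ge0 mu_adm.
  have Gle : memint mu (a + t0) G <= 4 * d1.
    apply: (@le_trans _ _ (memint mu (a + t0) (fun r => 2 * (c ^+ 2 + Q r)))).
      apply: memint_le => //.
        by apply: memL1Z; apply: memL1D => //; exact: memL1_cst.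
      by move=> r _; rewrite /G /Q; have := sqr_ge0 (c + (psi (r + h) - psi r)); lra.
    have i1 := memL1_cst mu_adm (a + t0) (c ^+ 2).
    rewrite memintZ; last exact: memL1D.
    rewrite memintD// memint_cst//.
    have : c ^+ 2 * kernel_mass mu <= d1.
      by apply: le_trans (sq _ h1); rewrite ler_piMr ?sqr_ge0// ltW.
    by move: h3; rewrite -/Q; lra.
  have G0 : 0 <= memint mu (a + t0) G by apply: memint_ge0 => // r _; exact: sqr_ge0.
  have cc0 := sqr_ge0 c; have dd0 := sqr_ge0 dq.
  have lc0 : 0 <= lam * c ^+ 2 by rewrite mulr_ge0// ltW.
  have lc1 : lam * c ^+ 2 <= lam * d1 by rewrite ler_wpM2l ?(ltW lam0)// sq.
  have lG0 := mulr_ge0 (ltW lam0) G0.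
  have lG1 := ler_wpM2l (ltW lam0) Gle.
  have P0 : 0 <= (1 - kernel_mass mu) * (lam * c ^+ 2) by rewrite mulr_ge0// subr_ge0 ltW.
  have P1 : (1 - kernel_mass mu) * (lam * c ^+ 2) <= lam * d1.
    by apply: le_trans lc1; rewrite ler_piMl// gerBl.
  have last : (5 * lam + 1) * d1 <= eps.
    by rewrite -ler_pdivlMl// /d1 ge_min (mulrC _ eps) lexx orbT.
  rewrite sub0r normrN ger0_norm; last by rewrite addr_ge0// addr_ge0.
  by have := sq _ h2; lra.
- exists (fun t v => force (a + t) * ip e v).
  + split.
      move=> t t0; split.
        by move=> k x y _ _; rewrite ipDr ipZr mulrDr mulrCA.
      exists (`|force (a + t)| * rt^-1) => v dv; rewrite normrM -mulrA ler_wpM2l//.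
      rewrite ler_pdivlMl//.
      have -> : rt * `|ip e v| = `|ip e (S v)|.
        by rewrite -(self_adjoint_sym S_sa Se_dom dv) Se ipZl normrM (gtr0_norm rt0).
      by rewrite (le_trans (cauchy_schwarz ip_norm _ _))// e1 mul1r.
    move=> v dv; have kc := loc_unif_contZ (ip e v) (loc_unif_cont_shift a0 force_cont).
    split.
      rewrite (_ : (fun _ => _) = fun t => ip e v * force (a + t)).
        exact: loc_unif_cont_locally_integrable.
      by apply/funext => t; rewrite mulrC.
    move=> s t s0 st; rewrite !derive1w ?(ltW s0) ?(le_trans (ltW s0))// !ipZl -mulrBl.
    rewrite eqn ?ltrDl ?lerD2l// Rintegral_itv_translate//; last by rewrite addr_ge0// ltW.
    rewrite RintegralZr//; apply: loc_unif_cont_compact_integrable; last 2 first.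
    * exact: segment_compact.
    * by move=> r /=; rewrite !in_itv /= andbT => /andP[sr _]; rewrite (le_trans (ltW s0)).
    * exact: loc_unif_cont_shift a0 force_cont.
  + apply: lebesgue_aeW => t t0; split; last first.
      move=> z _; apply: eq_Rintegral => s _; congr (_ * ip _ _).
      exact: eta_transportE.
    move=> v dv; have at0 : 0 <= a + t by rewrite addr_ge0// ltW.
    rewrite oppr0 scale0r ip0l addr0 ipSS//.
    have iD : memL1 mu (a + t) (fun r => psi (a + t) - psi r).
      by apply: memL1B; [exact: memL1_cst|exact: (mr_memL1 mu_adm reg)].
    rewrite (_ : \int[leb]_(s in `]0, +oo[) _ = memint mu (a + t) (fun r => lam * ip e v *
      (psi (a + t) - psi r))).
      rewrite memintZ// memintB//; [|exact: memL1_cst|exact: (mr_memL1 mu_adm reg)].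
      by rewrite (memint_cst mu_adm (a + t) (psi (a + t))) /force; ring.
    rewrite -half_line_memint//; last by have [] := memL1Z (lam * ip e v) iD.
    by apply: eq_Rintegral => s _; rewrite etaE ipSS// mulrAC.
Unshelve. all: by end_near. Qed.

End ModeSolution.

(** * The modes of a solution *)

Section SolutionModes.
Context {R : realType} {H : completeNormedModType R} (ip : {dot H for idfun}).
Hypothesis ip_norm : inner_product_norm ip.
Local Notation leb := (@lebesgue_measure R).
Variables (A S : operator H) (mu : R -> R).
Hypothesis mu_adm : admissible_kernel mu.
Hypothesis S_sa : self_adjoint ip S.
Implicit Types (s t r h : R) (x y : H).

Let mu_ge0 s : 0 < s -> 0 <= mu s.
Proof. by move=> s0; rewrite -(kern_gt0 mu s0) kern_ge0. Qed.

Lemma measurable_kernel_support : measurable (kernel_support mu).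
Proof.
rewrite (_ : kernel_support mu = kern mu @^-1` `]0, +oo[).
  rewrite -[X in measurable X]setTI; apply: (measurable_kern mu_adm) => //.
apply/seteqP; split => s; rewrite /kernel_support /= in_itv /= andbT.
  by move=> [s0 ms]; rewrite kern_gt0.
by rewrite /kern; case: (ltP 0 s) => [s0 ms|_]; [|rewrite ltxx].
Qed.

Lemma ip_continuous e : continuous (fun x => ip x e).
Proof.
move=> x; apply/cvgrPdist_lt => eps eps0.
have e1 : 0 < `|e| + 1 by rewrite ltr_wpDl.
near=> y; rewrite -ipBl (le_lt_trans (cauchy_schwarz ip_norm _ _))//.
apply: (@le_lt_trans _ _ (`|x - y| * (`|e| + 1))); first by rewrite ler_wpM2l// lerDl.
rewrite -ltr_pdivlMr//; near: y; apply: cvgr_dist_lt; rewrite ?divr_gt0//.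
Unshelve. all: by end_near. Qed.

Lemma simple_function_measurable (g : R -> H) (F : H -> R) : simple_function g ->
  measurable_fun setT (F \o g).
Proof.
move=> [fin mg] _ Y mY; rewrite setTI.
rewrite (_ : _ @^-1` Y = \bigcup_(y in range g `&` F @^-1` Y) g @^-1` [set y]).
  apply: fin_bigcup_measurable; first exact: finite_setIl.
  by move=> y _; exact: mg.
apply/seteqP; split => [s Ys|s [y [_ Fy] /= gy]]; last by rewrite /= gy.
by exists (g s) => //; split => //; exists s.
Qed.

(** Simple functions approximate [f] only almost everywhere, so [F \o f] itself need not be
    measurable. Setting it to [0] on the exceptional set gives a pointwise limit of measurable
    functions. *)
Lemma strongly_measurable_version (D : set R) (f : R -> H) (F : H -> R) :
  measurable D -> strongly_measurable D f -> continuous F ->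
  exists2 k : R -> R, measurable_fun setT k & {ae leb, forall s, D s -> F (f s) = k s}.
Proof.
move=> mD [g [gs [N [mN N0 gN]]]] Fc.
have mDN : measurable (D `\` N) by exact: measurableD.
exists ((F \o f) \_ (D `\` N)).
  apply: (measurable_restrictT _ mDN).1.
  apply: (measurable_fun_cvg (h := fun n => F \o g n)).
    by move=> n; apply: measurable_funTS; exact: simple_function_measurable.
  move=> s [Ds nNs]; apply: continuous_cvg; first exact: Fc.
  by apply: contrapT => h; apply: nNs; apply: gN => /(_ Ds).
exists N; split => // s /= /not_implyP[Ds]; apply: contra_notP => nNs.
by rewrite patchE mem_set.
Qed.

Let phase_terms (v : H * H * (R -> H)) (c : R) : phase_sqnorm mu S v <= c ->
  `|v.1.2| ^+ 2 <= c /\ memory_sqnorm mu S v.2 <= c.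
Proof.
have m1 := kernel_mass_lt1 mu_adm.
rewrite /phase_sqnorm; have h1 : 0 <= (1 - kernel_mass mu) * `|S v.1.1| ^+ 2.
  by rewrite mulr_ge0 ?sqr_ge0// subr_ge0 ltW.
have h2 := sqr_ge0 `|v.1.2|.
have h3 : 0 <= memory_sqnorm mu S v.2.
  apply: Rintegral_ge0 => s; rewrite /= in_itv /= andbT => s0.
  by rewrite mulr_ge0 ?sqr_ge0// mu_ge0.
by move=> h; split; lra.
Qed.

Lemma memory_space_version (w : R -> H) : memory_space mu S w ->
  exists2 k : R -> R, measurable_fun setT k /\ (forall s, 0 <= k s) &
    (\int[leb]_(s in `]0%R, +oo[) (mu s * k s ^+ 2)%:E < +oo)%E /\
    {ae leb, forall s, kernel_support mu s -> dom S (w s) /\ `|S (w s)| = k s}.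
Proof.
move=> [dw sw fin].
have [k mk kE] := strongly_measurable_version measurable_kernel_support sw (@norm_continuous _
  _).
exists (fun s => `|k s|); first by split => //; exact: measurableT_comp.
split; last first.
  have := lebesgue_aeI dw kE; apply: lebesgue_aeS => s [h1 h2] ss.
  by split; [exact: h1|rewrite -(h2 ss) ger0_norm].
apply: le_lt_trans fin; apply: ge0_integral_ae_le.
- by move=> s; rewrite /= in_itv /= andbT => s0; rewrite lee_fin mulr_ge0 ?sqr_ge0// mu_ge0.
- by move=> s; rewrite /= in_itv /= andbT => s0; rewrite lee_fin mulr_ge0 ?sqr_ge0// mu_ge0.
- apply: lebesgue_aeS kE => s h; rewrite /= in_itv /= andbT => s0.
  have [ms|ms] := ltP 0 (mu s); first by rewrite -h// ger0_norm.
  have -> : mu s = 0 by apply/eqP; rewrite eq_le ms mu_ge0.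
  by rewrite !mul0r.
Qed.

(** [memory_sqnorm] is a real integral, which would be [0] if the extended one were infinite.
    Finiteness is what makes smallness of the norm of a difference of states meaningful. *)
Lemma memory_space_diff_fin (w w' : R -> H) : memory_space mu S w -> memory_space mu S w' ->
  (\int[leb]_(s in `]0%R, +oo[) (mu s * `|S (w s - w' s)| ^+ 2)%:E < +oo)%E.
Proof.
move=> /memory_space_version[k [mk k0] [kfin kE]] /memory_space_version[k' [mk' k'0] [k'fin
  k'E]].
have [_ _ _ [int_mu _] _] := mu_adm.
have /integrableP[/measurable_EFinP mmu _] := int_mu.
have pos (c : R -> R) s : `]0, +oo[%classic s -> 0 <= mu s * c s ^+ 2.
  by rewrite /= in_itv /= andbT => s0; rewrite mulr_ge0 ?sqr_ge0// mu_ge0.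
have I (c : R -> R) : measurable_fun setT c ->
    (\int[leb]_(s in `]0%R, +oo[) (mu s * c s ^+ 2)%:E < +oo)%E ->
    leb.-integrable `]0, +oo[ (EFin \o (fun s => mu s * c s ^+ 2)).
  move=> mc cfin; apply/integrableP; split.
    apply/measurable_EFinP; apply: measurable_funM => //.
    by apply: measurable_funTS; exact: measurable_funX.
  apply: le_lt_trans cfin; rewrite le_eqVlt; apply/orP; left; apply/eqP.
  by apply: eq_integral => s; rewrite inE => /(pos c) h; rewrite /= ger0_norm.
have ID : leb.-integrable `]0, +oo[
    ((EFin \o (fun s => mu s * k s ^+ 2)%R) \+ (EFin \o (fun s => mu s * k' s ^+ 2)%R))%E.
  by apply: integrableD => //; exact: I.
have /integrableP[_] : leb.-integrable `]0, +oo[ (fun s => 2%:E *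
    (((EFin \o (fun s => mu s * k s ^+ 2)%R) \+ (EFin \o (fun s => mu s * k' s ^+ 2)%R)) s))%E.
  by apply: integrableZl.
apply: le_lt_trans; apply: ge0_integral_ae_le.
- by move=> s s0; rewrite lee_fin; exact: (pos (fun s => `|S (w s - w' s)|)).
- by [].
have := lebesgue_aeI kE k'E; apply: lebesgue_aeS => s [h1 h2]; rewrite /= in_itv /= andbT => s0.
rewrite lee_fin (le_trans _ (ler_norm _))// -mulrDr (mulrCA 2).
have [ms|ms] := ltP 0 (mu s); last first.
  have -> : mu s = 0 by apply/eqP; rewrite eq_le ms mu_ge0.
  by rewrite !mul0r.
rewrite ler_wpM2l ?(ltW ms)//.
have [[d1 <-] [d2 <-]] := (h1 (conj s0 ms), h2 (conj s0 ms)).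
have [_ ->] := linear_operatorB (self_adjoint_linear S_sa) d1 d2.
have := ler_normB (S (w s)) (S (w' s)); have := normr_ge0 (S (w s) - S (w' s)).
by have := sqr_ge0 (`|S (w s)| - `|S (w' s)|); nra.
Qed.

Section OneMode.
Variables (b : R -> R) (tau : R) (u0 u : R -> H) (e : H) (rt : R).
Hypothesis sol : is_solution ip A S mu b tau u0 u.
Hypotheses (Se_dom : dom S e) (Se : S e = rt *: e) (rt0 : 0 < rt) (e1 : `|e| <= 1).

Let phi t := ip (u t) e.
Let p t := ip (derive1 u t) e.

Let ipSe x : dom S x -> ip (S x) e = rt * ip x e.
Proof. by move=> dx; rewrite (self_adjoint_sym S_sa dx Se_dom) Se ipZr. Qed.

Let ip_le x : `|ip x e| <= `|x|.
Proof. by rewrite (le_trans (cauchy_schwarz ip_norm _ _))// ler_piMr. Qed.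

Let phi_derive t : 0 <= t -> is_derive t (1 : R) phi (p t).
Proof.
move=> t0; have du := sol_derivable sol t0.
suff cphi : (fun h => h^-1 *: ((phi \o shift t) (h *: (1 : R)) - phi t)) @ 0^' --> p t.
  by apply: DeriveDef; [apply/cvg_ex; exists (p t)|exact: cvg_lim cphi].
rewrite (_ : (fun h => _) =
    (fun h => ip (h^-1 *: ((u \o shift t) (h *: (1 : R^o)) - u t)) e)); last first.
  by apply/funext => h; rewrite /phi /= ipZl ipBl.
apply/cvgrPdist_lt => eps eps0; have := du; move=> /cvgrPdist_lt /(_ eps eps0).
by apply: filterS => h; rewrite /p derive1E -ipBl; apply: le_lt_trans; exact: ip_le.
Qed.

Let state_close t0 (eps : R) : 0 <= t0 -> 0 < eps -> exists2 d : R, 0 < d &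
  forall t, 0 <= t -> `|t - t0| < d -> phase_sqnorm mu S (state_diff u t t0) <= eps.
Proof.
move=> t00 eps0; have := sol_continuous sol t00.
move=> /cvgrPdist_lt /(_ eps eps0) [d /= d0 H1]; exists d => // t t_ge0 td.
rewrite ltW// (le_lt_trans (ler_norm _))// -normrN -sub0r; apply: H1.
  by rewrite /= distrC.
by rewrite in_itv /= andbT.
Qed.

Let p_cont : loc_unif_cont p.
Proof.
apply: within_loc_unif_cont; apply/subspace_continuousP => t0;
  rewrite /= in_itv /= andbT => t00.
apply/cvgrPdist_lt => eps eps0.
have [d d0 H1] := state_close t00 (exprn_gt0 2 (divr_gt0 eps0 (ltr0Sn _ 1))).
rewrite near_withinE; apply: filterS (nbhsx_ballx t0 _ d0) => t.
rewrite -ball_normE /= distrC in_itv /= andbT => td t_ge0.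
have [+ _] := phase_terms (H1 t t_ge0 td).
rewrite /= ler_pXn2r ?nnegrE// ?divr_ge0 ?(ltW eps0)// => h.
rewrite distrC /p -ipBl (le_lt_trans (ip_le _))// (le_lt_trans h)//.
by rewrite ltr_pdivrMr// mulr2n mulrDr mulr1 ltrDl.
Qed.

Let phi_cont : loc_unif_cont phi.
Proof. exact: derive_loc_unif_cont phi_derive p_cont. Qed.

(* The history is only measurable up to a null set; on the exceptional set it
   is replaced by an affine function, which keeps the derivative at [0]. *)
Let mode_version : exists psi : R -> R,
  [/\ measurable_fun setT psi, forall t, 0 <= t -> psi t = phi t,
      forall t, 0 <= t -> is_derive t (1 : R) psi (p t) &
      forall t, 0 <= t -> {ae leb, forall s, kernel_support mu s -> psi (t - s) = phi (t - s)}].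
Proof.
have [d0 s0 _] := (sol_phase sol (lexx 0)).2; rewrite /state /= in d0 s0.
have [k mk kE] := strongly_measurable_version measurable_kernel_support s0 (@ip_continuous e).
have [N [mN N0 subN]] := lebesgue_aeI d0 kE.
pose D := kernel_support mu `\` N.
have mD : measurable D by apply: measurableD => //; exact: measurable_kernel_support.
(* Tested with [e], the vector [S (eta u 0 s)] gives [rt * (phi 0 - phi (- s))], so the measurable
   version [k] determines the history of the mode off the null set. *)
have goodE s : D s -> phi 0 - rt^-1 * k s = phi (- s).
  move=> [ss nN]; have [h1 h2] : (kernel_support mu s -> dom S (Defs.eta u 0 s)) /\
      (kernel_support mu s -> ip ((S \o Defs.eta u 0) s) e = k s).
    by apply: contrapT => h; apply: nN; exact: subN.
  have E := ipSe (h1 ss); have := h2 ss; rewrite /= E => <-.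
  rewrite mulKf ?gt_eqF// /Defs.eta ipBl sub0r.
  by rewrite /phi opprB addrC subrK.
pose G := (fun s => p 0 * s - rt^-1 * k s) \_ D.
pose psi t := if 0 <= t then phi (Num.max t 0) else phi 0 + p 0 * t + G (- t).
have psiE t : 0 <= t -> psi t = phi t by move=> t0; rewrite /psi t0 max_l.
have psiD t : t < 0 -> D (- t) -> psi t = phi t.
  move=> t0 Dt; rewrite /psi leNgt t0 /= /G patchE mem_set// -[RHS](congr1 phi (opprK t))
    -goodE//.
  by ring.
have psinD t : t < 0 -> ~ D (- t) -> psi t = phi 0 + p 0 * t.
  by move=> t0 Dt; rewrite /psi leNgt t0 /= /G patchE memNset// addr0.
exists psi; split => //.
- apply: measurable_fun_ifT; first exact: measurable_fun_ler.
    apply: continuous_measurable_fun; exact: loc_unif_cont_max.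
  apply: measurable_funD.
    by apply: measurable_funD => //; apply: measurable_funM.
  have mG : measurable_fun setT G.
    apply: (measurable_restrictT _ mD).1; apply: measurable_funTS.
    by apply: measurable_funB; apply: measurable_funM.
  by apply: (measurableT_comp mG).
- move=> t t0; have [dphi phi_p] := phi_derive t0.
  have cphi : (fun h => h^-1 *: ((phi \o shift t) (h *: (1 : R)) - phi t)) @ 0^' --> p t.
    by rewrite -phi_p; exact: dphi.
  suff cpsi : (fun h => h^-1 *: ((psi \o shift t) (h *: (1 : R)) - psi t)) @ 0^' --> p t.
    by apply: DeriveDef; [apply/cvg_ex; exists (p t)|exact: cvg_lim cpsi].
  apply/cvgrPdist_lt => eps eps0.
  have := cphi; move=> /cvgrPdist_lt /(_ eps eps0) cphi'.
  (* For [t > 0] this radius keeps [h + t] nonnegative. Negative times are seen only from [t = 0],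
     where the affine replacement has difference quotient exactly [p 0]. *)
  pose q := if t == 0 then 1 else t.
  have q0 : 0 < q by rewrite /q; case: eqVneq => // tn0; rewrite lt_def tn0.
  near=> h; have hq : `|h| < q.
    near: h; rewrite near_withinE; apply: filterS (nbhsx_ballx (0 : R) _ q0) => x.
    by rewrite -ball_normE /= sub0r normrN.
  have h0 : h != 0 by near: h; exact: nbhs_dnbhs_neq.
  have cp : `|p t - h^-1 *: ((phi \o shift t) (h *: (1 : R)) - phi t)| < eps by near: h;
    exact: cphi'.
  rewrite /= (psiE t t0); have hx : h *: (1 : R) = h by rewrite /GRing.scale /= mulr1.
  rewrite /= !hx in cp *.
  have [ht|ht] := leP 0 (h + t); first by rewrite psiE.
  have [Dt|nDt] := pselect (D (- (h + t))); first by rewrite psiD.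
  have tE : t = 0.
    apply/eqP; apply: contraTT ht => tn0; rewrite -leNgt.
    by move: hq; rewrite /q (negbTE tn0) ltr_norml => /andP[]; lra.
  rewrite psinD// tE !addr0 (_ : phi 0 + p 0 * h - phi 0 = h * p 0); last by ring.
  by rewrite /GRing.scale /= mulKf// subrr normr0.
- move=> t t0; have nN : leb.-negligible N by exists N; split.
  (* Two reflections translate the exceptional set by [t]. When [t - s] is negative, [s - t] lies in
     the kernel support as soon as [s] does, by monotonicity of the kernel. *)
  have := negligible_reflect t (negligible_reflect 0 nN).
  move=> [N' [mN' N'0 sub']]; exists N'; split => // s /= /not_implyP[ss ne].
  apply: sub' => /=; apply: contrapT => nNs; apply: ne.
  have [ts|ts] := leP 0 (t - s); first exact: psiE.
  apply: psiD => //; rewrite opprB; split; last by rewrite sub0r opprB in nNs.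
  have [s_gt0 ms] := ss; split; first by lra.
  by rewrite (lt_le_trans ms)// (admissible_kernel_nincr mu_adm)//; lra.
Unshelve. all: by end_near. Qed.

(** Testing with [e] is allowed since it lies in [dom S], and symmetry of [S] closes the equation on
    one scalar function. Translations act continuously on the history because the state is
    continuous at time [0]. The factor [mu s] in the last clause covers the points where [mu]
    vanishes and [eta] need not lie in [dom S]. *)
Lemma solution_mode : exists psi q : R -> R,
  [/\ mode_regular mu psi q, mode_equation mu (rt ^+ 2) b tau psi q,
      forall t, 0 <= t -> psi t = ip (u t) e,
      forall t, q t = ip (derive1 u t) e &
      forall t, 0 <= t -> {ae leb, forall s, 0 < s ->
        mu s * ip (S (Defs.eta u t s)) e ^+ 2 = mu s * (rt ^+ 2 * (psi t - psi (t - s)) ^+ 2)}].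
Proof.
have [psi [mpsi psiE dpsi psi_ae]] := mode_version.
have dom_ae t : 0 <= t -> {ae leb, forall s, kernel_support mu s -> dom S (Defs.eta u t s)}.
  by move=> t0; have [] := (sol_phase sol t0).2.
have etaE t s : 0 <= t -> (kernel_support mu s -> dom S (Defs.eta u t s)) ->
    (kernel_support mu s -> psi (t - s) = phi (t - s)) -> kernel_support mu s ->
    ip (S (Defs.eta u t s)) e = rt * (psi t - psi (t - s)).
  by move=> t0 h1 h2 ss; rewrite (ipSe (h1 ss)) /Defs.eta ipBl psiE// (h2 ss).
have supp s : 0 < s -> ~ kernel_support mu s -> mu s = 0.
  move=> s0 ns; apply/eqP; rewrite eq_le mu_ge0// andbT leNgt; apply/negP => ms.
  by apply: ns.
have sq_ae t : 0 <= t -> {ae leb, forall s, 0 < s ->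
    mu s * ip (S (Defs.eta u t s)) e ^+ 2 = mu s * (rt ^+ 2 * (psi t - psi (t - s)) ^+ 2)}.
  move=> t0; have := lebesgue_aeI (dom_ae t t0) (psi_ae t t0).
  apply: lebesgue_aeS => s [h1 h2] s0.
  have [ss|ns] := pselect (kernel_support mu s); last by rewrite supp// !mul0r.
  by rewrite etaE// exprMn.
have rt20 : 0 < rt ^+ 2 by rewrite exprn_gt0.
have pos (c s : R) : 0 < s -> 0 <= c -> (0 <= (mu s * c)%:E)%E.
  by move=> s0 cp; rewrite lee_fin mulr_ge0// mu_ge0.
have mpsi_dif t : measurable_fun setT (fun r => (psi t - psi r) ^+ 2).
  by apply: measurable_funX; apply: measurable_funB.
have hist0 : memL1 mu 0 (fun r => (psi 0 - psi r) ^+ 2).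
  have L : memL1 mu 0 (fun r => rt ^+ 2 * (psi 0 - psi r) ^+ 2).
    apply/(memL1_half_line mu_adm).
    - by apply: measurable_funM.
    - by move=> r; rewrite mulr_ge0 ?sqr_ge0.
    have [_ _ fin] := (sol_phase sol (lexx 0)).2; apply: le_lt_trans fin.
    apply: ge0_integral_ae_le.
    - by move=> s; rewrite /= in_itv /= andbT => s0; apply: pos s0 _;
      rewrite ?sqr_ge0// mulr_ge0 ?sqr_ge0.
    - by move=> s; rewrite /= in_itv /= andbT => s0; apply: pos s0 _;
      rewrite ?sqr_ge0// mulr_ge0 ?sqr_ge0.
    apply: lebesgue_aeS (sq_ae 0 (lexx 0)) => s h; rewrite /= in_itv /= andbT => s0.
    rewrite lee_fin -(h s0) ler_wpM2l ?mu_ge0//.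
    by rewrite -(real_normK (num_real (ip _ e))) ler_pXn2r ?nnegrE// ip_le.
  have := memL1Z (rt ^+ 2)^-1 L.
  by under eq_fun do rewrite mulKf ?gt_eqF//.
have hist : memL1 mu 0 (fun r => psi r ^+ 2).
  have D : memL1 mu 0 (fun r => 2 * (psi 0 ^+ 2 + (psi 0 - psi r) ^+ 2)).
    by apply: memL1Z; apply: memL1D => //; exact: memL1_cst.
  apply: (memL1_le mu_adm _ D); first exact: measurable_funX.
  move=> r _; rewrite ger0_norm ?sqr_ge0//.
  by have := sqr_ge0 (2 * psi 0 - psi r); lra.
have reg : mode_regular mu psi p.
  split => //; split => //; first exact: (derive_loc_unif_cont dpsi p_cont).
  move=> eps eps0.
  have m0 := kernel_mass_ge0 mu_adm; have m1 := kernel_mass_lt1 mu_adm.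
  pose eps1 := Num.min 1 (eps / 4).
  have eps10 : 0 < eps1 by rewrite lt_min ltr01 divr_gt0.
  (* [S] multiplies the mode by [rt], hence the factor [rt ^+ 2], which is divided out again. The
     quarter is what the final bound [2 * (eps / 4 + eps / 4)] requires. *)
  have [d1 d10 H1] := state_close (lexx 0) (mulr_gt0 rt20 (divr_gt0 eps0 (ltr0Sn _ 3))).
  have [d2 d20 H2] := phi_cont 1 eps10.
  exists (Num.min (Num.min d1 d2) 1); first by rewrite !lt_min d10 d20 ltr01.
  move=> h h0; rewrite !lt_min => /andP[/andP[hd1 hd2] hle1].
  have := H1 h (ltW h0); rewrite subr0 gtr0_norm// => /(_ hd1) /phase_terms[_ /= mem].
  set c := psi h - psi 0.
  have cE : `|c| < eps1.
    rewrite /c !psiE// ?(ltW h0)//; apply: H2; rewrite ?lexx ?ler01 ?(ltW h0) ?(ltW hle1)//.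
    by rewrite subr0 gtr0_norm.
  pose G := fun r => (c - (psi (r + h) - psi r)) ^+ 2.
  have mshift : measurable_fun setT (fun r => psi (r + h)).
    by apply: (measurableT_comp mpsi); apply: measurable_funD.
  have mG : measurable_fun setT G.
    by apply: measurable_funX; apply: measurable_funB => //; apply: measurable_funB.
  have fin := memory_space_diff_fin (sol_phase sol (ltW h0)).2 (sol_phase sol (lexx 0)).2.
  rewrite /state /= in fin.
  have Gle : (\int[leb]_(s in `]0%R, +oo[) (mu s * (rt ^+ 2 * G (0 - s)%R))%:E <=
      \int[leb]_(s in `]0%R, +oo[) (mu s * `|S (Defs.eta u h s - Defs.eta u 0 s)| ^+ 2)%:E)%E.
    apply: ge0_integral_ae_le.
    - by move=> s; rewrite /= in_itv /= andbT => s0; apply: pos s0 _;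
      rewrite ?sqr_ge0// mulr_ge0 ?sqr_ge0.
    - by move=> s; rewrite /= in_itv /= andbT => s0; apply: pos s0 _;
      rewrite ?sqr_ge0// mulr_ge0 ?sqr_ge0.
    have := lebesgue_aeI (lebesgue_aeI (dom_ae h (ltW h0)) (psi_ae h (ltW h0)))
      (lebesgue_aeI (dom_ae 0 (lexx 0)) (psi_ae 0 (lexx 0))).
    apply: lebesgue_aeS => s [[a1 a2] [a3 a4]]; rewrite /= in_itv /= andbT => s0.
    have [ss|ns] := pselect (kernel_support mu s); last by rewrite supp// !mul0r.
    rewrite lee_fin ler_wpM2l ?mu_ge0// /G.
    have [_ ->] := linear_operatorB (self_adjoint_linear S_sa) (a1 ss) (a3 ss).
    rewrite -exprMn (_ : rt * _ = ip (S (Defs.eta u h s) - S (Defs.eta u 0 s)) e).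
      by rewrite -(real_normK (num_real (ip _ e))) ler_pXn2r ?nnegrE// ip_le.
    rewrite ipBl !etaE// ?(ltW h0)// /c (_ : 0 - s + h = h - s); [ring|ring].
  have iG' : memL1 mu 0 (fun r => rt ^+ 2 * G r).
    apply/(memL1_half_line mu_adm); last exact: le_lt_trans fin.
    - by apply: measurable_funM.
    - by move=> r; rewrite mulr_ge0 ?sqr_ge0.
  have iG : memL1 mu 0 G.
    have := memL1Z (rt ^+ 2)^-1 iG'.
    by under eq_fun do rewrite mulKf ?gt_eqF//.
  have Gmem : rt ^+ 2 * memint mu 0 G <= rt ^+ 2 * (eps / 4).
    rewrite -memintZ// -half_line_memint//; last by have [] := iG'.
    apply: le_trans mem; rewrite /memory_sqnorm /Rintegral fine_le//.
    + rewrite ge0_fin_numE; first exact: le_lt_trans fin.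
      apply: integral_ge0 => s; rewrite /= in_itv /= andbT => s0.
      by apply: pos s0 _; rewrite ?sqr_ge0// mulr_ge0 ?sqr_ge0.
    + rewrite ge0_fin_numE//.
      apply: integral_ge0 => s; rewrite /= in_itv /= andbT => s0.
      by apply: pos s0 _; rewrite ?sqr_ge0// mulr_ge0 ?sqr_ge0.
  rewrite ler_pM2l// in Gmem.
  have ic := memL1_cst mu_adm 0 (c ^+ 2).
  have mQ : measurable_fun setT (fun r => (psi (r + h) - psi r) ^+ 2).
    by apply: measurable_funX; apply: measurable_funB.
  have ptw r : (psi (r + h) - psi r) ^+ 2 <= 2 * (c ^+ 2 + G r).
    by rewrite /G; have := sqr_ge0 (2 * c - (psi (r + h) - psi r)); lra.
  have iR : memL1 mu 0 (fun r => 2 * (c ^+ 2 + G r)) by apply: memL1Z; exact: memL1D.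
  apply: (@le_trans _ _ (memint mu 0 (fun r => 2 * (c ^+ 2 + G r)))).
    apply: memint_le => //; apply: (memL1_le mu_adm mQ iR) => r _.
    by rewrite ger0_norm ?sqr_ge0.
  rewrite memintZ ?memintD ?memint_cst//; last exact: memL1D.
  have c2 : c ^+ 2 * kernel_mass mu <= eps / 4.
    apply: (@le_trans _ _ (c ^+ 2)); first by rewrite ler_piMr ?sqr_ge0// ltW.
    rewrite -(real_normK (num_real c)).
    have h1 : eps1 <= 1 by rewrite ge_min lexx.
    have h2 : eps1 <= eps / 4 by rewrite ge_min lexx orbT.
    by have := normr_ge0 c; nra.
  lra.
exists psi, p; split => //.
have [utt [_ wutt] eqs] := sol_equations sol.
  have [Floc Fint] := wutt e Se_dom.
  exists (utt ^~ e).
    move=> s t s0 st; split; last exact: Fint.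
    have [mF _ Ffin] := Floc.
    have sub : `[s, t] `<=` (`]0, +oo[ : set R).
      by move=> r /=; rewrite !in_itv /= andbT => /andP[sr _]; rewrite (lt_le_trans s0).
    apply/integrableP; split.
      by apply/measurable_EFinP; apply: measurable_funS mF.
    by apply: Ffin => //; exact: segment_compact.
  apply: lebesgue_aeS eqs => r eqr r0; have [mom _] := eqr r0; rewrite (mom e Se_dom).
  have r_ge0 := ltW r0.
  have [du _] := sol_phase sol r_ge0; rewrite /state /= in du.
  have ir : memL1 mu r (fun x : R => psi r - psi x).
    by apply: memL1B; [exact: memL1_cst|exact: (mr_memL1 mu_adm reg)].
  have -> : \int[leb]_(s in `]0, +oo[) (mu s * ip (S (Defs.eta u r s)) (S e)) =
      memint mu r (fun x : R => rt ^+ 2 * (psi r - psi x)).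
    rewrite -half_line_memint//; last by have [] := memL1Z (rt ^+ 2) ir.
    apply: Rintegral_ae_eq; have := lebesgue_aeI (dom_ae r r_ge0) (psi_ae r r_ge0).
    apply: lebesgue_aeS => s [h1 h2]; rewrite /= in_itv /= andbT => s0.
    have [ss|ns] := pselect (kernel_support mu s); last by rewrite supp// !mul0r.
    by rewrite Se ipZr etaE//; congr (_ * _); ring.
  have ip2 : ip (S (u r)) (S e) = rt ^+ 2 * psi r by rewrite Se ipZr ipSe// psiE// /phi; ring.
  rewrite ip2 memintZ// memintB//; [|exact: memL1_cst|exact: (mr_memL1 mu_adm reg)].
  rewrite (memint_cst mu_adm r (psi r)) ipZl /p; ring.
Qed.

End OneMode.
End SolutionModes.

(** * Parseval decomposition of the energy *)

Section EnergyDecomposition.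
Context {R : realType} {H : completeNormedModType R} (ip : {dot H for idfun}).
Local Notation leb := (@lebesgue_measure R).
Variables (S : operator H) (mu : R -> R).
Hypothesis mu_adm : admissible_kernel mu.
Hypothesis S_sa : self_adjoint ip S.
Variables (e : nat -> H) (rt : nat -> R).
Hypothesis Se_dom : forall k, dom S (e k).
Hypothesis Se : forall k, S (e k) = rt k *: e k.
Hypothesis parseval : forall x, (\sum_(k < n) ip x (e k) ^+ 2) @[n --> \oo] --> `|x| ^+ 2.
Variables (u : R -> H) (psi q : nat -> R -> R) (t : R).
Hypothesis t0 : 0 <= t.
Hypothesis reg : forall k, mode_regular mu (psi k) (q k).
Hypothesis phase : phase_space mu S (state u t).
Hypothesis psiE : forall k, psi k t = ip (u t) (e k).
Hypothesis qE : forall k, q k t = ip (derive1 u t) (e k).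
Hypothesis memE : forall k, {ae leb, forall s, 0 < s ->
  mu s * ip (S (Defs.eta u t s)) (e k) ^+ 2
  = mu s * (rt k ^+ 2 * (psi k t - psi k (t - s)) ^+ 2)}.

Let memory_term k s := (mu s * (rt k ^+ 2 * (psi k t - psi k (t - s)) ^+ 2))%:E.

Let memory_term_ge0 k s : 0 < s -> (0 <= memory_term k s)%E.
Proof.
move=> s0; have [[mu0 _] _ _ _ _] := mu_adm.
by rewrite lee_fin mulr_ge0 ?mu0 ?(ltW s0)// mulr_ge0 ?sqr_ge0.
Qed.

Let memory_term_integral k :
  (\int[leb]_(s in `]0%R, +oo[) memory_term k s = (rt k ^+ 2 * mode_memory mu (psi k) t)%:E)%E.
Proof.
have L := mode_memory_memL1 mu_adm (reg k) t0; have Lk := memL1Z (rt k ^+ 2) L.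
rewrite (ge0_half_line_integral mu_adm t (g := fun r => rt k ^+ 2 * (psi k t - psi k r) ^+ 2)).
- rewrite /mode_memory -memintZ// /memint /Rintegral fineK//.
  by apply: integrable_fin_num => //; case: Lk.
- by case: Lk.
- by move=> r; rewrite mulr_ge0 ?sqr_ge0.
Qed.

(** Parseval's identity is applied to [S (eta u t s)] for almost every [s]; the terms being
    nonnegative, the series is integrated term by term. *)
Let memory_parseval :
  (\sum_(k < n) rt k ^+ 2 * mode_memory mu (psi k) t) @[n --> \oo] -->
  \int[leb]_(s in `]0, +oo[) (mu s * `|S (Defs.eta u t s)| ^+ 2).
Proof.
have [[mu_ge0 _] _ _ [int_mu _] _] := mu_adm.
have /integrableP[/measurable_EFinP mmu _] := int_mu.
have sumE : (\int[leb]_(s in `]0%R, +oo[) (mu s * `|S (Defs.eta u t s)| ^+ 2)%:E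
    = \sum_(k <oo) (rt k ^+ 2 * mode_memory mu (psi k) t)%:E)%E.
  under eq_eseriesr do rewrite -memory_term_integral.
  rewrite -integral_nneseries//; first last.
  - by move=> k s; rewrite /= in_itv /= andbT; exact: memory_term_ge0.
  - move=> k; apply/measurable_EFinP; apply: measurable_funM => //; apply: measurable_funTS.
    have mpsi := mr_measurable (reg k).
    apply: measurable_funM => //; apply: measurable_funX; apply: measurable_funB => //.
    apply: measurableT_comp => //; exact: measurable_funB.
  apply: ge0_integral_ae_eq.
  - by move=> s; rewrite /= in_itv /= andbT => s0;
    rewrite lee_fin mulr_ge0 ?sqr_ge0// mu_ge0// ltW.
  - move=> s; rewrite /= in_itv /= andbT => s0; apply: nneseries_ge0 => k _ _.
    exact: memory_term_ge0.
  have : {ae leb, forall s k, 0 < s -> mu s * ip (S (Defs.eta u t s)) (e k) ^+ 2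
      = mu s * (rt k ^+ 2 * (psi k t - psi k (t - s)) ^+ 2)} by apply: ae_foralln.
  apply: lebesgue_aeS => s h; rewrite /= in_itv /= andbT => s0; apply/esym.
  apply/cvg_lim => //; rewrite /memory_term.
  under eq_fun do rewrite big_mkord sumEFin.
  apply: cvg_EFin; first by near=> n.
  rewrite (_ : _ \o _ = fun n => mu s * \sum_(k < n) ip (S (Defs.eta u t s)) (e k) ^+ 2).
    by apply: cvgMl_tmp; exact: parseval.
  by apply/funext => n /=; rewrite mulr_sumr; apply: eq_bigr => k _; rewrite h.
have fin : (\int[leb]_(s in `]0%R, +oo[) (mu s * `|S (Defs.eta u t s)| ^+ 2)%:E \is a
  fin_num)%E.
  rewrite ge0_fin_numE; first by have [_ []] := phase.
  apply: integral_ge0 => s; rewrite /= in_itv /= andbT => s0.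
  by rewrite lee_fin mulr_ge0 ?sqr_ge0// mu_ge0// ltW.
have mm0 k : (0 <= (rt k ^+ 2 * mode_memory mu (psi k) t)%:E)%E.
  by rewrite lee_fin mulr_ge0 ?sqr_ge0// (mode_memory_ge0 mu_adm).
have : (\sum_(0 <= k < n) (rt k ^+ 2 * mode_memory mu (psi k) t)%:E)%E @[n --> \oo] -->
    (\int[leb]_(s in `]0, +oo[) (mu s * `|S (Defs.eta u t s)| ^+ 2))%:E.
  rewrite /Rintegral fineK// sumE.
  by apply/cvg_ex; eexists; apply: is_cvg_nneseries => k _ _; exact: mm0.
under eq_fun do rewrite big_mkord sumEFin.
by move/fine_cvgP => [_].
Unshelve. all: by end_near. Qed.

Lemma energy_modes :
  (\sum_(k < n) mode_energy mu (rt k ^+ 2) (psi k) (q k) t) @[n --> \oo] --> energy S mu u t.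
Proof.
have -> : (fun n => \sum_(k < n) mode_energy mu (rt k ^+ 2) (psi k) (q k) t) =
    (fun n => 2^-1 * (\sum_(k < n) ip (derive1 u t) (e k) ^+ 2)
      + (1 - kernel_mass mu) / 2 * (\sum_(k < n) ip (S (u t)) (e k) ^+ 2)
      + 2^-1 * (\sum_(k < n) rt k ^+ 2 * mode_memory mu (psi k) t)).
  apply/funext => n; rewrite !mulr_sumr -!big_split; apply: eq_bigr => k _.
  have [du _] := phase.
  rewrite /mode_energy /= qE psiE (self_adjoint_sym S_sa du (Se_dom k)) Se ipZr.
  by rewrite exprMn.
apply: cvgD; [apply: cvgD|]; apply: cvgMl_tmp;
  [exact: parseval|exact: parseval|exact: memory_parseval].
Qed.

End EnergyDecomposition.

(** * Decay of the modes and of the energy *)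

Section ModeDecay.
Context {R : realType} {H : completeNormedModType R} (ip : {dot H for idfun}).
Hypothesis ip_norm : inner_product_norm ip.
Local Notation leb := (@lebesgue_measure R).
Variables (A S : operator H) (mu : R -> R) (e : H) (rt tau C alpha : R).
Hypothesis mu_adm : admissible_kernel mu.
Hypotheses (S_sa : self_adjoint ip S) (Se_dom : dom S e) (Se : S e = rt *: e).
Hypotheses (e1 : `|e| = 1) (rt0 : 0 < rt).
Hypothesis decay : decay_constants ip A S mu tau C alpha.
Variables (b phi p : R -> R).
Hypothesis reg : mode_regular mu phi p.
Hypothesis eqn : mode_equation mu (rt ^+ 2) b tau phi p.
Local Notation E := (mode_energy mu (rt ^+ 2) phi p).

(* The decay hypothesis concerns global solutions, so the mode is continued
   beyond [c] without delay. *)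
Lemma mode_energy_undelayed_decay a c : 0 <= a -> a < c ->
  (forall r, a <= r < c -> b r = 0) -> E c <= C * expR (- alpha * (c - a)) * E a.
Proof.
move=> a0 ac b0; have c0 : 0 < c by rewrite (le_lt_trans a0).
have [psi [q [regq psiE qE qeq]]] := volterra_extension mu_adm reg (sqr_ge0 rt) c0.
pose force r := - (rt ^+ 2) * (psi r - memint mu r psi).
have force_cont : loc_unif_cont force.
  by apply: loc_unif_contZ; exact: (mr_deviation_cont mu_adm (mr_memory regq)).
have integralE s t : 0 < s -> s <= t ->
    \int[leb]_(r in `[s, t]) force r = primitive 0 force t - primitive 0 force s.
  move=> s0 st; apply/esym; apply: derive_integral => // r r0.
  exact: primitive_derive.
(* The coefficient vanishes on the half-open interval only, so the end point [c] is discarded as a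
   null set. Up to [c] the continued mode has the same past as the original one, hence the same
   force. *)
have before s t : a < s -> s <= t -> t <= c ->
    q t - q s = \int[leb]_(r in `[s, t]) force r.
  move=> as_ st tc; have [F Fint Feq] := eqn.
  rewrite !qE ?(le_trans st)//; have [_ ->] := Fint s t (le_lt_trans a0 as_) st.
  apply: Rintegral_ae_eq; have := lebesgue_aeI (lebesgue_ae_neq c) Feq.
  apply: lebesgue_aeS => r [/eqP rc FE]; rewrite /= in_itv /= => /andP[sr rt_].
  have rc' : r < c by rewrite lt_neqAle rc (le_trans rt_).
  have ar : a < r by rewrite (lt_le_trans as_).
  rewrite FE ?(le_lt_trans a0)// b0 ?(ltW ar)// mul0r subr0 /force psiE ?(ltW rc')//.
  by congr (_ * (_ - _)); apply: eq_memint => x xr; rewrite psiE// ltW// (lt_trans xr).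
have qeq' s t : a < s -> s <= t -> q t - q s = \int[leb]_(r in `[s, t]) force r.
  move=> as_ st; have [tc|ct] := leP t c; first exact: before.
  have [cs|sc] := leP c s; first exact: qeq.
  have s0 := le_lt_trans a0 as_.
  have h1 := before s c as_ (ltW sc) (lexx _); have h2 := qeq c t (lexx _) (ltW ct).
  move: h1 h2; rewrite !integralE// ?(ltW sc) ?(ltW ct)//; lra.
have sol := mode_is_solution ip_norm A tau mu_adm S_sa Se_dom Se e1 rt0 erefl a0 regq qeq'.
have [_ _ D] := decay.
have := D _ _ sol (c - a); rewrite subr_ge0 (ltW ac) => /(_ isT).
rewrite !(mode_solution_energy mu_adm S_sa Se_dom Se e1 erefl a0 regq)// ?subr_ge0 ?(ltW ac)//.
rewrite addr0 (addrC a) subrK.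
have EE t : t <= c -> mode_energy mu (rt ^+ 2) psi q t = E t.
  move=> tc; rewrite /mode_energy psiE// qE//; congr (_ + _ * (_ * _)).
  by apply: eq_memint => r rt_; rewrite !psiE// ltW// (lt_le_trans rt_).
by rewrite !EE// ltW.
Qed.

Variables (ts bnd : nat -> R) (Tstar Ttilde d : R).
Hypothesis b_on_off : on_off b ts bnd.
Hypothesis T_even : forall n : nat, ts n.*2.+1 - ts n.*2 = Tstar.
Hypothesis Tstar_ge_tau : tau <= Tstar.
Hypothesis T_odd : forall n : nat, ts n.*2.+2 - ts n.*2.+1 = Ttilde.
Hypothesis Ttilde_le_tau : Ttilde <= tau.
Hypothesis d_bound : forall n, expR (bnd n.*2.+1 * Ttilde) *
  (C * expR (- alpha * Tstar) + 1 - expR (- (bnd n.*2.+1 * Ttilde))) <= d.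

Lemma switching_time_ge0 n : 0 <= ts n.
Proof.
have [ts0 ts_incr _ _ _] := b_on_off.
by elim: n => [|n IHn]; [rewrite ts0|exact: le_trans IHn (ltW (ts_incr n))].
Qed.

Let E_ge0 t : 0 <= E t.
Proof. exact: (mode_energy_ge0 mu_adm phi p (sqr_ge0 rt) t). Qed.

Lemma mode_energy_period n :
  (forall t, ts n.*2 <= t <= ts n.*2.+1 -> E t <= E (ts n.*2)) /\
  (forall t, ts n.*2.+1 <= t <= ts n.*2.+2 -> E t <= d * E (ts n.*2)).
Proof.
have [_ ts_incr bnd0 b_off b_on] := b_on_off.
have Te := T_even n; have To := T_odd n; have a0 := switching_time_ge0 n.*2.
have am := ts_incr n.*2; have mc := ts_incr n.*2.+1; have db := d_bound n.
have B0 := bnd0 n; have boff := b_off n; have bon := b_on n.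
set a := ts n.*2 in Te a0 am boff *; set m := ts n.*2.+1 in Te To am mc boff bon *.
set c := ts n.*2.+2 in To mc bon *; set B := bnd n.*2.+1 in db B0 bon *.
have even t : a <= t <= m -> E t <= E a.
  move=> /andP[at_ tm].
  have := mode_energy_gronwall mu_adm reg (sqr_ge0 rt) eqn a0 at_ (lexx 0) (lexx 0) _.
  rewrite mul0r expR0 mul1r !addr0; apply => r /andP[ar rt_]; left.
  by apply: boff; rewrite (ltW ar) (lt_le_trans rt_).
split=> // t /andP[mt tc].
have m0 := switching_time_ge0 n.*2.+1.
have Em : E m <= C * expR (- alpha * Tstar) * E a.
  by rewrite -Te; apply: mode_energy_undelayed_decay.
have := mode_energy_gronwall mu_adm reg (sqr_ge0 rt) eqn m0 mt (ltW B0) (E_ge0 a) _.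
have delay r : m < r < t -> b r = 0 \/ `|b r| <= B /\ 2^-1 * p (r - tau) ^+ 2 <= E a.
  move=> /andP[mr rt_]; right; split; first by rewrite ltW// bon// (ltW mr) (lt_le_trans rt_).
  apply: le_trans (mode_energy_ge_velocity mu_adm phi p (sqr_ge0 rt) _) _.
  (* [tau <= Tstar] keeps [r - tau] after the start [a] of the period, and [Ttilde <= tau] keeps it
     before the switching time [m]. *)
  apply: even; rewrite lerBrDr lerBlDr; apply/andP; split.
    by rewrite (le_trans _ (ltW mr))// -lerBrDl Te.
  by rewrite (le_trans (ltW rt_))// (le_trans tc)// -lerBlDl To.
move=> /(_ delay) G; set x := B * Ttilde in db.
have ex : expR (B * (t - m)) <= expR x by rewrite ler_expR ler_wpM2l ?(ltW B0)// -To lerD2r.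
have {}G : E t + E a <= expR x * (C * expR (- alpha * Tstar) * E a + E a).
  apply: (le_trans G); apply: ler_pM => //; last by rewrite lerD2r.
    by rewrite addr_ge0 ?E_ge0.
have xx : expR x * expR (- x) = 1 by rewrite -expRD subrr expR0.
have := ler_wpM2r (E_ge0 a) db; rewrite mulrBr xx; lra.
Qed.

Hypothesis d01 : 0 <= d <= 1.

Lemma mode_energy_discrete_decay n t : ts n.*2 <= t <= ts n.*2.+2 -> E t <= d ^+ n * E 0.
Proof.
have /andP[d0 d1] := d01.
have [ts0 ts_incr _ _ _] := b_on_off.
have start k : E (ts k.*2) <= d ^+ k * E 0.
  elim: k => [|k IHk]; first by rewrite ts0 expr0 mul1r.
  have [_ h] := mode_energy_period k.
  rewrite doubleS; apply: le_trans (h _ _) _; first by rewrite lexx andbT ltW.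
  by rewrite (exprS d) -[leRHS]mulrA ler_wpM2l.
move=> /andP[at_ tc]; apply: le_trans (start n).
have [even odd] := mode_energy_period n.
have [tm|mt] := leP t (ts n.*2.+1); first by apply: even; rewrite at_.
by rewrite (le_trans (odd _ _)) ?(ltW mt)// ler_piMl ?E_ge0.
Qed.

End ModeDecay.

(** The number of complete periods exceeds [t / P - 1]; replacing it by [t / P] costs one factor
    [d], which [d^-1] restores. *)
Lemma geometric_exponential_bound {R : realType} (P d t : R) : 0 < P -> 0 < d < 1 -> 0 <= t ->
  d ^+ Num.truncn (t / P) <= d^-1 * expR (- (- ln d / P) * t).
Proof.
move=> P0 /andP[d0 d1] t0; have tP : 0 <= t / P by rewrite divr_ge0// ltW.
rewrite ler_pdivlMl// -exprS -[X in X ^+ _](lnK d0) -expRM_natl ler_expR.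
have /andP[_ h] := truncn_itv tP.
rewrite -mulNr opprK mulrAC -mulrA [leRHS]mulrC.
by rewrite ler_wnM2r ?(ltW h)// ltW// ln_lt0// d0.
Qed.

(** Serves the zero vectors that pad the eigenbasis. The representative of such a mode is controlled
    at negative times only almost everywhere and through the kernel, hence the form of the last
    condition. *)
Lemma vanishing_mode_energy {R : realType} (mu phi p : R -> R) (lam t : R) :
  admissible_kernel mu -> mode_regular mu phi p -> 0 < lam -> 0 <= t -> phi t = 0 -> p t = 0 ->
  {ae (@lebesgue_measure R), forall s, 0 < s ->
    mu s * (lam * (phi t - phi (t - s)) ^+ 2) = 0} ->
  mode_energy mu lam phi p t = 0.
Proof.
move=> mu_adm reg lam0 t0 phi0 p0 mem0; have mphi := mr_measurable reg.
have z : mode_memory mu phi t = 0.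
  rewrite /mode_memory -half_line_memint//; last by apply: measurable_funX;
    exact: measurable_funB.
  rewrite [RHS](_ : 0 = \int[@lebesgue_measure R]_(s in `]0, +oo[) (0 : R)); last first.
    by rewrite Rintegral_cst ?mul0r.
  apply: Rintegral_ae_eq; apply: lebesgue_aeS mem0 => s h; rewrite /= in_itv /= andbT => s0.
  by have /eqP := h s0; rewrite mulrCA mulf_eq0 gt_eqF//= => /eqP.
by rewrite /mode_energy z phi0 p0 expr0n /= !mulr0 !addr0.
Qed.

Unset Implicit Arguments.

Theorem theorem3p13 (R : realType) (H : completeNormedModType R)
    (ip : {dot H for idfun}) (A sqrtA : operator H) (mu : R -> R)
    (tau : R) (b : R -> R) (ts bnd : nat -> R)
    (C alpha Tstar Ttilde d : R)
    (ip_norm : inner_product_norm ip)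
    (A_self_adjoint : self_adjoint ip A)
    (A_positive : positive_operator ip A)
    (A_compact_inverse : has_compact_inverse A)
    (sqrtA_def : is_sqrt_operator ip sqrtA A)
    (tau_gt0 : 0 < tau)
    (mu_admissible : admissible_kernel mu)
    (b_Linfty_loc : locally_ess_bounded b)
    (b_on_off : on_off b ts bnd)
    (C_alpha_decay : decay_constants ip A sqrtA mu tau C alpha)
    (T_even : forall n : nat, ts n.*2.+1 - ts n.*2 = Tstar)
    (Tstar_ge_tau : tau <= Tstar)
    (Tstar_gt : alpha^-1 * ln C < Tstar)
    (T_odd : forall n : nat, ts n.*2.+2 - ts n.*2.+1 = Ttilde)
    (Ttilde_le_tau : Ttilde <= tau)
    (sup_d : ereal_sup (range (fun n : nat =>
       (expR (bnd n.*2.+1 * Ttilde) *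
        (C * expR (- alpha * Tstar) + 1
         - expR (- (bnd n.*2.+1 * Ttilde))))%:E)) = d%:E)
    (d_lt1 : d < 1) :
  exists gamma beta : R, [/\ 0 < gamma, 0 < beta &
    forall u0 u : R -> H, is_solution ip A sqrtA mu b tau u0 u ->
      forall t : R, 0 < t ->
        energy sqrtA mu u t <= gamma * expR (- beta * t) * energy sqrtA mu u 0].
Proof.
have [S_sa _ _ _] := sqrtA_def.
have [e [rt [e_eigen e_norm parseval]]] :=
  sqrt_operator_eigenbasis ip_norm A_self_adjoint A_positive A_compact_inverse sqrtA_def.
have rt0 k : 0 < rt k by have [] := e_eigen k.
have Se_dom k : dom sqrtA (e k) by have [] := e_eigen k.
have Se k : sqrtA (e k) = rt k *: e k by have [] := e_eigen k.
have e_le1 k : `|e k| <= 1 by have [->|->] := e_norm k; rewrite ?normr0.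
have [ts0 ts_incr bnd0 _ _] := b_on_off.
have [C1 alpha0 _] := C_alpha_decay.
have d_bound n : expR (bnd n.*2.+1 * Ttilde) *
    (C * expR (- alpha * Tstar) + 1 - expR (- (bnd n.*2.+1 * Ttilde))) <= d.
  by rewrite -lee_fin -sup_d; apply: ereal_sup_ubound; exists n.
have Ttilde0 : 0 < Ttilde by rewrite -(T_odd 0%N) subr_gt0.
(* The term of index [0] is already positive, since the product of [C] with the exponential is
   positive and [expR (- x) <= 1]. This makes [d^-1] and [ln d] usable as constants. *)
have d0 : 0 < d.
  apply: lt_le_trans (d_bound 0%N); set x := bnd _ * _.
  have x0 : 0 < x by rewrite mulr_gt0// bnd0.
  rewrite mulr_gt0 ?expR_gt0// -addrA ltr_wpDr ?mulr_gt0 ?expR_gt0 ?(lt_trans ltr01)//.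
  by rewrite subr_ge0 -expR0 ler_expR oppr_le0 ltW.
pose P := Tstar + Ttilde.
have P0 : 0 < P by rewrite addr_gt0// (lt_le_trans tau_gt0).
(* All periods have length [P], so the integer part of [t / P] is the index of the period containing
   [t]. *)
have tsE n : ts n.*2 = n%:R * P.
  elim: n => [|n IHn]; first by rewrite ts0 mul0r.
  rewrite doubleS -natr1 mulrDl mul1r -IHn /P -(T_even n) -(T_odd n); ring.
exists d^-1, (- ln d / P); split.
- by rewrite invr_gt0.
- by rewrite divr_gt0// oppr_gt0 ln_lt0// d0.
move=> u0 u sol t t_gt0; have t_ge0 := ltW t_gt0.
have modes k := solution_mode ip_norm mu_admissible S_sa sol (Se_dom k) (Se k) (rt0 k) (e_le1 k).
have [psi modes'] := choice modes; have [q {modes'}modes] := choice modes'.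
have limit s : 0 <= s -> (\sum_(k < n) mode_energy mu (rt k ^+ 2) (psi k) (q k) s) @[n --> \oo]
    --> energy sqrtA mu u s.
  move=> s0; apply: (energy_modes mu_admissible S_sa Se_dom Se parseval s0).
  - by move=> k; have [] := modes k.
  - exact: (sol_phase sol s0).
  - by move=> k; have [_ _ + _ _] := modes k; apply.
  - by move=> k; have [_ _ _ + _] := modes k; apply.
  - by move=> k; have [_ _ _ _ +] := modes k; apply.
have mode_decay k : mode_energy mu (rt k ^+ 2) (psi k) (q k) t <=
    d^-1 * expR (- (- ln d / P) * t) * mode_energy mu (rt k ^+ 2) (psi k) (q k) 0.
  have [reg eqn psiE qE memE] := modes k.
  have [e1|e0] := e_norm k; last first.
    have z s : 0 <= s -> mode_energy mu (rt k ^+ 2) (psi k) (q k) s = 0.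
      move=> s0; apply: vanishing_mode_energy => //.
      - by rewrite exprn_gt0.
      - by rewrite psiE// e0 linear0r.
      - by rewrite qE e0 linear0r.
      - by apply: lebesgue_aeS (memE s s0) => r h r0; rewrite -h// e0 linear0r expr0n mulr0.
    by rewrite !z// mulr0.
  have tP : 0 <= t / P by rewrite divr_ge0// ltW.
  apply: (@le_trans _ _ (d ^+ Num.truncn (t / P) * mode_energy mu (rt k ^+ 2) (psi k) (q k) 0)).
    apply: (mode_energy_discrete_decay ip_norm mu_admissible S_sa (Se_dom k) (Se k) e1 (rt0 k)
      C_alpha_decay reg eqn b_on_off T_even Tstar_ge_tau T_odd Ttilde_le_tau d_bound).
      by rewrite (ltW d0) ltW.
    have /andP[h1 h2] := truncn_itv tP.
    rewrite -doubleS !tsE -ler_pdivlMr// h1 /=.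
    by rewrite -ler_pdivrMr// ltW.
  rewrite ler_wpM2r ?geometric_exponential_bound ?d0//.
  exact: (mode_energy_ge0 mu_admissible (psi k) (q k) (sqr_ge0 (rt k))).
set K := d^-1 * _ in mode_decay *.
have limit0 : (K * \sum_(k < n) mode_energy mu (rt k ^+ 2) (psi k) (q k) 0) @[n --> \oo]
    --> K * energy sqrtA mu u 0.
  by apply: cvgMl_tmp; exact: limit.
apply: (ler_cvg_to (limit t t_ge0) limit0).
by near=> n; rewrite mulr_sumr ler_sum// => k _; exact: mode_decay.
Unshelve. all: by end_near.
Qed.
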